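(* The following decision problem is $\Pi^p_2$-hard: given two finite, $\mathcal{X}$-labeled prime event structures $\mathcal{E}_1$ and $\mathcal{E}_2$, decide whether $\mathcal{L}(\mathcal{E}_1)\subseteq\mathcal{L}(\mathcal{E}_2)$.
   Context: A finite $\mathcal{X}$-labeled prime event structure (FLES) is a tuple $\mathcal{E}=\langle E,<,\#,h\rangle$ where $E$ is a finite set of events, $<$ is a strict partial order on $E$ (causality), $h:E\to\mathcal{X}$ is a labeling, and $\#$ is a symmetric, irreflexive conflict relation on $E$ closed under $<$ (if $e\#e'$ and $e'<e''$ then $e\#e''$). $\mathcal{X}$ contains a distinguished label $\varepsilon$ denoting the empty word. There is a special event $\bot$ with no event below it, $\bot<e$ for all other events $e$, and $h(\bot)=\varepsilon$. A configuration is a left-closed, conflict-free subset $C\subseteq E$; it is maximal if no configuration strictly contains it. A trace of $C$ lists every event of $C$ exactly once such that $e_i<e_j$ implies $i<j$. $T(\mathcal{E})$ is the union of traces of all maximal configurations and $\mathcal{L}(\mathcal{E})=\{h(t)\mid t\in T(\mathcal{E})\}$ with $h$ applied pointwise and $\varepsilon$ contributing nothing. $\Pi^p_2$ is the second universal level of the polynomial hierarchy; hardness is with respect to polynomial-time many-one reductions. *)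

(* Defs.v *)
From mathcomp Require Import all_boot.
Set Implicit Arguments.
Unset Strict Implicit.
Unset Printing Implicit Defensive.

(* Events are 'I_fn; event 0 is the distinguished event bot.           *)
(* Labels are natural numbers; the label 0 is epsilon (empty word).   *)
Record fles := Fles {
  fn  : nat;                 (* number of events (including bot = 0) *)
  flt : nat -> nat -> bool;
  fcf : nat -> nat -> bool;
  flab : nat -> nat
}.

Definition eps : nat := 0.

Definition ev (E : fles) := 'I_(fn E).

Definition wf_fles (E : fles) : Prop :=
  0 < fn E /\
  (forall e : ev E, ~~ flt E e e) /\
  (forall e1 e2 e3 : ev E, flt E e1 e2 -> flt E e2 e3 -> flt E e1 e3) /\
  (forall e1 e2 : ev E, fcf E e1 e2 -> fcf E e2 e1) /\
  (forall e : ev E, ~~ fcf E e e) /\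
  (forall e1 e2 e3 : ev E, fcf E e1 e2 -> flt E e2 e3 -> fcf E e1 e3) /\
  (forall e : ev E, ~~ flt E e 0) /\
  (forall e : ev E, val e != 0 -> flt E 0 e) /\
  flab E 0 = eps.

Definition is_config (E : fles) (C : {set ev E}) : Prop :=
  (forall e e' : ev E, e \in C -> flt E e' e -> e' \in C) /\
  (forall e e' : ev E, e \in C -> e' \in C -> ~~ fcf E e e').

Definition is_max_config (E : fles) (C : {set ev E}) : Prop :=
  is_config C /\ forall C' : {set ev E}, is_config C' -> C \subset C' -> C' = C.

Definition is_trace (E : fles) (C : {set ev E}) (t : seq (ev E)) : Prop :=
  uniq t /\ (forall e, (e \in t) = (e \in C)) /\
  (forall (i j : nat) (d : ev E), i < size t -> j < size t ->
     flt E (nth d t i) (nth d t j) -> i < j).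

Definition word (E : fles) (t : seq (ev E)) : seq nat :=
  [seq flab E (val e) | e <- t & flab E (val e) != eps].

Definition in_lang (E : fles) (w : seq nat) : Prop :=
  exists (C : {set ev E}) (t : seq (ev E)),
    is_max_config C /\ is_trace C t /\ w = word t.

Definition lang_incl (E1 E2 : fles) : Prop :=
  forall w, in_lang E1 w -> in_lang E2 w.

(* number n  ~ n ones followed by a zero (unary);                      *)
(* a FLES    ~ n, then the n labels, then the n*n bit matrix of <,    *)
(*             then the n*n bit matrix of # (row-major);               *)
(* an instance ~ the encodings of E1 and E2 concatenated, nothing else.*)
Fixpoint dec_unary (s : seq bool) : option (nat * seq bool) :=
  match s with
  | [::] => None
  | false :: s' => Some (0, s')
  | true :: s' => if dec_unary s' is Some (n, r) then Some (n.+1, r) else None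
  end.

Fixpoint dec_nats (k : nat) (s : seq bool) : option (seq nat * seq bool) :=
  match k with
  | 0 => Some ([::], s)
  | k'.+1 =>
    match dec_unary s with
    | Some (a, r) =>
      match dec_nats k' r with
      | Some (l, r') => Some (a :: l, r')
      | None => None
      end
    | None => None
    end
  end.

Definition dec_bits (k : nat) (s : seq bool) : option (seq bool * seq bool) :=
  if k <= size s then Some (take k s, drop k s) else None.

Definition mx_of (n : nat) (bs : seq bool) : nat -> nat -> bool :=
  fun i j => (i < n) && (j < n) && nth false bs (i * n + j).

Definition dec_fles (s : seq bool) : option (fles * seq bool) :=
  match dec_unary s with
  | None => None
  | Some (n, s1) =>
    match dec_nats n s1 with
    | None => None
    | Some (labs, s2) =>
      match dec_bits (n * n) s2 with
      | None => None
      | Some (ltb, s3) =>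
        match dec_bits (n * n) s3 with
        | None => None
        | Some (cfb, s4) =>
          Some (Fles n (mx_of n ltb) (mx_of n cfb) (fun i => nth 0 labs i), s4)
        end
      end
    end
  end.

Definition dec_instance (s : seq bool) : option (fles * fles) :=
  match dec_fles s with
  | None => None
  | Some (E1, r) =>
    match dec_fles r with
    | Some (E2, [::]) => Some (E1, E2)
    | _ => None
    end
  end.

Definition INCL (x : seq bool) : Prop :=
  exists E1 E2, dec_instance x = Some (E1, E2) /\
    wf_fles E1 /\ wf_fles E2 /\ lang_incl E1 E2.

(* Deterministic single-tape Turing machines over {0,1,blank}.         *)
Inductive dir := DL | DR | DS.

Record TM := {
  tst : finType;
  tstart : tst;
  tacc : tst;
  trej : tst;
  tdelta : tst -> option bool -> tst * option bool * dir
}.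

(* state, left part (reversed, nearest cell first), head cell, right part *)
Definition tconf (M : TM) := (tst M * seq (option bool) * option bool * seq (option bool))%type.

Definition halted (M : TM) (c : tconf M) : bool :=
  let: (q, _, _, _) := c in (q == @tacc M) || (q == @trej M).

Definition tstep (M : TM) (c : tconf M) : tconf M :=
  if halted c then c else
  let: (q, l, h, r) := c in
  let: (q', w, d) := @tdelta M q h in
  match d with
  | DS => (q', l, w, r)
  | DL => match l with
          | [::] => (q', [::], None, w :: r)
          | a :: l' => (q', l', a, w :: r)
          end
  | DR => match r with
          | [::] => (q', w :: l, None, [::])
          | a :: r' => (q', w :: l, a, r')
          end
  end.

Definition tinit (M : TM) (x : seq bool) : tconf M :=
  match x with
  | [::] => (tstart M, [::], None, [::])
  | b :: x' => (tstart M, [::], Some b, map Some x')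
  end.

Definition trun (M : TM) (t : nat) (x : seq bool) : tconf M :=
  iter t (@tstep M) (tinit M x).

Definition tstate (M : TM) (c : tconf M) : tst M := let: (q, _, _, _) := c in q.

Fixpoint read_word (s : seq (option bool)) : seq bool :=
  match s with
  | Some b :: s' => b :: read_word s'
  | _ => [::]
  end.

Definition toutput (M : TM) (c : tconf M) : seq bool :=
  let: (_, _, h, r) := c in read_word (h :: r).

Definition polyb (c k n : nat) : nat := c * n ^ k + c.

Definition decides_in_time (M : TM) (L : seq bool -> Prop) (p : nat -> nat) : Prop :=
  forall x, exists t, t <= p (size x) /\ halted (trun M t x) /\
    (tstate (trun M t x) = tacc M <-> L x).

Definition computes_in_time (M : TM) (f : seq bool -> seq bool) (p : nat -> nat) : Prop :=
  forall x, exists t, t <= p (size x) /\ tstate (trun M t x) = tacc M /\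
    toutput (trun M t x) = f x.

Definition in_P (L : seq bool -> Prop) : Prop :=
  exists (M : TM) (c k : nat), decides_in_time M L (polyb c k).

Definition poly_computable (f : seq bool -> seq bool) : Prop :=
  exists (M : TM) (c k : nat), computes_in_time M f (polyb c k).

Definition enc_tuple (ws : seq (seq bool)) : seq bool :=
  flatten [seq flatten [seq [:: b; b] | b <- w] ++ [:: false; true] | w <- ws].

Definition in_PiP2 (L : seq bool -> Prop) : Prop :=
  exists (V : seq bool -> Prop) (c k : nat), in_P V /\
    forall x, L x <->
      (forall y, size y <= polyb c k (size x) ->
        exists z, size z <= polyb c k (size x) /\ V (enc_tuple [:: x; y; z])).

Definition pm_reduces (L L' : seq bool -> Prop) : Prop :=
  exists f, poly_computable f /\ forall x, L x <-> L' (f x).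

Definition PiP2_hard (L' : seq bool -> Prop) : Prop :=
  forall L, in_PiP2 L -> pm_reduces L L'.

(* Main.v *)
(** Let L be given by forall y exists z V(x,y,z), with V decided by a machine M in polynomial time.
    The run of M on the encoding of (x,y,z) is described by variables with values below a bound B
    (state, head position and contents of the cells at each time, lengths and bits of y and z),
    subject to constraints that each involve ten variables.

    The second event structure has a hidden choice event for every variable and value, choices
    for the same variable being in conflict; a visible copy of each choice concerning y, caused by
    it; and, for each constraint and each tuple of values of its scope, an event caused by the ten
    corresponding choices, labelled by the constraint if the tuple is legal and by a junk label
    otherwise. Its maximal configurations are the assignments, each assignment enabling exactly one
    event per constraint, and labelled events cause nothing, so the visible ones occur in any order.
    The first structure has the choices concerning y and one event per constraint, all concurrent
    except for conflicts between choices. Hence inclusion of the languages says that every choice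
    of y extends to an assignment satisfying all constraints.

    Events are the 15-digit numbers in base B, so both structures are printed by nested loops that
    test quantifier-free arithmetic formulas. Such register programs are compiled to a one-tape
    machine that keeps the registers in unary on interleaved tracks to the left of its output. *)
From Stdlib Require Import ZArith Lia FunctionalExtensionality.
Require Import Defs.
From mathcomp Require Import all_boot zify.
Set Implicit Arguments.
Unset Strict Implicit.
Unset Printing Implicit Defensive.

(** * Turing machines on two-way infinite tapes *)

(** Of the ten variables of a constraint, six belong to the tableau (state, head position and one
    cell, at two times) and four to the input (the lengths of y and z, one bit of each): where a bit
    of z stands in the first row depends on both lengths. A tuple thus has 15 digits: a type, four
    parameters and ten values; choices use the first five. Every tuple is an event, which spares a
    renumbering; those that code nothing are silent and belong to every maximal configuration.

    The obstacle is that all orders of the labels must be words of the second structure although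
    choices cause constraint events there; so its choices are silent and labelled copies stand above
    them. The first structure cannot keep a choice from announcing a y that is too long; for such a
    choice every constraint holds vacuously.

    Sizes and labels are encoded in unary, so nested loops can print them. The running time is
    replaced by a power T of |x| + 2, which such loops compute, and the run, idle once it has
    halted, is inspected at time T. *)

Definition tape := Z -> option bool.

Definition upd (tp : tape) (p : Z) (w : option bool) : tape :=
  fun z => if Z.eqb z p then w else tp z.

Definition dz (d : dir) : Z :=
  match d with DL => (-1)%Z | DR => 1%Z | DS => 0%Z end.

Lemma updE tp p w : upd tp p w p = w.
Proof. by rewrite /upd Z.eqb_refl. Qed.

Lemma upd_neq tp p w z : z <> p -> upd tp p w z = tp z.
Proof. by rewrite /upd => /Z.eqb_neq ->. Qed.

Lemma upd_id tp p : upd tp p (tp p) = tp.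
Proof.
by apply: functional_extensionality => z; rewrite /upd; case: Z.eqb_spec => // ->.
Qed.

Definition word_tape (x : seq bool) : tape :=
  fun z => if Z.leb 0 z then nth None (map Some x) (Z.to_nat z) else None.

Section AbstractRun.
Variable M : TM.

Definition acfg := (tst M * tape * Z)%type.

Definition ahalted (q : tst M) := (q == tacc M) || (q == trej M).

(** Idling in halted states is made a transition like any other, so the tableau needs no special
    rule for them. *)
Definition adelta (q : tst M) (a : option bool) : tst M * option bool * dir :=
  if ahalted q then (q, a, DS) else tdelta q a.

Definition astep (c : acfg) : acfg :=
  let: (q, tp, p) := c in
  let: (q', w, d) := adelta q (tp p) in (q', upd tp p w, (p + dz d)%Z).

(** The default [None] of [nth] identifies lists that differ by trailing blanks, as the tape
    does. *)
Definition rep (c : tconf M) (a : acfg) : Prop :=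
  let: (q, l, h, r) := c in let: (q', tp, p) := a in
  [/\ q = q', h = tp p,
      forall i, nth None l i = tp (p - 1 - Z.of_nat i)%Z &
      forall i, nth None r i = tp (p + 1 + Z.of_nat i)%Z].

Lemma rep_step c a : rep c a -> rep (tstep c) (astep a).
Proof.
case: c => [[[q l] h] r]; case: a => [[q' tp] p] [<- {q'} -> hl hr].
rewrite /tstep /astep /adelta /ahalted /=; case: ifP => _.
  by rewrite upd_id Z.add_0_r.
case: tdelta => [[q' w] []] /=.
- case: l hl => [|a l] hl; (split => //; last first).
  + case=> [|i] /=; first by rewrite (_ : _ + _ + _ = p)%Z ?updE //; lia.
    by rewrite hr upd_neq; [congr tp; lia | lia].
  + by move=> i; rewrite upd_neq; [move: (hl i.+1); rewrite !nth_nil => ->; congr tp; lia|lia].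
  + by rewrite upd_neq; [move: (hl 0) => /= ->; congr tp; lia|lia].
  + case=> [|i] /=; first by rewrite (_ : _ + _ + _ = p)%Z ?updE //; lia.
    by rewrite hr upd_neq; [congr tp; lia | lia].
  + by move=> i; rewrite upd_neq; [move: (hl i.+1) => /= ->; congr tp; lia|lia].
  + by rewrite upd_neq; [move: (hl 0) => /= ->; congr tp; lia|lia].
- case: r hr => [|a r] hr; (split => //; last first).
  + by move=> i; rewrite upd_neq; [move: (hr i.+1); rewrite !nth_nil => ->; congr tp; lia|lia].
  + case=> [|i] /=; first by rewrite (_ : _ - _ - _ = p)%Z ?updE //; lia.
    by rewrite hl upd_neq; [congr tp; lia | lia].
  + by rewrite upd_neq; [move: (hr 0) => /= ->; congr tp; lia|lia].
  + by move=> i; rewrite upd_neq; [move: (hr i.+1) => /= ->; congr tp; lia|lia].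
  + case=> [|i] /=; first by rewrite (_ : _ - _ - _ = p)%Z ?updE //; lia.
    by rewrite hl upd_neq; [congr tp; lia | lia].
  + by rewrite upd_neq; [move: (hr 0) => /= ->; congr tp; lia|lia].
- by rewrite Z.add_0_r; split => [||i|i] //; rewrite ?updE // upd_neq //; lia.
Qed.

Definition ainit (x : seq bool) : acfg := (tstart M, word_tape x, 0%Z).

Lemma rep_init x : rep (tinit M x) (ainit x).
Proof.
have left i : None = word_tape x (0 - 1 - Z.of_nat i)%Z.
  by rewrite /word_tape; case: Z.leb_spec => //; lia.
have right i : nth None (map Some x) i.+1 = word_tape x (0 + 1 + Z.of_nat i)%Z.
  rewrite /word_tape; case: Z.leb_spec => [_|]; last lia.
  by congr nth; lia.
case: x left right => [|b x] left right; split => // i; rewrite ?nth_nil //.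
by rewrite -(right i) nth_nil.
Qed.

Lemma rep_run t x : rep (trun M t x) (iter t astep (ainit x)).
Proof.
elim: t => [|t IH]; first exact: rep_init.
by rewrite /trun /= -/(trun M t x); apply: rep_step.
Qed.

End AbstractRun.

Lemma read_word_ext s w :
  (forall i, nth None s i = nth None (map Some w) i) -> read_word s = w.
Proof.
elim: w s => [|b w IH] [|a s] //= h.
- by move: (h 0) => /= ->.
- by move: (h 0).
by move: (h 0) => /= ->; rewrite IH // => i; exact: (h i.+1).
Qed.

Lemma rep_output M (c : tconf M) q tp p w :
  rep c (q, tp, p) -> (forall i, tp (p + Z.of_nat i)%Z = nth None (map Some w) i) ->
  tstate c = q /\ toutput c = w.
Proof.
case: c => [[[q' l] h] r] [-> -> _ hr] ht; split=> //=.
have := @read_word_ext (tp p :: r) w; rewrite /=; apply.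
case=> [|i] /=; rewrite -ht; first by congr tp; lia.
by rewrite hr; congr tp; lia.
Qed.


(** * Finite-state tape programs *)

(** A fragment leaves through a transition that returns a value of [X]; later fragments may depend
    on it, so branching on a symbol just read needs no other mechanism. *)
Record frag (X : finType) := Frag {
  fstate : finType;
  fstart : fstate;
  fdelta : fstate -> option bool -> (fstate + X) * option bool * dir
}.

Inductive frun (X : finType) (F : frag X) :
    fstate F -> tape -> Z -> nat -> X -> tape -> Z -> Prop :=
| frun_exit s tp p x w d : fdelta s (tp p) = (inr x, w, d) ->
    frun s tp p 1 x (upd tp p w) (p + dz d)%Z
| frun_step s tp p s' w d t x tp' p' : fdelta s (tp p) = (inl s', w, d) ->
    frun s' (upd tp p w) (p + dz d)%Z t x tp' p' -> frun s tp p t.+1 x tp' p'.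

Definition texec (X : finType) (F : frag X) tp p T x tp' p' :=
  exists2 t, t <= T & frun (fstart F) tp p t x tp' p'.

Lemma texec_le (X : finType) (F : frag X) tp p T T' x tp' p' :
  T <= T' -> texec F tp p T x tp' p' -> texec F tp p T' x tp' p'.
Proof. by move=> le [t lt r]; exists t => //; apply: leq_trans le. Qed.

Definition act (X : finType) (f : option bool -> X * option bool * dir) : frag X :=
  @Frag X unit tt (fun _ a => let: (x, w, d) := f a in (inr x, w, d)).

Lemma texec_act (X : finType) (f : option bool -> X * option bool * dir) tp p x w d :
  f (tp p) = (x, w, d) -> texec (act f) tp p 1 x (upd tp p w) (p + dz d)%Z.
Proof. by move=> e; exists 1 => //; apply: frun_exit => /=; rewrite e. Qed.

(** The dependent sum keeps the returned value [x] in the finite control while [G x] runs. *)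
Definition bind (X Y : finType) (F : frag X) (G : X -> frag Y) : frag Y :=
  @Frag Y (fstate F + {x : X & fstate (G x)})%type (inl (fstart F))
    (fun s a => match s with
     | inl s => let: (r, w, d) := fdelta s a in
         (match r with
          | inl s' => inl (inl s')
          | inr x => inl (inr (Tagged (fun x => fstate (G x)) (fstart (G x))))
          end, w, d)
     | inr u => let: (r, w, d) := fdelta (tagged u) a in
         (match r with
          | inl s' => inl (inr (Tagged (fun x => fstate (G x)) s'))
          | inr y => inr y
          end, w, d)
     end).

Lemma texec_bind (X Y : finType) (F : frag X) (G : X -> frag Y)
    tp p T1 x tp1 p1 T2 y tp2 p2 :
  texec F tp p T1 x tp1 p1 -> texec (G x) tp1 p1 T2 y tp2 p2 ->
  texec (bind F G) tp p (T1 + T2) y tp2 p2.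
Proof.
case=> t1 l1 r1 [t2 l2 r2]; exists (t1 + t2); first exact: leq_add.
have {}r2 : @frun Y (bind F G) (inr (Tagged (fun x => fstate (G x)) (fstart (G x))))
    tp1 p1 t2 y tp2 p2.
  elim: r2 => {t2 l2 y tp2 p2} [s tq q y w d e|s tq q s' w d t y tq' q' e _ IH].
    by apply: frun_exit => /=; rewrite e.
  by apply: frun_step IH; rewrite /= e.
rewrite /=; elim: r1 r2 => {l1} [s tq q {}x w d e|s tq q s' w d t {}x tq' q' e _ IH] r2.
  by apply: frun_step r2; rewrite /= e.
by rewrite addSn; apply: frun_step (IH r2); rewrite /= e.
Qed.

Definition loop (X : finType) (F : frag (option X)) : frag X :=
  @Frag X (fstate F) (fstart F)
    (fun s a => let: (r, w, d) := fdelta s a in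
       (match r with
        | inl s' => inl s'
        | inr None => inl (fstart F)
        | inr (Some x) => inr x
        end, w, d)).

Lemma texec_loop_exit (X : finType) (F : frag (option X)) tp p T x tp' p' :
  texec F tp p T (Some x) tp' p' -> texec (loop F) tp p T x tp' p'.
Proof.
case=> t l r; exists t => //=; move ey : (Some x) r => y r.
elim: r ey => [s tq q {}y w d e|s tq q s' w d {l}t {}y tq' q' e _ IH] ey.
  by apply: frun_exit => /=; rewrite e -ey.
by apply: frun_step (IH ey) => /=; rewrite e.
Qed.

Lemma texec_loop_next (X : finType) (F : frag (option X)) tp p T1 tp1 p1 T2 x tp2 p2 :
  texec F tp p T1 None tp1 p1 -> texec (loop F) tp1 p1 T2 x tp2 p2 ->
  texec (loop F) tp p (T1 + T2) x tp2 p2.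
Proof.
case=> t l r [t2 l2 r2]; exists (t + t2); first exact: leq_add.
suff gen s y : frun (F := F) s tp p t y tp1 p1 -> y = None ->
    frun (F := loop F) s tp p (t + t2) x tp2 p2 by exact: gen r erefl.
move=> {l}{}r; elim: r r2 => [s' tq q {}y w d e|s' tq q s2 w d t' {}y tq' q' e _ IH] r2 ey.
  by rewrite add1n; apply: frun_step r2; rewrite /= e ey.
by rewrite addSn; apply: frun_step (IH r2 ey); rewrite /= e.
Qed.

Definition ret (X : finType) (x : X) : frag X := act (fun a => (x, a, DS)).

Lemma texec_ret (X : finType) (x : X) tp p : texec (ret x) tp p 1 x tp p.
Proof.
have := @texec_act X (fun a => (x, a, DS)) tp p x (tp p) DS erefl.
by rewrite upd_id Z.add_0_r.
Qed.

Definition rd (X : finType) (f : option bool -> X) : frag X :=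
  act (fun a => (f a, a, DS)).

Lemma texec_rd (X : finType) (f : option bool -> X) tp p :
  texec (rd f) tp p 1 (f (tp p)) tp p.
Proof.
have := @texec_act X (fun a => (f a, a, DS)) tp p (f (tp p)) (tp p) DS erefl.
by rewrite upd_id Z.add_0_r.
Qed.

Definition wr (w : option bool) : frag unit := act (fun=> (tt, w, DS)).

Lemma texec_wr w tp p : texec (wr w) tp p 1 tt (upd tp p w) p.
Proof.
by have := @texec_act _ (fun=> (tt, w, DS)) tp p tt w DS erefl; rewrite Z.add_0_r.
Qed.

Fixpoint mv (d : dir) (n : nat) : frag unit :=
  if n is n'.+1 then bind (act (fun a => (tt, a, d))) (fun=> mv d n') else ret tt.

Lemma texec_mv d n tp p : texec (mv d n) tp p n.+1 tt tp (p + Z.of_nat n * dz d)%Z.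
Proof.
elim: n p => [|n IH] p.
  by rewrite Z.mul_0_l Z.add_0_r; exact: texec_ret.
apply: (@texec_bind _ _ _ _ _ _ 1).
  exact: (@texec_act _ (fun a => (tt, a, d))).
rewrite upd_id (_ : p + Z.of_nat n.+1 * dz d = (p + dz d) + Z.of_nat n * dz d)%Z; last by rewrite /dz; case: (d); lia.
exact: IH.
Qed.

Lemma texec_mvL n tp p q : (q = p - Z.of_nat n)%Z -> texec (mv DL n) tp p n.+1 tt tp q.
Proof. by move=> ->; have := texec_mv DL n tp p; congr texec; rewrite /=; lia. Qed.

Lemma texec_mvR n tp p q : (q = p + Z.of_nat n)%Z -> texec (mv DR n) tp p n.+1 tt tp q.
Proof. by move=> ->; have := texec_mv DR n tp p; congr texec; rewrite /=; lia. Qed.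

Notation "F ;; G" := (bind F (fun _ => G)) (at level 61, right associativity).

(* [cells w j] is the cell of track [w] in block [j]; the blocks of [W] cells follow
   each other leftwards from position -2, position -1 stays blank, and positions from 0 on hold
   first the remaining input and later the output. Track 0 marks block 0. *)
Definition ltape (W : nat) (cells : nat -> nat -> option bool) (o : seq bool) : tape :=
  fun z => if Z.leb 0 z then nth None (map Some o) (Z.to_nat z)
           else if Z.eqb z (-1) then None
           else let q := Z.to_nat (-2 - z) in cells (q %% W) (q %/ W).

Definition addr (W w j : nat) : Z := (-2 - Z.of_nat (j * W + w))%Z.

Definition updc (cells : nat -> nat -> option bool) w j v : nat -> nat -> option bool :=
  fun w' j' => if (w' == w) && (j' == j) then v else cells w' j'.

Lemma ltape_addr W cells o w j : w < W -> ltape W cells o (addr W w j) = cells w j.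
Proof.
move=> h; rewrite /ltape /addr.
case: Z.leb_spec; first lia; move=> _; case: Z.eqb_spec; first lia.
rewrite (_ : Z.to_nat _ = j * W + w); last lia.
by rewrite modnMDl divnMDl ?modn_small ?divn_small ?addn0 //; lia.
Qed.

Lemma upd_addr W cells o w j v : w < W ->
  upd (ltape W cells o) (addr W w j) v = ltape W (updc cells w j v) o.
Proof.
move=> h; apply: functional_extensionality => z; rewrite /upd.
case: Z.eqb_spec => [->|ne]; first by rewrite ltape_addr // /updc !eqxx.
rewrite /ltape; case: Z.leb_spec => // z0; case: Z.eqb_spec => // z1.
rewrite /updc; case: andP => // -[/eqP e1 /eqP e2]; case: ne.
rewrite /addr -e1 -e2 -divn_eq; lia.
Qed.

(** * Addressing the tracks from the marked block *)

Definition home : Z := (-2)%Z.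

Lemma addr0 W : addr W 0 0 = home.
Proof. by rewrite /addr /home; lia. Qed.

(** On a track that holds a register in unary, the first block with an empty cell has the value of
    the register as its index. This turns values into addresses. *)
Definition seek (W w : nat) : frag unit :=
  loop (mv DL w ;;
        bind (rd isSome) (fun b : bool =>
          if b then mv DL (W - w) ;; ret None else ret (Some tt))).

Lemma texec_seek W cells o w v j : w < W ->
  (forall i, i < v -> isSome (cells w (j + i))) -> cells w (j + v) = None ->
  texec (seek W w) (ltape W cells o) (addr W 0 j) (v.+1 * (W + 5)) tt
    (ltape W cells o) (addr W w (j + v)).
Proof.
move=> hw; elim: v j => [|v IH] j full stop.
  apply: texec_loop_exit; apply: (@texec_le _ _ _ _ (w.+1 + (1 + 1))); first lia.
  apply: texec_bind; first by apply: (@texec_mvL _ _ _ (addr W w j)); rewrite /addr; lia.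
  have := texec_rd isSome (ltape W cells o) (addr W w j).
  rewrite ltape_addr //; rewrite addn0 in stop *; rewrite stop => r.
  by apply: texec_bind r _; exact: texec_ret.
rewrite (_ : v.+2 * _ = (W + 5) + v.+1 * (W + 5)); last lia.
apply: (@texec_loop_next _ _ _ _ _ (ltape W cells o) (addr W 0 j.+1)).
  apply: (@texec_le _ _ _ _ (w.+1 + (1 + ((W - w).+1 + 1)))); first lia.
  apply: texec_bind; first by apply: (@texec_mvL _ _ _ (addr W w j)); rewrite /addr; lia.
  have := texec_rd isSome (ltape W cells o) (addr W w j).
  rewrite ltape_addr //; move: (full 0 isT); rewrite addn0 => -> r.
  apply: texec_bind r _; apply: texec_bind; last exact: texec_ret.
  by apply: texec_mvL; rewrite /addr mulSn; lia.
rewrite (_ : j + v.+1 = j.+1 + v); last lia.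
apply: IH; last by rewrite addSnnS.
by move=> i hi; rewrite addSnnS; exact: full.
Qed.

Definition gohome (W : nat) : frag unit :=
  loop (bind (rd isSome) (fun b : bool => if b then ret (Some tt) else mv DR W ;; ret None)).

Definition marked (cells : nat -> nat -> option bool) :=
  forall j, isSome (cells 0 j) = (j == 0).

Lemma texec_gohome W cells o v : 0 < W -> marked cells ->
  texec (gohome W) (ltape W cells o) (addr W 0 v) (v.+1 * (W + 5)) tt
    (ltape W cells o) home.
Proof.
move=> hW mk; elim: v => [|v IH].
  apply: texec_loop_exit; apply: (@texec_le _ _ _ _ (1 + 1)); first lia.
  have := texec_rd isSome (ltape W cells o) (addr W 0 0).
  rewrite ltape_addr // mk eqxx => r; apply: texec_bind r _.
  by rewrite addr0; exact: texec_ret.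
rewrite (_ : v.+2 * _ = (W + 5) + v.+1 * (W + 5)); last lia.
apply: texec_loop_next IH; apply: (@texec_le _ _ _ _ (1 + (W.+1 + 1))); first lia.
have := texec_rd isSome (ltape W cells o) (addr W 0 v.+1).
rewrite ltape_addr // mk => r; apply: texec_bind r _.
apply: texec_bind; last exact: texec_ret.
by apply: texec_mvR; rewrite /addr mulSn; lia.
Qed.

(** The cell of track [w] in the block whose index is the register on track [r]. One primitive
    serves for three: with [w = r] it is the first free cell of the register, to be filled by an
    increment; on another register it is filled exactly when [r] is the smaller value; on track 1 it
    is an array entry. *)
Definition access (X : finType) (W r w : nat) (f : option bool -> X * option bool) : frag X :=
  seek W r ;; mv DR r ;; mv DL w ;;
  bind (act (fun a => (f a, DS))) (fun x => mv DR w ;; gohome W ;; ret x).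

Lemma texec_access (X : finType) W r w (f : option bool -> X * option bool) cells o v x c :
  0 < w < W -> r < W -> marked cells ->
  (forall i, i < v -> isSome (cells r i)) -> cells r v = None ->
  f (cells w v) = (x, c) ->
  texec (access W r w f) (ltape W cells o) home (v.+1 * (6 * (W + 5))) x
    (ltape W (updc cells w v c) o) home.
Proof.
move=> /andP[w0 hw] hr mk full stop fE.
apply: (@texec_le _ _ _ _
   (v.+1 * (W + 5) + (r.+1 + (w.+1 + (1 + (w.+1 + (v.+1 * (W + 5) + 1)))))));
  first by rewrite mulnCA; nia.
apply: texec_bind.
  by rewrite -(addr0 W); apply: (@texec_seek W cells o r v 0).
apply: texec_bind; first by apply: (@texec_mvR _ _ _ (addr W 0 v)); rewrite /addr; lia.
apply: texec_bind; first by apply: (@texec_mvL _ _ _ (addr W w v)); rewrite /addr; lia.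
apply: (@texec_bind _ _ _ _ _ _ _ x (ltape W (updc cells w v c) o) (addr W w v)).
  have := @texec_act _ (fun a => (f a, DS)) (ltape W cells o) (addr W w v) x c DS.
  by rewrite ltape_addr // fE Z.add_0_r upd_addr //; apply.
apply: texec_bind; first by apply: (@texec_mvR _ _ _ (addr W 0 v)); rewrite /addr; lia.
apply: texec_bind; last exact: texec_ret.
apply: texec_gohome; first lia.
move=> j; rewrite /updc (_ : (0 == w) = false) ?mk //; lia.
Qed.

Definition wipe (W r : nat) : frag unit :=
  loop (mv DL r ;;
        bind (act (fun a => (isSome a, None, DS))) (fun b : bool =>
          if b then mv DL (W - r) ;; ret None else mv DR r ;; ret (Some tt))) ;;
  gohome W.

Lemma texec_wipe W r cells o v : 0 < r < W -> marked cells ->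
  (forall i, i < v -> isSome (cells r i)) -> (forall i, v <= i -> cells r i = None) ->
  texec (wipe W r) (ltape W cells o) home (v.+1 * (3 * (W + 5))) tt
    (ltape W (fun w j => if w == r then None else cells w j) o) home.
Proof.
move=> /andP[r0 hr] mk full stop.
rewrite (_ : _ * _ = v.+1 * (2 * (W + 5)) + v.+1 * (W + 5)); last lia.
apply: (@texec_bind _ _ _ _ _ _ _ tt
   (ltape W (fun w j => if w == r then None else cells w j) o) (addr W 0 v)); last first.
  apply: texec_gohome; first lia.
  by move=> j; rewrite (_ : (0 == r) = false) ?mk //; lia.
rewrite -(addr0 W).
(* The state after [k] turns: the first [k] cells of the track are wiped. *)
pose cl k w j := if (w == r) && (j < k) then None else cells w j.
have c0 : cl 0 = cells.
  by do 2!apply: functional_extensionality => ?; rewrite /cl ltn0 andbF.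
have cv : cl v = (fun w j => if w == r then None else cells w j).
  do 2!apply: functional_extensionality => ?; rewrite /cl; case: eqP => //= ->.
  by case: ltnP => // /stop ->.
have clS k : updc (cl k) r k None = cl k.+1.
  apply: functional_extensionality => w; apply: functional_extensionality => j.
  rewrite /cl /updc (_ : (j < k.+1) = (j == k) || (j < k)); last lia.
  by case: (_ == r) => //=; case: (_ == k).
(* The last turn writes a blank over a cell that is already blank. *)
have clV : cl v.+1 = cl v.
  apply: functional_extensionality => w; apply: functional_extensionality => j.
  rewrite /cl (_ : (j < v.+1) = (j == v) || (j < v)); last lia.
  by case: eqP => //= ->; case: eqP => //= ->; rewrite ltnn stop.
suff gen k m : k + m = v ->
   texec (loop (mv DL r ;;
        bind (act (fun a => (isSome a, None, DS))) (fun b : bool =>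
          if b then mv DL (W - r) ;; ret None else mv DR r ;; ret (Some tt))))
     (ltape W (cl k) o) (addr W 0 k) (m.+1 * (2 * (W + 5))) tt
     (ltape W (cl v) o) (addr W 0 v).
  by have := gen 0 v erefl; rewrite c0 cv.
elim: m k => [|m IH] k e.
  apply: texec_loop_exit; apply: (@texec_le _ _ _ _ (r.+1 + (1 + (r.+1 + 1)))); first lia.
  apply: texec_bind; first by apply: (@texec_mvL _ _ _ (addr W r k)); rewrite /addr; lia.
  rewrite addn0 in e; subst k.
  have := @texec_act _ (fun a => (isSome a, None, DS)) (ltape W (cl v) o) (addr W r v)
    (isSome (cells r v)) None DS.
  rewrite ltape_addr // {1}/cl ltnn andbF => /(_ erefl); rewrite stop // upd_addr // clS clV.
  rewrite Z.add_0_r => h; apply: texec_bind h _.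
  apply: texec_bind; last exact: texec_ret.
  by apply: texec_mvR; rewrite /addr; lia.
rewrite (_ : m.+2 * _ = 2 * (W + 5) + m.+1 * (2 * (W + 5))); last lia.
apply: (@texec_loop_next _ _ _ _ _ (ltape W (cl k.+1) o) (addr W 0 k.+1)); last first.
  by apply: IH; rewrite addSnnS.
apply: (@texec_le _ _ _ _ (r.+1 + (1 + ((W - r).+1 + 1)))); first lia.
apply: texec_bind; first by apply: (@texec_mvL _ _ _ (addr W r k)); rewrite /addr; lia.
have := @texec_act _ (fun a => (isSome a, None, DS)) (ltape W (cl k) o) (addr W r k)
  (isSome (cells r k)) None DS.
rewrite ltape_addr // {1}/cl ltnn andbF => /(_ erefl); rewrite full ?upd_addr ?clS //; last lia.
rewrite Z.add_0_r => h; apply: texec_bind h _.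
apply: texec_bind; last exact: texec_ret.
by apply: texec_mvL; rewrite /addr mulSn; lia.
Qed.


(** * A register language and its compilation *)

(** The walk stops at the blank in position -1, and the move made while reading it ends at
    [home]. *)
Definition goleft : frag unit :=
  loop (act (fun a => (if isSome a then None else Some tt, a, DL))).

Definition goright (w : option bool) : frag unit :=
  loop (act (fun a => if isSome a then (None, a, DR) else (Some tt, w, DL))).

Lemma ltape_pos W cells o i :
  ltape W cells o (Z.of_nat i) = nth None (map Some o) i.
Proof. by rewrite /ltape; case: Z.leb_spec => [_|]; [rewrite Nat2Z.id|lia]. Qed.

Lemma texec_goleft W cells o i : i <= size o ->
  texec goleft (ltape W cells o) (Z.of_nat i - 1)%Z i.+1 tt (ltape W cells o) home.
Proof.
have step p a x : ltape W cells o p = a -> (if isSome a then None else Some tt) = x ->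
    texec (act (fun a => (if isSome a then None else Some tt, a, DL)))
      (ltape W cells o) p 1 x (ltape W cells o) (p - 1)%Z.
  move=> <- <-; have := @texec_act _ (fun a => (if isSome a then None else Some tt, a, DL))
    (ltape W cells o) p _ (ltape W cells o p) DL erefl.
  by rewrite upd_id.
elim: i => [|i IH] hi.
  by apply: texec_loop_exit; apply: step.
rewrite -[i.+2]add1n.
apply: texec_loop_next (IH _); last exact: ltnW.
rewrite (_ : Z.of_nat i.+1 - 1 = Z.of_nat i)%Z; last lia.
by apply: (step _ (Some (nth false o i))); rewrite // ltape_pos (nth_map false).
Qed.

Lemma texec_goright W cells o i m w : i + m = size o ->
  texec (goright w) (ltape W cells o) (Z.of_nat i) m.+1 tt
    (upd (ltape W cells o) (Z.of_nat (size o)) w) (Z.of_nat (size o) - 1)%Z.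
Proof.
elim: m i => [|m IH] i hi.
  rewrite -hi addn0; apply: texec_loop_exit.
  have := @texec_act _ (fun a => if isSome a then (None, a, DR) else (Some tt, w, DL))
    (ltape W cells o) (Z.of_nat i) (Some tt) w DL.
  by apply; rewrite ltape_pos nth_default // size_map -hi addn0.
rewrite -[m.+2]add1n.
apply: texec_loop_next (IH i.+1 _); last by rewrite addSnnS.
have := @texec_act _ (fun a => if isSome a then (None, a, DR) else (Some tt, w, DL))
    (ltape W cells o) (Z.of_nat i) None (ltape W cells o (Z.of_nat i)) DR.
rewrite upd_id (_ : Z.of_nat i + dz DR = Z.of_nat i.+1)%Z; last by rewrite /dz; lia.
by apply; rewrite ltape_pos (nth_map false) //; lia.
Qed.

Definition push (b : bool) : frag unit := mv DR 2 ;; goright (Some b) ;; goleft.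

Lemma texec_push W cells o b :
  texec (push b) (ltape W cells o) home (2 * size o + 6) tt
    (ltape W cells (rcons o b)) home.
Proof.
apply: (@texec_le _ _ _ _ (3 + ((size o).+1 + (size o).+1))); first lia.
apply: texec_bind; first exact: (@texec_mvR _ _ _ (Z.of_nat 0)).
apply: texec_bind; first exact: texec_goright.
rewrite (_ : upd _ _ _ = ltape W cells (rcons o b)).
  by apply: texec_goleft; rewrite size_rcons.
apply: functional_extensionality => z; rewrite /upd /ltape map_rcons nth_rcons size_map.
case: Z.eqb_spec => [->|ne].
  case: Z.leb_spec; last lia; by rewrite Nat2Z.id ltnn eqxx.
case: Z.leb_spec => // z0; case: ltnP => // h; case: eqP => [|_]; first lia.
by rewrite nth_default ?size_map.
Qed.

(** Taking bits from the end leaves the rest of the input in place, and an exhausted input leaves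
    the region from 0 on blank for the output. On an empty input the bit read is the blank in
    position -1. *)
Definition pop : frag (option bool) :=
  mv DR 2 ;; goright None ;;
  bind (act (fun a => (a, None, DL)))
    (fun x => if isSome x then goleft ;; ret x else ret x).

Lemma texec_pop_nil W cells :
  texec pop (ltape W cells [::]) home 6 None (ltape W cells [::]) home.
Proof.
apply: (@texec_le _ _ _ _ (3 + (1 + (1 + 1)))); first lia.
apply: texec_bind; first exact: (@texec_mvR _ _ _ (Z.of_nat 0)).
apply: texec_bind; first exact: (@texec_goright _ _ [::]).
rewrite (_ : upd _ _ _ = ltape W cells [::]); last first.
  by rewrite -[RHS](upd_id _ (Z.of_nat 0)).
apply: (@texec_bind _ _ _ _ _ _ _ None (ltape W cells [::]) home); last exact: texec_ret.
have := @texec_act _ (fun a => (a, None, DL)) (ltape W cells [::]) (-1)%Z None None DL erefl.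
by rewrite (_ : upd _ _ _ = ltape W cells [::]) // -[RHS](upd_id _ (-1)%Z).
Qed.

Lemma texec_pop_rcons W cells o b :
  texec pop (ltape W cells (rcons o b)) home (2 * size o + 10) (Some b)
    (ltape W cells o) home.
Proof.
apply: (@texec_le _ _ _ _ (3 + ((size o).+2 + (1 + ((size o).+1 + 1))))); first lia.
apply: texec_bind; first exact: (@texec_mvR _ _ _ (Z.of_nat 0)).
apply: texec_bind; first by apply: texec_goright; rewrite size_rcons.
rewrite size_rcons (_ : upd _ _ _ = ltape W cells (rcons o b)); last first.
  by rewrite -[RHS](upd_id _ (Z.of_nat (size o).+1)) ltape_pos nth_default // size_map size_rcons.
apply: (@texec_bind _ _ _ _ _ _ _ (Some b) (ltape W cells o) (Z.of_nat (size o) - 1)%Z); last first.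
  by apply: texec_bind; [exact: texec_goleft|exact: texec_ret].
have e : ltape W cells (rcons o b) (Z.of_nat (size o)) = Some b.
  by rewrite ltape_pos (nth_map false) ?size_rcons // nth_rcons ltnn eqxx.
have := @texec_act _ (fun a => (a, None, DL)) (ltape W cells (rcons o b))
  (Z.of_nat (size o)) (Some b) None DL.
rewrite e => /(_ erefl).
rewrite (_ : Z.of_nat (size o).+1 - 1 = Z.of_nat (size o))%Z; last lia.
rewrite (_ : upd _ _ _ = ltape W cells o) //.
apply: functional_extensionality => z; rewrite /upd /ltape map_rcons nth_rcons size_map.
case: Z.eqb_spec => [->|ne].
  case: Z.leb_spec; last lia; by rewrite Nat2Z.id nth_default ?size_map.
case: Z.leb_spec => // z0; case: ltnP => // h; case: eqP => [|_]; first lia.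
by rewrite nth_default ?size_map.
Qed.

Record st := St { reg : nat -> nat; arr : nat -> option bool; out : seq bool }.

Definition setreg (s : st) r v :=
  St (fun r' => if r' == r then v else reg s r') (arr s) (out s).

Definition addout (s : st) w := St (reg s) (arr s) (out s ++ w).

(* Track 1 is the bit array; register r is written in unary on track r + 2. *)
Definition cellsof (s : st) (w j : nat) : option bool :=
  match w with
  | 0 => if j == 0 then Some true else None
  | 1 => arr s j
  | r.+2 => if j < reg s r then Some true else None
  end.

Definition stape W s := ltape W (cellsof s) (out s).

Lemma marked_cellsof s : marked (cellsof s).
Proof. by case. Qed.

Inductive cmd :=
  | Skip
  | Inc of nat
  | Clear of nat
  | Emit of bool
  | Seq of cmd & cmd
  | IfLt of nat & nat & cmd & cmd
  | IfBit of nat & cmd & cmd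
  | For of nat & nat & cmd.

Definition increg v s := setreg s v (reg s v).+1.

Fixpoint sem (c : cmd) (s : st) : st :=
  match c with
  | Skip => s
  | Inc r => increg r s
  | Clear r => setreg s r 0
  | Emit b => addout s [:: b]
  | Seq c d => sem d (sem c s)
  | IfLt a b c d => if reg s a < reg s b then sem c s else sem d s
  | IfBit a c d => if arr s (reg s a) == Some true then sem c s else sem d s
  | For v b c =>
      setreg (iter (reg s b) (fun s => increg v (sem c s)) (setreg s v 0)) v 0
  end.

(** For a loop, 4 pays for the first clearing, the failing test, the last clearing and the exit; 3
    pays for the test, the increment and the return of each turn. *)
Fixpoint cost (c : cmd) (s : st) : nat :=
  match c with
  | Skip | Inc _ | Clear _ | Emit _ => 1
  | Seq c d => cost c s + cost d (sem c s)
  | IfLt a b c d => (if reg s a < reg s b then cost c s else cost d s).+1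
  | IfBit a c d => (if arr s (reg s a) == Some true then cost c s else cost d s).+1
  | For v b c =>
      4 + \sum_(i < reg s b)
        (3 + cost c (iter i (fun s => increg v (sem c s)) (setreg s v 0)))
  end.

Fixpoint mods (c : cmd) (r : nat) : bool :=
  match c with
  | Skip | Emit _ => false
  | Inc r' | Clear r' => r == r'
  | Seq c d | IfLt _ _ c d | IfBit _ c d => mods c r || mods d r
  | For v b c => (r == v) || mods c r
  end.

(* The compiled loop tests [v < b] again at each turn, while [sem] runs the body exactly [b] times:
   the two agree when the body changes neither register. *)
Fixpoint wf (c : cmd) : bool :=
  match c with
  | Seq c d | IfLt _ _ c d | IfBit _ c d => wf c && wf d
  | For v b c => [&& v != b, ~~ mods c v, ~~ mods c b & wf c]
  | _ => true
  end.

Fixpoint width (c : cmd) : nat :=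
  match c with
  | Inc r | Clear r => r.+1
  | Seq c d => maxn (width c) (width d)
  | IfLt a b c d => maxn (maxn a.+1 b.+1) (maxn (width c) (width d))
  | IfBit a c d => maxn a.+1 (maxn (width c) (width d))
  | For v b c => maxn (maxn v.+1 b.+1) (width c)
  | _ => 0
  end.

Lemma reg_sem c s r : ~~ mods c r -> reg (sem c s) r = reg s r.
Proof.
elim: c s => [|r'|r'|b|c IHc d IHd|a b c IHc d IHd|a c IHc d IHd|v b c IHc] s //=.
- by move/negbTE => ->.
- by move/negbTE => ->.
- by rewrite negb_or => /andP[hc hd]; rewrite IHd // IHc.
- by rewrite negb_or => /andP[hc hd]; case: ifP; rewrite ?IHd ?IHc.
- by rewrite negb_or => /andP[hc hd]; case: ifP; rewrite ?IHd ?IHc.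
rewrite negb_or => /andP[/negbTE ne hc]; rewrite ne.
by elim: (reg s b) => [|n IH] /=; rewrite ne // IHc.
Qed.

Definition bounded N s := (forall r, reg s r <= N) /\ size (out s) <= N.

Lemma bounded_le N N' s : N <= N' -> bounded N s -> bounded N' s.
Proof. by move=> le [h o]; split=> [r|]; apply: leq_trans le. Qed.

(** A unit of cost adds at most one to a register or to the output. Cost therefore also bounds the
    tape in use, hence the time of each compiled operation. *)
Lemma bounded_sem N c s : bounded N s -> bounded (N + cost c s) (sem c s).
Proof.
elim: c N s => [|r'|r'|b|c IHc d IHd|a b c IHc d IHd|a c IHc d IHd|v b c IHc] N s bs /=.
- by apply: bounded_le bs; lia.
- by case: bs => h o; split=> [r|] /=; [case: eqP => _; have := h r; have := h r'; lia|lia].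
- by case: bs => h o; split=> [r|] /=; [case: eqP => _; have := h r; lia|lia].
- by case: bs => h o; split=> [r|] /=; [have := h r; lia|rewrite size_cat /=; lia].
- by rewrite addnA; apply: IHd; apply: IHc.
- by case: ifP => _; [apply: bounded_le (IHc _ _ bs)|apply: bounded_le (IHd _ _ bs)]; lia.
- by case: ifP => _; [apply: bounded_le (IHc _ _ bs)|apply: bounded_le (IHd _ _ bs)]; lia.
have set0 N' s' w : bounded N' s' -> bounded N' (setreg s' w 0).
  by case=> h o; split=> //= r; case: eqP.
apply: (set0); set f := fun s => increg v (sem c s); set s0 := setreg s v 0.
suff: bounded (N + \sum_(i < reg s b) (3 + cost c (iter i f s0))) (iter (reg s b) f s0).
  by move=> h; apply: bounded_le h; rewrite leq_add2l leq_addl.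
elim: (reg s b) => [|n IH]; first by rewrite big_ord0 addn0; apply: set0.
rewrite big_ord_recr /= addnA; move: (\sum_(i < n) _) IH => S IH.
have [h o] := IHc _ _ IH.
split=> /= [r|]; last lia.
by case: eqP => _; [have := h v|have := h r]; lia.
Qed.

Section Compile.
Variable W : nat.

Fixpoint compile (c : cmd) : frag unit :=
  match c with
  | Skip => ret tt
  | Inc r => access W r.+2 r.+2 (fun=> (tt, Some true))
  | Clear r => wipe W r.+2
  | Emit b => push b
  | Seq c d => compile c ;; compile d
  | IfLt a b c d =>
      bind (access W a.+2 b.+2 (fun x => (isSome x, x)))
        (fun t : bool => if t then compile c else compile d)
  | IfBit a c d =>
      bind (access W a.+2 1 (fun x => (x == Some true, x)))
        (fun t : bool => if t then compile c else compile d)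
  | For v b c =>
      wipe W v.+2 ;;
      loop (bind (access W v.+2 b.+2 (fun x => (isSome x, x))) (fun t : bool =>
        if t then compile c ;; access W v.+2 v.+2 (fun=> (tt, Some true)) ;; ret None
        else wipe W v.+2 ;; ret (Some tt)))
  end.

Definition unitcost N := N.+1 * (6 * (W + 5)).

Lemma stape_inc s r : ltape W (updc (cellsof s) r.+2 (reg s r) (Some true)) (out s) =
  stape W (increg r s).
Proof.
congr ltape; apply: functional_extensionality => w; apply: functional_extensionality => j.
rewrite /updc; case: w => [|[|w]] //=; rewrite !eqSS; case: eqP => //= ->.
rewrite (_ : (j < (reg s r).+1) = (j == reg s r) || (j < reg s r)); last lia.
by case: (j == _).
Qed.

Lemma stape_clear s r :
  ltape W (fun w j => if w == r.+2 then None else cellsof s w j) (out s) =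
  stape W (setreg s r 0).
Proof.
congr ltape; apply: functional_extensionality => w; apply: functional_extensionality => j.
by case: w => [|[|w]] //=; rewrite !eqSS; case: eqP.
Qed.

Lemma texec_inc s r N : r.+2 < W -> bounded N s ->
  texec (access W r.+2 r.+2 (fun=> (tt, Some true))) (stape W s) home (unitcost N) tt
    (stape W (increg r s)) home.
Proof.
move=> hr [h _]; rewrite -stape_inc.
apply: (@texec_le _ _ _ _ ((reg s r).+1 * (6 * (W + 5)))); first by rewrite leq_mul2r ltnS h orbT.
apply: texec_access => //=; first exact: marked_cellsof.
- by move=> i ->.
- by rewrite ltnn.
Qed.

Lemma texec_clear s r N : r.+2 < W -> bounded N s ->
  texec (wipe W r.+2) (stape W s) home (unitcost N) tt (stape W (setreg s r 0)) home.
Proof.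
move=> hr [h _]; rewrite -stape_clear.
apply: (@texec_le _ _ _ _ ((reg s r).+1 * (3 * (W + 5)))).
  by apply: leq_mul; rewrite ?ltnS ?h //; lia.
apply: texec_wipe => //=; first exact: marked_cellsof.
- by move=> i ->.
- by move=> i; rewrite ltnNge => ->.
Qed.

Lemma updc_id cells w j : updc cells w j (cells w j) = cells.
Proof.
apply: functional_extensionality => w'; apply: functional_extensionality => j'.
by rewrite /updc; case: andP => // -[/eqP-> /eqP->].
Qed.

Lemma texec_test s r w N (f : option bool -> bool) : r.+2 < W -> 0 < w < W -> bounded N s ->
  texec (access W r.+2 w (fun x => (f x, x))) (stape W s) home (unitcost N)
    (f (cellsof s w (reg s r))) (stape W s) home.
Proof.
move=> hr hw [h _]; rewrite {2}/stape -{2}(updc_id (cellsof s) w (reg s r)).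
apply: (@texec_le _ _ _ _ ((reg s r).+1 * (6 * (W + 5)))); first by rewrite leq_mul2r ltnS h orbT.
apply: texec_access => //=; first exact: marked_cellsof.
- by move=> i ->.
- by rewrite ltnn.
Qed.

Lemma unitcost_gt0 N : 0 < unitcost N.
Proof. by rewrite /unitcost muln_gt0; lia. Qed.

Lemma texec_compile c s N : width c + 2 <= W -> wf c -> bounded N s ->
  texec (compile c) (stape W s) home (cost c s * unitcost (N + cost c s)) tt
    (stape W (sem c s)) home.
Proof.
(* One [N] above all sizes reached gives every operation the same price, so the times of subcommands
   add up. *)
suff gen N' s' : width c + 2 <= W -> wf c -> bounded N' s' -> forall N, N' + cost c s' <= N ->
    texec (compile c) (stape W s') home (cost c s' * unitcost N) tt (stape W (sem c s')) home.
  by move=> h1 h2 h3; apply: gen h3 _ _.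
elim: c N' s' => {s N} [|r|r|b|c IHc d IHd|a b c IHc d IHd|a c IHc d IHd|v b c IHc] N' s hW hwf bs N hN /=;
  rewrite /= in hW hwf hN; have bN : bounded N s by apply: bounded_le bs; lia.
- by rewrite mul1n; apply: texec_le (texec_ret _ _ _); apply: unitcost_gt0.
- by rewrite mul1n; apply: texec_inc => //; lia.
- by rewrite mul1n; apply: texec_clear => //; lia.
- rewrite mul1n /stape /= cats1; apply: texec_le (texec_push _ _ _ _).
  by case: bN => _ o; rewrite /unitcost; lia.
- move: hwf => /andP[wc wd]; rewrite mulnDl.
  apply: (@texec_bind _ _ _ _ _ _ _ tt (stape W (sem c s)) home).
    by apply: (IHc N') => //; lia.
  by apply: (IHd (N' + cost c s)) => //; [lia|apply: bounded_sem|lia].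
- move: hwf => /andP[wc wd]; rewrite mulSn.
  apply: texec_bind; first by apply: texec_test => //; lia.
  rewrite /=; case: ifP hN => _ hN /=; [apply: (IHc N')|apply: (IHd N')] => //; lia.
- move: hwf => /andP[wc wd]; rewrite mulSn.
  apply: texec_bind; first by apply: texec_test => //; lia.
  rewrite /=; case: ifP hN => _ hN /=; [apply: (IHc N')|apply: (IHd N')] => //; lia.
move: hwf => /and4P[vb mv mb wc]; rewrite mulnDl.
rewrite (_ : 4 * unitcost N = unitcost N + 3 * unitcost N); last lia.
rewrite -addnA; apply: texec_bind; first by apply: texec_clear => //; lia.
set s0 := setreg s v 0; set f := fun s => increg v (sem c s).
have b0 : bounded N' s0 by case: bs => h o; split=> //= r; case: eqP.
have itv i : reg (iter i f s0) v = i.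
  by elim: i => [|i IH] /=; rewrite eqxx // reg_sem ?IH.
have itb i : reg (iter i f s0) b = reg s b.
  by elim: i => [|i IH] /=; rewrite eq_sym (negbTE vb) // reg_sem ?IH.
pose cst k i := \sum_(j < k) (3 + cost c (iter (i + j) f s0)).
have cstS k i : cst k.+1 i = (3 + cost c (iter i f s0)) + cst k i.+1.
  rewrite /cst big_ord_recl addn0; congr addn; apply: eq_bigr => j _.
  by rewrite lift0 -addSnnS.
suff gen k i : i + k = reg s b -> forall N'', bounded N'' (iter i f s0) -> N'' + cst k i <= N ->
    texec (loop (bind (access W v.+2 b.+2 (fun x => (isSome x, x))) (fun t : bool =>
        if t then compile c ;; access W v.+2 v.+2 (fun=> (tt, Some true)) ;; ret None
        else wipe W v.+2 ;; ret (Some tt))))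
      (stape W (iter i f s0)) home (3 * unitcost N + cst k i * unitcost N) tt
      (stape W (setreg (iter (reg s b) f s0) v 0)) home.
  by apply: (gen (reg s b) 0 erefl N' b0); apply: leq_trans hN; rewrite leq_add2l leq_addl.
elim: k i => [|k IH] i hi N'' bi le.
  apply: texec_loop_exit; have {}bi : bounded N (iter i f s0) by apply: bounded_le bi; lia.
  apply: (@texec_le _ _ _ _ (unitcost N + (unitcost N + 1))).
    by have := unitcost_gt0 N; lia.
  apply: texec_bind; first by apply: texec_test => //; lia.
  rewrite /= itv itb -hi addn0 ltnn; apply: texec_bind; last exact: texec_ret.
  by apply: texec_clear => //; lia.
rewrite cstS in le *.
rewrite (_ : _ + _ = (unitcost N + (cost c (iter i f s0) * unitcost N + (unitcost N + unitcost N)))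
   + (3 * unitcost N + cst k i.+1 * unitcost N)); last by rewrite !mulnDl; lia.
have bc := bounded_sem c bi.
have b1 : bounded (N'' + (3 + cost c (iter i f s0))) (iter i.+1 f s0).
  rewrite /=; case: bc => h o; split=> /= [r|]; last by lia.
  by case: eqP => _; [have := h v|have := h r]; lia.
apply: texec_loop_next (IH i.+1 _ _ b1 _); rewrite ?addSnnS //; last by lia.
apply: texec_bind; first by apply: texec_test (bounded_le _ bi) => //; lia.
rewrite /= itv itb (_ : (i < reg s b) = true) /=; last lia.
apply: texec_bind; first by apply: (IHc N'') => //; lia.
apply: texec_bind; first by apply: texec_inc (bounded_le _ bc) => //; lia.
by apply: texec_le (texec_ret _ _ _); apply: unitcost_gt0.
Qed.

End Compile.


(** * Polynomial bounds, loops and tests *)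

(** The base [n.+1] is positive, so raising the exponent never lowers the bound, not even at 0. *)
Definition polybounded (f : nat -> nat) := exists c k, forall n, f n <= c * n.+1 ^ k.

Lemma pb_le f g : (forall n, f n <= g n) -> polybounded g -> polybounded f.
Proof. by move=> le [c [k h]]; exists c, k => n; apply: leq_trans (h n). Qed.

Lemma pb_const a : polybounded (fun=> a).
Proof. by exists a, 0 => n; rewrite expn0 muln1. Qed.

Lemma pb_id : polybounded id.
Proof. by exists 1, 1 => n; rewrite expn1 mul1n. Qed.

Lemma pb_add f g : polybounded f -> polybounded g -> polybounded (fun n => f n + g n).
Proof.
move=> [c [k h]] [c' [k' h']]; exists (c + c'), (k + k') => n.
rewrite mulnDl; apply: leq_add; [apply: leq_trans (h n) _|apply: leq_trans (h' n) _];
  by rewrite leq_mul2l leq_pexp2l ?leq_addr ?leq_addl ?orbT.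
Qed.

Lemma pb_mul f g : polybounded f -> polybounded g -> polybounded (fun n => f n * g n).
Proof.
move=> [c [k h]] [c' [k' h']]; exists (c * c'), (k + k') => n.
by rewrite expnD mulnACA leq_mul.
Qed.

Lemma pb_exp f k : polybounded f -> polybounded (fun n => f n ^ k).
Proof.
move=> pf; elim: k => [|k IH]; first exact: pb_const.
by apply: pb_le (pb_mul pf IH) => n; rewrite expnS.
Qed.

Lemma pb_comp f g : polybounded f -> polybounded g -> polybounded (fun n => f (g n)).
Proof.
move=> [c [k h]] pg; apply: pb_le (fun n => h (g n)) _.
apply: pb_mul; first exact: pb_const.
apply: pb_exp; apply: pb_le (pb_add pg (pb_const 1)) => n; by rewrite addn1.
Qed.

Lemma pb_polyb c k : polybounded (polyb c k).
Proof.
by apply: pb_add (pb_const c); apply: pb_mul (pb_const c) (pb_exp k pb_id).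
Qed.

(** For positive n, n + 1 is at most 2n, at the price of a factor [2 ^ k]; the additive constant of
    [polyb] covers n = 0. *)
Lemma polyb_pb f : polybounded f -> exists c k, forall n, f n <= polyb c k n.
Proof.
move=> [c [k h]]; exists (c * 2 ^ k), k => n; apply: leq_trans (h n) _.
rewrite /polyb -[X in _ + X]muln1 -mulnDr -mulnA leq_mul2l; apply/orP; right.
case: n {h} => [|n].
  by rewrite exp1n muln_gt0 expn_gt0 /= addn1.
rewrite mulnDr -expnMn; apply: leq_trans (leq_addr _ _).
by case: k => // k; rewrite leq_exp2r //; lia.
Qed.

(* [Bd] contains the registers that bound loops; they change only as loop counters, so a bound
   [R] on their initial values persists. *)
Section StaticCost.
Variable Bd : pred nat.

Fixpoint boundable (c : cmd) : bool :=
  match c with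
  | Inc r => ~~ Bd r
  | Seq c d | IfLt _ _ c d | IfBit _ c d => boundable c && boundable d
  | For v b c => Bd b && boundable c
  | _ => true
  end.

Fixpoint maxcost (c : cmd) (R : nat) : nat :=
  match c with
  | Skip | Inc _ | Clear _ | Emit _ => 1
  | Seq c d => maxcost c R + maxcost d R
  | IfLt _ _ c d | IfBit _ c d => (maxcost c R + maxcost d R).+1
  | For v b c => 4 + R * (3 + maxcost c R)
  end.

Lemma pb_maxcost c : polybounded (maxcost c).
Proof.
elim: c => [|r|r|b|c IHc d IHd|a b c IHc d IHd|a c IHc d IHd|v b c IHc] /=;
  try exact: pb_const.
- exact: pb_add.
- exact: pb_add (pb_const 1) (pb_add IHc IHd).
- exact: pb_add (pb_const 1) (pb_add IHc IHd).
exact: pb_add (pb_const 4) (pb_mul pb_id (pb_add (pb_const 3) IHc)).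
Qed.

Lemma cost_max c s R : wf c -> boundable c -> (forall r, Bd r -> reg s r <= R) ->
  cost c s <= maxcost c R /\ forall r, Bd r -> reg (sem c s) r <= R.
Proof.
elim: c s => [|r|r|b|c IHc d IHd|a b c IHc d IHd|a c IHc d IHd|v b c IHc] s //= hw hb hs.
- by split=> // r' hr'; case: eqP => [e|_]; [rewrite -e hr' in hb|exact: hs].
- by split=> // r' hr'; case: eqP => // _; exact: hs.
- move: hw hb => /andP[wc wd] /andP[bc bd]; have [c1 s1] := IHc s wc bc hs.
  by have [c2 s2] := IHd _ wd bd s1; split=> //; apply: leq_add.
- move: hw hb => /andP[wc wd] /andP[bc bd]; have [c1 s1] := IHc s wc bc hs.
  by have [c2 s2] := IHd s wd bd hs; case: ifP; split=> //; rewrite ltnS; lia.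
- move: hw hb => /andP[wc wd] /andP[bc bd]; have [c1 s1] := IHc s wc bc hs.
  by have [c2 s2] := IHd s wd bd hs; case: ifP; split=> //; rewrite ltnS; lia.
move: hw hb => /and4P[vb mv mb wc] /andP[Bb bc].
set s0 := setreg s v 0; set f := fun s => increg v (sem c s).
have itv i : reg (iter i f s0) v = i.
  by elim: i => [|i IH] /=; rewrite eqxx // reg_sem ?IH.
(* A register of [Bd] may be the counter itself; its value [i] stays below that of [b], which is in
   [Bd]. *)
have inv i : i <= reg s b -> forall r, Bd r -> reg (iter i f s0) r <= R.
  elim: i => [|i IH] hi r hr /=; case: eqP => // e; first exact: hs.
    by rewrite reg_sem // itv; apply: leq_trans hi (hs _ Bb).
  by have [_ /(_ r hr)] := IHc (iter i f s0) wc bc (IH (ltnW hi)).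
split; last by move=> r hr /=; case: eqP => // _; apply: inv.
rewrite leq_add2l; apply: (@leq_trans (\sum_(i < reg s b) (3 + maxcost c R))).
  apply: leq_sum => i _; rewrite leq_add2l.
  by have [] := IHc (iter i f s0) wc bc (inv i (ltnW (ltn_ord i))).
by rewrite sum_nat_const card_ord leq_mul2r hs ?orbT.
Qed.

End StaticCost.

Lemma st_ext s s' : reg s =1 reg s' -> arr s = arr s' -> out s = out s' -> s = s'.
Proof.
by case: s s' => [r a o] [r' a' o'] /= /functional_extensionality -> -> ->.
Qed.

Definition zero_on (Z : seq nat) (s : st) := forall r, r \in Z -> reg s r = 0.

(** [Z] lists loop counters that start at 0. A loop resets its counter, so the final state differs
    from the initial one in [r] only, and meanings become equations between states. *)
Definition adds (r : nat) (Z : seq nat) (b : nat) (c : cmd) (g : nat -> nat) :=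
  forall s, zero_on Z s -> sem c s = setreg s r (reg s r + g (reg s b)).

Lemma adds_inc r b : adds r [::] b (Inc r) (fun=> 1).
Proof. by move=> s _; rewrite addn1. Qed.

Lemma adds_seq r Z b c d g h : r \notin Z -> r != b ->
  adds r Z b c g -> adds r Z b d h -> adds r Z b (Seq c d) (fun x => g x + h x).
Proof.
move=> rZ rb hc hd s z /=; rewrite hc // hd => [|r' hr'].
  rewrite /= eqxx eq_sym (negbTE rb) addnA.
  by apply: st_ext => // x /=; case: eqP.
by rewrite /=; case: eqP => [e|_]; [rewrite -e hr' in rZ|exact: z].
Qed.

Lemma adds_for r Z b c g v : v != b -> r != v -> r != b -> r \notin Z -> v \notin Z ->
  adds r Z b c g -> adds r (v :: Z) b (For v b c) (fun x => x * g x).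
Proof.
move=> vb rv rb rZ vZ hc s z /=.
set s0 := setreg s v 0; set f := fun s => increg v (sem c s).
have it i : iter i f s0 = setreg (setreg s r (reg s r + i * g (reg s b))) v i.
  elim: i => [|i IH]; first by apply: st_ext => // x /=; rewrite addn0; case: eqP => // _; case: eqP => // ->.
  rewrite /= IH /f hc => [|r' hr'].
    have [br bv vr] : [/\ (b == r) = false, (b == v) = false & (v == r) = false].
      by rewrite ![_ == r]eq_sym [b == v]eq_sym (negbTE rv) (negbTE rb) (negbTE vb).
    apply: st_ext => // x /=; rewrite !eqxx (negbTE rv) vr br bv mulSn.
    by case: eqP => // _; case: eqP => // _; lia.
  rewrite /=; case: eqP => [e|_]; first by rewrite -e hr' in vZ.
  case: eqP => [e|_]; first by rewrite -e hr' in rZ.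
  by apply: z; rewrite inE hr' orbT.
rewrite it; apply: st_ext => // x /=; case: eqP => // ->.
by rewrite eq_sym (negbTE rv) z // mem_head.
Qed.

(** * Programs that print words *)

Section Emit.
Variable A : nat -> option bool.

Definition env := nat -> nat.

Definition setr (rho : env) r v : env := fun r' => if r' == r then v else rho r'.

Definition emits (Z : seq nat) (c : cmd) (w : env -> seq bool) :=
  forall s, arr s = A -> zero_on Z s -> sem c s = addout s (w (reg s)).

Lemma addoutA s w w' : addout (addout s w) w' = addout s (w ++ w').
Proof. by apply: st_ext => //=; rewrite catA. Qed.

Lemma addout0 s : addout s [::] = s.
Proof. by apply: st_ext => //=; rewrite cats0. Qed.

Lemma emits_sub Z Z' c w : {subset Z <= Z'} -> emits Z c w -> emits Z' c w.
Proof. by move=> sZ h s a z; apply: h => // r /sZ; exact: z. Qed.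

Lemma emits_skip Z : emits Z Skip (fun=> [::]).
Proof. by move=> s _ _; rewrite addout0. Qed.

Lemma emits_emit Z b : emits Z (Emit b) (fun=> [:: b]).
Proof. by []. Qed.

Lemma emits_seq Z c d w w' : emits Z c w -> emits Z d w' ->
  emits Z (Seq c d) (fun rho => w rho ++ w' rho).
Proof. by move=> hc hd s a z; rewrite /= hc // hd // addoutA. Qed.

Lemma emits_for Z v b c w : v \notin Z -> v != b -> emits Z c w ->
  emits (v :: Z) (For v b c)
    (fun rho => flatten [seq w (setr rho v i) | i <- iota 0 (rho b)]).
Proof.
move=> vZ vb hc s a z /=.
set s0 := setreg s v 0; set f := fun s => increg v (sem c s).
have it i : iter i f s0 =
    setreg (addout s (flatten [seq w (setr (reg s) v i) | i <- iota 0 i])) v i.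
  elim: i => [|i IH]; first by rewrite addout0.
  rewrite [iter _ _ _]/= IH /f hc // => [|r hr].
    rewrite -addn1 iotaD map_cat flatten_cat /= cats0.
    by apply: st_ext => [x||] //=; rewrite ?eqxx ?addn1 ?catA //; case: eqP.
  by rewrite /=; case: eqP => [e|_]; [rewrite -e hr in vZ|apply: z; rewrite inE hr orbT].
by rewrite it; apply: st_ext => // x /=; case: eqP => // ->; rewrite z ?mem_head.
Qed.

Fixpoint loops (vs : seq nat) (b : nat) (c : cmd) : cmd :=
  if vs is v :: vs' then For v b (loops vs' b c) else c.

(** This lexicographic order is the one in which nested loops visit the tuples; the position of a
    tuple in it is the number of its event. *)
Fixpoint tups (B k : nat) : seq (seq nat) :=
  if k is k'.+1 then [seq i :: t | i <- iota 0 B, t <- tups B k'] else [:: [::]].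

Fixpoint setrs (rho : env) (vs ds : seq nat) : env :=
  if vs is v :: vs' then
    if ds is d :: ds' then setrs (setr rho v d) vs' ds' else rho
  else rho.

Lemma emits_loops Z vs b c w : uniq (b :: vs) -> ~~ has (mem Z) vs -> emits Z c w ->
  emits (vs ++ Z) (loops vs b c)
    (fun rho => flatten [seq w (setrs rho vs ds) | ds <- tups (rho b) (size vs)]).
Proof.
elim: vs => [|v vs IH] /=; first by move=> _ _ h s a z; rewrite h //= cats0.
rewrite inE !negb_or => /and3P[/andP[bv bvs] vvs uvs] /andP[vZ nZ] hc s a z.
rewrite (emits_for (Z := vs ++ Z) _ _ (IH _ _ hc)) //; first last.
- by rewrite /= bvs.
- by rewrite eq_sym.
- by rewrite mem_cat negb_or vvs.
congr addout.
have -> : (fun i => flatten [seq w (setrs (setr (reg s) v i) vs ds)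
     | ds <- tups (setr (reg s) v i b) (size vs)]) =
   (fun i => flatten [seq w (setrs (reg s) (v :: vs) ds)
     | ds <- [seq i :: t | t <- tups (reg s b) (size vs)]]).
  apply: functional_extensionality => i; rewrite -map_comp.
  by rewrite {2}/setr (negbTE bv).
elim: (iota _ _) => [|i l IHl] //=.
by rewrite map_cat flatten_cat IHl.
Qed.

(** Comparing sums of registers is linear arithmetic over the naturals: a repeated register is a
    coefficient, and what would be subtracted moves to the other side. *)
Inductive fm :=
  | LeSum of seq nat & seq nat
  | BitAt of nat
  | Neg of fm
  | Conj of fm & fm
  | Truth.

Definition sumr (rho : env) (l : seq nat) := sumn (map rho l).

Fixpoint feval (rho : env) (f : fm) : bool :=
  match f with
  | LeSum l1 l2 => sumr rho l1 <= sumr rho l2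
  | BitAt r => A (rho r) == Some true
  | Neg f => ~~ feval rho f
  | Conj f g => feval rho f && feval rho g
  | Truth => true
  end.

Variables t1 t2 tk : nat.
Hypothesis ut : uniq [:: t1; t2; tk].

Fixpoint addl (r : nat) (l : seq nat) : cmd :=
  if l is x :: l' then Seq (For tk x (Inc r)) (addl r l') else Skip.

(** Conjunctions copy the branch [d]. This affects only the length of the program, which is
    independent of the input. The two sums are cleared before a branch is entered, so that nested
    tests can reuse their registers. *)
Fixpoint cond (f : fm) (c d : cmd) : cmd :=
  match f with
  | LeSum l1 l2 =>
      let clear := Seq (Clear t1) (Clear t2) in
      Seq (addl t1 l1) (Seq (addl t2 l2)
        (IfLt t2 t1 (Seq clear d) (Seq clear c)))
  | BitAt r => IfBit r c d
  | Neg f => cond f d c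
  | Conj f g => cond f (cond g c d) d
  | Truth => c
  end.

Fixpoint fvars (f : fm) : seq nat :=
  match f with
  | LeSum l1 l2 => l1 ++ l2
  | BitAt r => [:: r]
  | Neg f => fvars f
  | Conj f g => fvars f ++ fvars g
  | Truth => [::]
  end.

Definition tmps := [:: t1; t2; tk].

Definition fresh (l : seq nat) := all (fun r => r \notin tmps) l.

Lemma sem_addl r l s : r != tk -> r \notin l -> tk \notin l -> reg s tk = 0 ->
  sem (addl r l) s = setreg s r (reg s r + sumr (reg s) l).
Proof.
move=> rk; elim: l s => [|x l IH] s.
  by move=> _ _ _; rewrite /= addn0; apply: st_ext => // y /=; case: eqP => // ->.
rewrite !inE !negb_or => /andP[rx rl] /andP[kx kl] k0.
have h := adds_for (v := tk) kx rk rx _ _ (adds_inc r x).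
rewrite [sem _ _]/= -/(sem (For tk x (Inc r)) s) h //; last by move=> y; rewrite mem_seq1 => /eqP ->.
rewrite IH //=; last by rewrite eq_sym (negbTE rk).
rewrite eqxx muln1 -addnA; apply: st_ext => // y /=; case: eqP => // _; congr (_ + (_ + _)).
rewrite /sumr; congr sumn; apply/eq_in_map => z zl; case: eqP => // e.
by rewrite -e zl in rl.
Qed.

Lemma emits_cond Z f c d w w' : {subset tmps <= Z} -> fresh (fvars f) ->
  emits Z c w -> emits Z d w' ->
  emits Z (cond f c d) (fun rho => if feval rho f then w rho else w' rho).
Proof.
move=> sZ; elim: f c d w w' => [l1 l2|r|f IH|f IHf g IHg|] c d w w' fr hc hd.
- move=> s a z; rewrite /=.
  have [zt1 zt2 ztk] : [/\ reg s t1 = 0, reg s t2 = 0 & reg s tk = 0].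
    by split; apply: z; apply: sZ; rewrite !inE eqxx ?orbT.
  move: ut; rewrite /= !inE negb_or => /and3P[/andP[n12 n1k] n2k _].
  have nin x l : x \in tmps -> fresh l -> x \notin l.
    by move=> hx /allP hl; apply: contraL hx => /hl.
  have [fr1 fr2] : fresh l1 /\ fresh l2 by apply/andP; rewrite -all_cat.
  rewrite (@sem_addl t1 l1) ?nin ?inE ?eqxx ?orbT //.
have ek y : reg (setreg s t1 y) tk = 0 by rewrite /= eq_sym (negbTE n1k).
rewrite (@sem_addl t2 l2) ?ek ?nin ?inE ?eqxx ?orbT //=.
  have e2 : sumr (fun r' => if r' == t1 then reg s t1 + sumr (reg s) l1 else reg s r') l2
     = sumr (reg s) l2.
    rewrite /sumr; congr sumn; apply/eq_in_map => x xl; case: eqP => // e.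
    by move: (nin t1 l2 (mem_head _ _) fr2); rewrite -e xl.
  rewrite !eqxx (negbTE n12) eq_sym (negbTE n12) e2 zt1 zt2 !add0n ltnNge.
  set s' := setreg (setreg _ _ _) _ _.
  have -> : s' = s.
    by apply: st_ext => // x /=; case: eqP => [->|_] //; do 2 case: eqP => [->|_] //.
  by case: (_ <= _) => /=; [rewrite hc|rewrite hd].
- by move=> s a z /=; rewrite a; case: ifP => _; [rewrite hc|rewrite hd].
- move=> s a z /=; rewrite (IH _ _ _ _ fr hd hc) //; by case: feval.
- move: fr; rewrite /fresh /= all_cat => /andP[frf frg] s a z /=.
  by rewrite (IHf _ _ _ _ frf (IHg _ _ _ _ frg hc hd) hd) //; case: feval; case: feval.
- by move=> s a z /=; rewrite hc.
Qed.

Lemma wf_addl r l : r != tk -> r \notin l -> tk \notin l -> wf (addl r l).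
Proof.
move=> rk; elim: l => //= x l IH; rewrite !inE !negb_or => /andP[rx rl] /andP[kx kl].
by rewrite kx IH // eq_sym rk eq_sym rx.
Qed.

Lemma mods_addl r l x : mods (addl r l) x -> (x == r) || (x == tk).
Proof. by elim: l => //= y l IH /orP[/orP[->|->]|/IH] //; rewrite orbT. Qed.

Lemma wf_cond f c d : fresh (fvars f) -> wf c -> wf d -> wf (cond f c d).
Proof.
move: ut; rewrite /= !inE negb_or => /and3P[/andP[n12 n1k] n2k _].
elim: f c d => [l1 l2|r|f IH|f IHf g IHg|] c d fr hc hd //=; first 1 last.
- by rewrite hc.
- exact: IH.
- by move: fr; rewrite /fresh all_cat => /andP[frf frg]; apply: IHf; rewrite ?IHg.
have nin x l : x \in tmps -> fresh l -> x \notin l.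
  by move=> hx /allP hl; apply: contraL hx => /hl.
have [fr1 fr2] : fresh l1 /\ fresh l2 by apply/andP; rewrite -all_cat.
by rewrite !wf_addl ?hc ?hd ?nin ?inE ?eqxx ?orbT.
Qed.

Lemma mods_cond f c d x : mods (cond f c d) x -> [|| x \in tmps, mods c x | mods d x].
Proof.
rewrite !inE; elim: f c d => [l1 l2|r|f IH|f IHf g IHg|] c d //=.
- case/orP => [/mods_addl/orP[]->|]; rewrite ?orbT //.
  case/orP => [/mods_addl/orP[]->|]; rewrite ?orbT //.
  by do !case/orP; move=> ->; rewrite ?orbT.
- by move=> ->; rewrite orbT.
- by move/IH => /or3P[]->; rewrite ?orbT.
- by move/IHf => /or3P[->|/IHg/or3P[]->|->]; rewrite ?orbT.
- by move=> ->; rewrite orbT.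
Qed.

Lemma boundable_cond Bd f c d : ~~ Bd t1 -> ~~ Bd t2 -> all Bd (fvars f) ->
  boundable Bd c -> boundable Bd d -> boundable Bd (cond f c d).
Proof.
move=> B1 B2; elim: f c d => [l1 l2|r|f IH|f IHf g IHg|] c d //=.
- rewrite all_cat => /andP[h1 h2] hc hd.
  have ad r l : ~~ Bd r -> all Bd l -> boundable Bd (addl r l).
    by move=> hr; elim: l => //= y l IH /andP[-> /IH->]; rewrite hr.
  by rewrite !ad // hc hd.
- by move=> _ -> ->.
- by move=> fr hc hd; apply: IH.
- by rewrite all_cat => /andP[hf hg] hc hd; apply: IHf => //; apply: IHg.
Qed.

End Emit.

Lemma wf_loops vs b c : uniq (b :: vs) -> wf c ->
  (forall v, v \in b :: vs -> ~~ mods c v) -> wf (loops vs b c).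
Proof.
elim: vs => //= v vs IH; rewrite inE negb_or => /and3P[/andP[bv bvs] vvs uvs] wc hm.
have md x : x \in [:: b; v] -> ~~ mods (loops vs b c) x.
  move=> hx; have : x \notin vs by move: hx; rewrite !inE => /orP[]/eqP ->.
  have : ~~ mods c x by apply: hm; move: hx; rewrite !inE => /orP[]->; rewrite ?orbT.
  by elim: (vs) => //= y l IHl h; rewrite inE !negb_or => /andP[-> /(IHl h)].
rewrite eq_sym bv !md ?inE ?eqxx ?orbT //=; apply: IH; rewrite ?bvs //.
by move=> x hx; apply: hm; move: hx; rewrite !inE => /orP[]->; rewrite ?orbT.
Qed.

Lemma mods_loops vs b c x : mods (loops vs b c) x -> (x \in vs) || mods c x.
Proof.
by elim: vs => //= v vs IH /orP[|/IH/orP[]]; rewrite inE => ->; rewrite ?orbT.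
Qed.

Lemma boundable_loops (Bd : pred nat) vs b c :
  Bd b -> boundable Bd c -> boundable Bd (loops vs b c).
Proof. by move=> hb hc; elim: vs => //= v vs ->; rewrite hb. Qed.


(** * Event structures with supports *)

Lemma perm_map_ex (T U : eqType) (f : T -> U) (w : seq U) (s : seq T) :
  perm_eq w (map f s) -> exists2 u, perm_eq u s & map f u = w.
Proof.
case: s => [|x s] p; first by exists [::] => //; rewrite (perm_nilP p).
have [Is pI ->] := perm_iotaP (f x) p.
exists (map (nth x (x :: s)) Is).
  rewrite -[X in perm_eq _ X](mkseq_nth x) perm_map // -(size_map f); exact: pI.
rewrite -map_comp; apply/eq_in_map => i hi; rewrite /= -(nth_map x (f x)) //.
by move: hi; rewrite (perm_mem pI) mem_iota size_map.
Qed.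

Section Flat.
Variables (V : eqType) (E : fles) (B : nat).
Variables (ch : nat -> bool) (supp : nat -> seq (V * nat)).

(** A support is a partial assignment that an event depends on; events conflict when their supports
    contradict each other, whether or not they are choices. *)
Definition clash (s s' : seq (V * nat)) :=
  has (fun p => has (fun q => (p.1 == q.1) && (p.2 != q.2)) s') s.

Hypothesis fn_gt0 : 0 < fn E.
Hypothesis B_gt0 : 0 < B.
Hypothesis lt_flat : forall i j, i < fn E -> j < fn E ->
  flt E i j = (i == 0) && (j != 0) || [&& ch i, ~~ ch j & has (mem (supp j)) (supp i)].
Hypothesis cf_flat : forall i j, i < fn E -> j < fn E ->
  fcf E i j = clash (supp i) (supp j).
Hypothesis supp0 : supp 0 = [::].
Hypothesis lab0 : flab E 0 = eps.
Hypothesis supp_ch : forall i, i < fn E -> ch i -> exists p, supp i = [:: p].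
Hypothesis supp_fun : forall i, i < fn E -> ~~ clash (supp i) (supp i).
Hypothesis supp_val : forall i p, i < fn E -> p \in supp i -> p.2 < B.
Hypothesis ch_ex : forall i p v, i < fn E -> p \in supp i -> v < B ->
  exists2 j, j < fn E & ch j /\ supp j = [:: (p.1, v)].
Hypothesis lab_max : forall i j, i < fn E -> j < fn E -> flab E i != eps -> ~~ flt E i j.

Lemma clashP s s' :
  reflect (exists p q, [/\ p \in s, q \in s', p.1 = q.1 & p.2 <> q.2]) (clash s s').
Proof.
apply: (iffP hasP) => [[p hp /hasP[q hq /andP[/eqP e /eqP ne]]]|[p [q [hp hq e ne]]]].
  by exists p, q.
by exists p => //; apply/hasP; exists q => //; rewrite e eqxx /=; apply/eqP.
Qed.

Lemma ch0 : ~~ ch 0.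
Proof. by apply/negP => /(supp_ch fn_gt0)[p]; rewrite supp0. Qed.

(** A cause is bot, whose support is empty, or a choice, whose only pair lies in the support of the
    effect. Conflict is thereby inherited along causality. *)
Lemma lt_supp i j : i < fn E -> j < fn E -> flt E i j -> {subset supp i <= supp j}.
Proof.
move=> hi hj; rewrite lt_flat // => /orP[/andP[/eqP-> _]|/and3P[hc _ hs]] p.
  by rewrite supp0.
by have [q e] := supp_ch hi hc; move: hs; rewrite e /= orbF inE => hq /eqP ->.
Qed.

(** Apart from bot, only choices are causes and only other events are their effects, so chains of
    causality above bot have length at most two and transitivity has only the case of bot. *)
Lemma wf_flat : wf_fles E.
Proof.
split=> //; split; [|split; [|split; [|split; [|split; [|split]]]]].
- move=> e; rewrite lt_flat //; apply/negP => /orP[/andP[->]//|/and3P[-> //]].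
- move=> e1 e2 e3; rewrite !lt_flat // => /orP[/andP[-> n2]|/and3P[h1 h2 h3]].
    case/orP => [/andP[e _]|/and3P[c2 _ hs]]; first by rewrite e in n2.
    by rewrite (_ : (_ != _) = true) //; apply: contraL hs => /eqP ->; rewrite supp0 has_pred0.
  case/orP => [/andP[/eqP e _]|/and3P[c2 _ hs]]; last by rewrite c2 in h2.
  by move: h3; rewrite e supp0 has_pred0.
- move=> e1 e2; rewrite !cf_flat // => /clashP[p [q [hp hq e ne]]]; apply/clashP.
  by exists q, p; split=> // e'; apply: ne.
- by move=> e; rewrite cf_flat // supp_fun.
- move=> e1 e2 e3 + l; rewrite !cf_flat // => /clashP[p [q [hp hq e ne]]]; apply/clashP.
  by exists p, q; split=> //; apply: lt_supp l _ hq.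
- move=> e; rewrite lt_flat // supp0 andbF /= has_pred0 !andbF //.
- split=> // e he; by rewrite lt_flat // eqxx he.
Qed.

Definition agrees (alpha : V -> nat) i := all (fun p => alpha p.1 == p.2) (supp i).

Definition cfg alpha : {set ev E} := [set e : ev E | agrees alpha e].

Lemma is_config_cfg alpha : is_config (cfg alpha).
Proof.
split=> [e e'|e e']; rewrite !inE => /allP ha.
  by move=> l; apply/allP => p hp; apply: ha; apply: lt_supp l _ hp.
move=> /allP ha'; rewrite cf_flat //; apply/clashP => -[p [q [hp hq e1 ne]]].
by apply: ne; rewrite -(eqP (ha _ hp)) -(eqP (ha' _ hq)) e1.
Qed.

(** An event that disagrees with [alpha] at a variable conflicts with the choice of the value of
    [alpha] there, which exists by [ch_ex] and lies in [cfg alpha]. *)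
Lemma max_cfg alpha : (forall x, alpha x < B) -> is_max_config (cfg alpha).
Proof.
move=> bnd; split; first exact: is_config_cfg.
move=> C' [_ nc] sub; apply/eqP; rewrite eqEsubset sub andbT; apply/subsetP => e he.
rewrite inE; apply/allP => p hp; apply/eqP.
have [j hj [cj sj]] := ch_ex (ltn_ord e) hp (bnd p.1).
have jC : Ordinal hj \in C'.
  by apply: (subsetP sub); rewrite inE /agrees /= sj /= eqxx.
have := nc _ _ jC he; rewrite cf_flat //= sj => /clashP h.
apply/eqP/negPn/negP => /eqP ne; apply: h.
by exists (p.1, alpha p.1), p; rewrite mem_head.
Qed.

(** Read [alpha] off the supports of the events in [C], with value 0 where they say nothing. Freedom
    from conflict puts [C] inside [cfg alpha], and maximality makes them equal. *)
Lemma max_config_cfg C : is_max_config C ->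
  exists2 alpha, (forall x, alpha x < B) & C = cfg alpha.
Proof.
move=> [[lc nc] mx].
pose L := flatten [seq supp (val e) | e <- enum C].
pose alpha x := head 0 [seq p.2 | p <- L & p.1 == x].
have LP p : p \in L -> exists2 e, e \in C & p \in supp (val e).
  by move=> /flatten_mapP[e]; rewrite mem_enum; exists e.
have hd x : alpha x = 0 \/ exists2 p, p \in L & p.1 = x /\ alpha x = p.2.
  rewrite /alpha; case e : [seq p <- L | p.1 == x] => [|p l]; [by left|right].
  have : p \in [seq p <- L | p.1 == x] by rewrite e mem_head.
  by rewrite mem_filter => /andP[/eqP hx hp]; exists p.
have bnd x : alpha x < B.
  case: (hd x) => [->//|[p /LP[e _ hp] [_ ->]]].
  exact: supp_val (ltn_ord e) hp.
exists alpha => //; apply/esym/mx; first exact: is_config_cfg.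
apply/subsetP => e he; rewrite inE; apply/allP => p hp.
have pL : p \in L by apply/flatten_mapP; exists e; rewrite ?mem_enum.
have [q hq [eq1 eq2]] : exists2 q, q \in L & q.1 = p.1 /\ alpha p.1 = q.2.
  rewrite /alpha; have : p \in [seq q <- L | q.1 == p.1] by rewrite mem_filter eqxx.
  case e' : [seq q <- L | q.1 == p.1] => [|q l] // _; exists q => //.
    by have : q \in q :: l by [rewrite mem_head]; rewrite -e' mem_filter => /andP[].
  split=> //; have : q \in q :: l by [rewrite mem_head].
  by rewrite -e' mem_filter => /andP[/eqP].
have [e' he' hq'] := LP _ hq.
have := nc _ _ he he'; rewrite cf_flat // => /clashP h.
rewrite eq2; apply/negPn/negP => /eqP ne; apply: h; exists p, q; split=> //.
by move=> e2; apply: ne.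
Qed.

Definition labels alpha : seq nat :=
  [seq flab E (val e) | e : ev E <- enum (ev E) & agrees alpha (val e) && (flab E (val e) != eps)].

(** A linearisation: bot, silent choices, other silent events, labelled events. The last class can
    be ordered freely because labelled events cause nothing. *)
Definition level (e : ev E) : nat :=
  if val e == 0 then 0 else if flab E e != eps then 3 else if ch e then 1 else 2.

Lemma lt_level (e e' : ev E) : flt E e e' -> level e < level e'.
Proof.
move=> l; have le : flab E e == eps.
  by apply/negPn/negP => h; have := lab_max (ltn_ord e) (ltn_ord e') h; rewrite l.
move: l; rewrite lt_flat // /level le /=.
case/orP => [/andP[-> /negbTE->]|/and3P[ce /negbTE ce' hs]]; first by case: (flab _ _ == _); case: (ch _).
rewrite ce ce'.
have /negbTE -> : val e != 0 by apply/eqP => e0; move: (ch0); rewrite -e0 ce.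
have /negbTE -> : val e' != 0.
  by apply: contraL hs => /eqP ->; rewrite supp0 has_pred0.
by case: ifP.
Qed.

Lemma in_lang_flat w :
  in_lang E w <-> exists2 alpha, (forall x, alpha x < B) & perm_eq w (labels alpha).
Proof.
split=> [[C [t [/max_config_cfg[alpha bnd ->] [[ut [mt _]] ->]]]]|[alpha bnd pw]].
  exists alpha => //; rewrite /word /labels; apply: perm_map.
  rewrite (eq_filter (a2 := predI (fun e : ev E => flab E e != eps) (fun e => agrees alpha e)));
    last by move=> e; rewrite /= andbC.
  rewrite filter_predI perm_filter //; apply: uniq_perm => //.
    by rewrite filter_uniq // enum_uniq.
  by move=> e; rewrite mt mem_filter mem_enum andbT inE.
(* [u] arranges the labelled events as [w] prescribes; the silent events [h], sorted by level, are
   put before it. *)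
have [u pu wu] := perm_map_ex pw.
pose leL := relpre level leq.
have leLtr : transitive leL by move=> x y z; apply: leq_trans.
pose h := sort leL [seq e : ev E <- enum (ev E) | agrees alpha (val e) && (flab E (val e) == eps)].
have hl e : (e \in h) = agrees alpha e && (flab E (val e) == eps).
  by rewrite mem_sort mem_filter mem_enum andbT.
have ul e : (e \in u) = agrees alpha e && (flab E (val e) != eps).
  by rewrite (perm_mem pu) mem_filter mem_enum andbT.
exists (cfg alpha), (h ++ u); split; first exact: max_cfg.
have sorted_t : sorted leL (h ++ u).
  rewrite sorted_pairwise // pairwise_cat -!sorted_pairwise //; apply/and3P; split.
  - apply/allrelP => x y; rewrite hl ul => _ /andP[_ hy]; rewrite /leL /= /level hy.
    rewrite (_ : (val y == 0) = false); first by case: (val x == 0) => //; case: (flab _ _ == _) => //; case: (ch _).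
    by apply: contraNF hy => /eqP ->; rewrite lab0.
  - by apply: sort_sorted => x y; apply: leq_total.
  rewrite sorted_pairwise //; apply/(pairwiseP (Ordinal fn_gt0)) => i j hi hj _.
  have lu x : x \in u -> level x = 3.
    rewrite ul => /andP[_ hx]; rewrite /level hx ifN //.
    by apply: contraNneq hx => ->; rewrite lab0.
  by rewrite /leL /= !lu ?mem_nth.
split; last first.
  have eh : [seq e : ev E <- h | flab E (val e) != eps] = [::].
    apply/eqP; rewrite -size_eq0 size_filter -leqn0 leqNgt -has_count; apply/hasPn => e.
    by rewrite hl => /andP[_ ->].
  have eu : [seq e : ev E <- u | flab E (val e) != eps] = u.
    by apply/all_filterP/allP => e; rewrite ul => /andP[].
  by rewrite /word filter_cat eh eu.
split; last split.
- rewrite cat_uniq sort_uniq filter_uniq ?enum_uniq // (perm_uniq pu) filter_uniq ?enum_uniq //.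
  rewrite andbT; apply/hasPn => e; rewrite ul => /andP[_ he].
  by rewrite hl negb_and he orbT.
- by move=> e; rewrite mem_cat hl ul inE -andb_orr orbN andbT.
move=> i j d hi hj /lt_level; rewrite ltnNge => nl; rewrite ltnNge; apply: contra nl => ji.
move: ji; rewrite leq_eqVlt => /orP[/eqP->//|ji].
by apply: (sorted_ltn_nth leLtr d sorted_t).
Qed.

End Flat.


(** * Inclusion as constraint satisfaction *)

Lemma mem_tups B D d : (d \in tups B D) = (size d == D) && all (fun x => x < B) d.
Proof.
elim: D d => [|D IH] [|x d] //=; first by apply/negP => /allpairsP[[a b] [_ _]].
apply/allpairsP/idP => [[[a t] /= [ha ht [-> ->]]]|/and3P[sd hx hd]].
  by move: ht ha; rewrite IH mem_iota => /andP[/eqP-> ->] /andP[_ ->]; rewrite eqxx.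
by exists (x, d); rewrite /= mem_iota hx IH -eqSS sd hd.
Qed.

Lemma tups_uniq B D : uniq (tups B D).
Proof.
elim: D => //= D IH; apply: allpairs_uniq => //; first exact: iota_uniq.
by move=> [a b] [c d] _ _ [-> ->].
Qed.

Lemma size_tups B D : size (tups B D) = B ^ D.
Proof. by elim: D => //= D IH; rewrite size_allpairs size_iota IH expnS. Qed.

(** Event 0 is the tuple of zeros, which therefore plays the part of bot. *)
Lemma tups_head B D : 0 < B -> nth [::] (tups B D) 0 = nseq D 0.
Proof.
move=> hB; have hN D' : 0 < size (tups B D') by rewrite size_tups expn_gt0 hB.
elim: D => //= D IH; rewrite -IH; case: B hB hN {IH} => // B _ hN /=.
by move: (hN D); case: (tups _ D).
Qed.

Fixpoint rank (B : nat) (s : seq nat) : nat :=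
  if s is x :: s' then x * B ^ size s' + rank B s' else 0.

Lemma rank_lt B s : all (fun x => x < B) s -> rank B s < B ^ size s.
Proof.
elim: s => //= x s IH /andP[hx /IH hs].
rewrite expnS; apply: (@leq_trans (x.+1 * B ^ size s)); first by rewrite mulSn; lia.
by rewrite leq_mul2r hx orbT.
Qed.

Lemma rank_inj B s s' : size s = size s' -> all (fun x => x < B) s ->
  all (fun x => x < B) s' -> rank B s = rank B s' -> s = s'.
Proof.
elim: s s' => [|x s IH] [|x' s'] //= [es] /andP[_ hs] /andP[_ hs'] e.
have P := rank_lt hs; have P' := rank_lt hs'; rewrite -es in e P'.
have p0 : 0 < B ^ size s by apply: leq_ltn_trans P.
have ex : x = x'.
  by move/(congr1 (fun z => z %/ B ^ size s)): e; rewrite !divnMDl // !divn_small ?addn0.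
by rewrite ex (IH s') //; move: e; rewrite ex => /addnI.
Qed.

Definition var := (nat * nat * nat)%type.

Definition dig (d : seq nat) i := nth 0 d i.

Definition tuple_fles (B D : nat) (lab : seq nat -> nat) (lt cf : seq nat -> seq nat -> bool)
    (E : fles) :=
  [/\ fn E = B ^ D,
      forall i, i < B ^ D -> flab E i = lab (nth [::] (tups B D) i),
      forall i j, i < B ^ D -> j < B ^ D ->
        flt E i j = lt (nth [::] (tups B D) i) (nth [::] (tups B D) j) &
      forall i j, i < B ^ D -> j < B ^ D ->
        fcf E i j = cf (nth [::] (tups B D) i) (nth [::] (tups B D) j)].

Definition tuple_lt (D : nat) (ch : seq nat -> bool) (supp : seq nat -> seq (var * nat)) d d' :=
  (d == nseq D 0) && (d' != nseq D 0) || [&& ch d, ~~ ch d' & has (mem (supp d')) (supp d)].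

Section TupleFles.
Variables (B D : nat) (lab : seq nat -> nat) (ch : seq nat -> bool).
Variables (supp : seq nat -> seq (var * nat)) (E : fles).

Hypothesis B0 : 0 < B.
Hypothesis tE : tuple_fles B D lab (tuple_lt D ch supp) (fun d d' => clash (supp d) (supp d')) E.
Hypothesis supp0 : supp (nseq D 0) = [::].
Hypothesis lab0 : lab (nseq D 0) = 0.
Hypothesis supp_ch : forall d, d \in tups B D -> ch d -> exists p, supp d = [:: p].
Hypothesis supp_fun : forall d, d \in tups B D -> ~~ clash (supp d) (supp d).
Hypothesis supp_val : forall d p, d \in tups B D -> p \in supp d -> p.2 < B.
Hypothesis ch_ex : forall d p v, d \in tups B D -> p \in supp d -> v < B ->
  exists2 d', d' \in tups B D & ch d' /\ supp d' = [:: (p.1, v)].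
Hypothesis lab_max : forall d d', d \in tups B D -> d' \in tups B D -> lab d != 0 ->
  ~~ tuple_lt D ch supp d d'.

Let T := tups B D.
Let dg i := nth [::] T i.

Lemma tuple_wf_lang : wf_fles E /\ forall w, in_lang E w <->
  exists2 alpha : var -> nat, (forall x, alpha x < B) &
    perm_eq w [seq lab d | d <- T & all (fun p => alpha p.1 == p.2) (supp d) && (lab d != 0)].
Proof.
have [fnE labE ltE cfE] := tE.
have sT : size T = B ^ D by apply: size_tups.
have N0 : 0 < B ^ D by rewrite expn_gt0 B0.
have dgT i : i < fn E -> dg i \in T by rewrite fnE -sT => h; apply: mem_nth.
have dg0 : dg 0 = nseq D 0 by apply: tups_head.
have dg_eq0 i : i < fn E -> (dg i == nseq D 0) = (i == 0).
  by rewrite fnE -dg0 => h; rewrite nth_uniq ?sT ?tups_uniq.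
have H1 : 0 < fn E by rewrite fnE.
have H2 i j : i < fn E -> j < fn E -> flt E i j = (i == 0) && (j != 0) ||
    [&& ch (dg i), ~~ ch (dg j) & has (mem (supp (dg j))) (supp (dg i))].
  by move=> hi hj; rewrite ltE -?fnE // /tuple_lt !dg_eq0.
have H3 i j : i < fn E -> j < fn E -> fcf E i j = clash (supp (dg i)) (supp (dg j)).
  by move=> hi hj; rewrite cfE -?fnE.
have H4 : supp (dg 0) = [::] by rewrite dg0.
have H5 : flab E 0 = eps by rewrite labE // -/(dg 0) dg0.
have H6 i : i < fn E -> ch (dg i) -> exists p, supp (dg i) = [:: p].
  by move=> hi; apply: supp_ch; apply: dgT.
have H7 i : i < fn E -> ~~ clash (supp (dg i)) (supp (dg i)).
  by move=> hi; apply: supp_fun; apply: dgT.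
have H8 i p : i < fn E -> p \in supp (dg i) -> p.2 < B.
  by move=> hi; apply: supp_val; apply: dgT.
have H9 i p v : i < fn E -> p \in supp (dg i) -> v < B ->
    exists2 j, j < fn E & ch (dg j) /\ supp (dg j) = [:: (p.1, v)].
  move=> hi hp hv; have [d hd [cd sd]] := ch_ex (dgT _ hi) hp hv.
  by exists (index d T); rewrite ?fnE -?sT ?index_mem // /dg nth_index.
have H10 i j : i < fn E -> j < fn E -> flab E i != eps -> ~~ flt E i j.
  move=> hi hj; rewrite labE ?ltE -?fnE // => hl.
  by apply: lab_max hl; apply: dgT.
split; first exact: (wf_flat H1 H2 H3 H4 H5 H6 H7).
move=> w; rewrite (in_lang_flat H1 B0 H2 H3 H4 H5 H6 H8 H9 H10).
suff e alpha : labels E (fun i => supp (dg i)) alpha =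
    [seq lab d | d <- T & all (fun p => alpha p.1 == p.2) (supp d) && (lab d != 0)].
  by split=> -[alpha h p]; exists alpha => //; rewrite ?e // -e.
have -> : T = [seq dg (val e) | e : ev E <- enum (ev E)].
  rewrite (map_comp dg val) /ev val_enum_ord fnE -sT.
  by apply: (@eq_from_nth _ [::]); rewrite ?size_map ?size_iota // => i hi;
    rewrite (nth_map 0) ?size_iota // nth_iota.
rewrite /labels filter_map -map_comp.
rewrite (eq_filter (a2 := preim (fun e : ev E => dg (val e))
   (fun d => all (fun p => alpha p.1 == p.2) (supp d) && (lab d != 0)))).
  by apply: eq_map => e; rewrite /= labE -?fnE.
by move=> e; rewrite /= labE -?fnE.
Qed.

End TupleFles.

(* Variables are triples (kind, a, b): kinds 0, 1, 2 are the state at time a, the head position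
   at time a and the content of cell b at time a; kinds 3 and 4 are |y| and |z|; kinds 5 and 6
   are bit a of y and of z. *)
Definition scope (t t' i j : nat) : seq var :=
  [:: (0, t, 0); (1, t, 0); (2, t, i); (0, t', 0); (1, t', 0); (2, t', i);
      (3, 0, 0); (4, 0, 0); (5, j, 0); (6, j, 0)].

(* Digit 0 is the type of an event: 1 is a hidden choice (variable, value), 2 a visible one
   (a copy of the choice in the second structure), 3 a constraint together with a tuple of values
   for its scope. Constraints with t = t' are dropped, since their scope would repeat variables
   and the event could conflict with itself. *)
Definition iscon d := (dig d 0 == 3) && (dig d 1 != dig d 2).

Definition cellpair d : var * nat := ((dig d 1, dig d 2, dig d 3), dig d 4).

Definition conpairs d : seq (var * nat) :=
  zip (scope (dig d 1) (dig d 2) (dig d 3) (dig d 4)) (drop 5 d).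

(** Constraint events get an empty support here, so every word of the first structure asks for every
    constraint. *)
Definition supp1 d := if dig d 0 == 2 then [:: cellpair d] else [::].

Definition supp2 d :=
  if (dig d 0 == 1) || (dig d 0 == 2) then [:: cellpair d]
  else if iscon d then conpairs d else [::].

Definition ch1 d := dig d 0 == 2.
Definition ch2 d := dig d 0 == 1.

(** Labels depend on the first five digits only; zeros elsewhere select one tuple among those that
    would share a label. *)
Definition rest0 d := all (pred1 0) (drop 5 d).

Definition visible k := (k == 3) || (k == 5).

Definition isvis d := [&& dig d 0 == 2, visible (dig d 1) & rest0 d].

Definition lab1 B d := if isvis d || (iscon d && rest0 d) then rank B (take 5 d) else 0.

(* The label 1 is the rank of an invisible tuple, so no word of the first structure uses it. *)
Definition lab2 (legal : seq nat -> bool) B d :=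
  if isvis d then rank B (take 5 d)
  else if iscon d then (if legal d then rank B (take 5 d) else 1) else 0.

Section Inclusion.
Variables (B : nat) (legal : seq nat -> bool) (E1 E2 : fles).
Hypothesis B7 : 6 < B.
Hypothesis tE1 : tuple_fles B 15 (lab1 B) (tuple_lt 15 ch1 supp1)
  (fun d d' => clash (supp1 d) (supp1 d')) E1.
Hypothesis tE2 : tuple_fles B 15 (lab2 legal B) (tuple_lt 15 ch2 supp2)
  (fun d d' => clash (supp2 d) (supp2 d')) E2.

Let T := tups B 15.

Lemma tupP d : reflect (exists a b c e f l, [/\ d = [:: a, b, c, e, f & l], size l = 10,
  all (fun x => x < B) l & [&& a < B, b < B, c < B, e < B & f < B]]) (d \in T).
Proof.
rewrite mem_tups; apply: (iffP andP) => [[/eqP]|[a [b [c [e [f [l [-> sl al /and5P[? ? ? ? ?]]]]]]]]].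
  case: d => [|a [|b [|c [|e [|f l]]]]] // [sl] /= /and5P[? ? ? ? /andP[? ?]].
  by exists a, b, c, e, f, l; split=> //; apply/and5P.
by split; rewrite /= ?sl ?al //; apply/and5P; split=> //; apply/andP.
Qed.

Lemma uniq_clash s : uniq (unzip1 s) -> ~~ @clash var s s.
Proof.
elim: s => //= p s IH /andP[np /IH ns]; rewrite /clash /= !eqxx /=.
have nin q : q \in s -> (p.1 == q.1) = false.
  by move=> hq; apply: contraNF np => /eqP ->; apply: map_f.
rewrite !negb_or; apply/andP; split; first by apply/hasPn => q /nin ->.
apply/hasPn => q hq /=; rewrite eq_sym nin //=.
by apply: contra ns => h; apply/hasP; exists q.
Qed.

Lemma choice_tup (x : var) v a : x.1.1 < B -> x.1.2 < B -> x.2 < B -> v < B -> a < B ->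
  [:: a, x.1.1, x.1.2, x.2, v & nseq 10 0] \in T.
Proof.
move=> *; apply/tupP; do 6 eexists; split; [reflexivity|by []| |by apply/and5P].
by rewrite all_nseq (leq_trans _ B7).
Qed.

Lemma con_tup t t' i j l : t < B -> t' < B -> i < B -> j < B -> size l = 10 ->
  all (fun x => x < B) l -> [:: 3, t, t', i, j & l] \in T.
Proof.
move=> *; apply/tupP; do 6 eexists; split; [reflexivity|by []|by []|].
by apply/and5P; split=> //; apply: leq_trans B7.
Qed.

Lemma scope_lt t t' i j (x : var) : t < B -> t' < B -> i < B -> j < B -> x \in scope t t' i j ->
  [/\ x.1.1 < B, x.1.2 < B & x.2 < B].
Proof.
move=> ? ? ? ?; rewrite !inE.
by do !case/orP; move=> /eqP -> /=; split=> //; lia.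
Qed.

Lemma scope_uniq t t' i j : t != t' -> uniq (scope t t' i j).
Proof. by move=> /negbTE h; rewrite /= !inE !xpair_eqE /= h. Qed.

Lemma lang1 : wf_fles E1 /\ forall w, in_lang E1 w <->
  exists2 alpha : var -> nat, (forall x, alpha x < B) &
    perm_eq w [seq lab1 B d | d <- T &
      all (fun p => alpha p.1 == p.2) (supp1 d) && (lab1 B d != 0)].
Proof.
apply: (tuple_wf_lang _ tE1) => //; first lia.
- by move=> d _; rewrite /ch1 /supp1 => ->; eexists.
- by move=> d _; apply: uniq_clash; rewrite /supp1; case: ifP.
- move=> d p /tupP[a [b [c [e [f [l [-> _ _ /and5P[? ? ? ? ?]]]]]]]].
  by rewrite /supp1; case: ifP => // _; rewrite mem_seq1 => /eqP ->.
- move=> d p v /tupP[a [b [c [e [f [l [-> _ _ /and5P[? ? ? ? ?]]]]]]]].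
  rewrite /supp1; case: ifP => // _; rewrite mem_seq1 => /eqP -> hv.
  exists [:: 2, b, c, e, v & nseq 10 0] => //.
  by apply: (@choice_tup (b, c, e)) => //; lia.
move=> d d' _ _ hl; rewrite /tuple_lt negb_or; apply/andP; split.
  by rewrite negb_and; apply/orP; left; apply: contra hl => /eqP ->.
apply/negP => /and3P[_]; rewrite /ch1 /supp1 => /negbTE ->.
by case: ifP.
Qed.

Lemma lang2 : wf_fles E2 /\ forall w, in_lang E2 w <->
  exists2 alpha : var -> nat, (forall x, alpha x < B) &
    perm_eq w [seq lab2 legal B d | d <- T &
      all (fun p => alpha p.1 == p.2) (supp2 d) && (lab2 legal B d != 0)].
Proof.
have zipx (s : seq var) l p : p \in zip s l -> p.1 \in s /\ p.2 \in l.
  elim: s l => [|x s IH] [|y l] //=; rewrite inE => /orP[/eqP -> /=|/IH[h h']].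
    by rewrite !inE !eqxx.
  by rewrite !inE h h' !orbT.
apply: (tuple_wf_lang _ tE2) => //; first lia.
- by move=> d _; rewrite /ch2 /supp2 => ->; eexists.
- move=> d /tupP[a [b [c [e [f [l [-> sl _ _]]]]]]]; apply: uniq_clash; rewrite /supp2.
  case: ifP => // _; case: ifP => // /andP[_ ne].
  by rewrite unzip1_zip ?scope_uniq // /= drop0 sl.
- move=> d p /tupP[a [b [c [e [f [l [-> sl al /and5P[? ? ? ? ?]]]]]]]].
  rewrite /supp2; case: ifP => _; first by rewrite mem_seq1 => /eqP ->.
  by case: ifP => // _ /zipx[_]; rewrite /= drop0; apply: (allP al).
- move=> d p v /tupP[a [b [c [e [f [l [-> sl al /and5P[? ? ? ? ?]]]]]]]] hp hv.
  have [h1 h2 h3] : [/\ p.1.1.1 < B, p.1.1.2 < B & p.1.2 < B].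
    move: hp; rewrite /supp2; case: ifP => _; first by rewrite mem_seq1 => /eqP ->.
    by case: ifP => // _ /zipx[/scope_lt h _]; apply: h.
  exists [:: 1, p.1.1.1, p.1.1.2, p.1.2, v & nseq 10 0].
    by apply: choice_tup => //; lia.
  by split=> //; case: (p) => [[[]]].
move=> d d' _ _ hl; rewrite /tuple_lt negb_or; apply/andP; split.
  by rewrite negb_and; apply/orP; left; apply: contra hl => /eqP ->.
apply/negP => /and3P[/eqP c _ _]; move: hl.
by rewrite /lab2 /isvis /iscon c.
Qed.

Lemma rank5_inj d d' : d \in T -> d' \in T -> rank B (take 5 d) = rank B (take 5 d') ->
  take 5 d = take 5 d'.
Proof.
rewrite !mem_tups => /andP[/eqP sd ad] /andP[/eqP sd' ad'].
have al x : all (fun x => x < B) x -> all (fun x => x < B) (take 5 x).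
  by rewrite -{1}(cat_take_drop 5 x) all_cat => /andP[].
by apply: rank_inj; rewrite ?size_take ?sd ?sd' ?al.
Qed.

(** The leading digit alone contributes at least [2 * B ^ 4]. This separates genuine labels from the
    empty word 0 and from junk 1. *)
Lemma rank5_gt1 d : 1 < dig d 0 -> 4 < size d -> 1 < rank B (take 5 d).
Proof.
case: d => [|a [|b [|c [|e [|f l]]]]] //= ha _; rewrite /dig /= in ha.
have : 0 < B ^ 4 by rewrite expn_gt0; lia.
by rewrite take0 /=; nia.
Qed.

Lemma rest0_eq d d' : d \in T -> d' \in T -> take 5 d = take 5 d' -> rest0 d -> rest0 d' -> d = d'.
Proof.
rewrite !mem_tups => /andP[/eqP sd _] /andP[/eqP sd' _] e r r'.
rewrite -(cat_take_drop 5 d) -(cat_take_drop 5 d') e.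
by move/all_pred1P: r => ->; move/all_pred1P: r' => ->; rewrite !size_drop sd sd'.
Qed.

Definition conof (beta : var -> nat) t t' i j := [:: 3, t, t', i, j & map beta (scope t t' i j)].

Lemma agrees_con (beta : var -> nat) d : d \in T -> iscon d ->
  all (fun p => beta p.1 == p.2) (supp2 d) = (d == conof beta (dig d 1) (dig d 2) (dig d 3) (dig d 4)).
Proof.
move=> /tupP[a [b [c [e [f [l [-> sl al _]]]]]]] hc.
have [/eqP ha _] := andP hc; rewrite /dig /= in ha; subst a.
set D := [:: 3, b, c, e, f & l].
have -> : (D == conof beta (dig D 1) (dig D 2) (dig D 3) (dig D 4)) = (l == map beta (scope b c e f)).
  by rewrite /conof !eqseq_cons !eqxx.
have -> : supp2 D = zip (scope b c e f) l by rewrite /supp2 hc /conpairs /= drop0.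
have : size (scope b c e f) = size l by rewrite sl.
elim: (scope b c e f) l {D sl al hc} => [|x s IH] [|y l] //= [es].
by rewrite eqseq_cons eq_sym IH.
Qed.

(** A language consists of the permutations of the label lists of the assignments, so inclusion
    means that each list of the first structure is a permutation of one of the second. Without junk
    in it, the latter has the legal tuple of every constraint. *)
Lemma incl_csp : lang_incl E1 E2 <->
  forall alpha : var -> nat, (forall x, alpha x < B) ->
    exists2 beta : var -> nat, (forall x, beta x < B) &
      (forall k a b, visible k -> a < B -> b < B -> beta (k, a, b) = alpha (k, a, b)) /\
      (forall t t' i j, t < B -> t' < B -> i < B -> j < B -> t != t' ->
         legal (conof beta t t' i j)).
Proof.
have sz d : d \in T -> size d = 15 by rewrite mem_tups => /andP[/eqP].
have ltk k : visible k -> k < B by rewrite /visible; lia.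
have dig_take d d' k : k < 5 -> take 5 d = take 5 d' -> dig d k = dig d' k.
  by move=> hk e; rewrite /dig -(nth_take _ hk d) e nth_take.
split=> [incl alpha ha|csp w /(lang1.2 w)[alpha ha pw]].
  have : in_lang E1 [seq lab1 B d | d <- T &
      all (fun p => alpha p.1 == p.2) (supp1 d) && (lab1 B d != 0)].
    by apply/lang1.2; exists alpha.
  move/incl/lang2.2 => [beta hb pb]; exists beta => //.
  (* Each labelled event [d] enabled by [alpha] has a partner [d'] enabled by [beta]; the shared
     label determines the first five digits and is not junk. *)
  have key d : d \in T -> 1 < dig d 0 -> all (fun p => alpha p.1 == p.2) (supp1 d) ->
      lab1 B d = rank B (take 5 d) ->
      exists d', [/\ d' \in T, take 5 d' = take 5 d, all (fun p => beta p.1 == p.2) (supp2 d')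
        & isvis d' || (iscon d' && legal d')].
    move=> dT d0 sd ld; have r1 : 1 < rank B (take 5 d) by apply: rank5_gt1 => //; rewrite sz.
    have : lab1 B d \in [seq lab1 B d | d <- T &
      all (fun p => alpha p.1 == p.2) (supp1 d) && (lab1 B d != 0)].
      by apply: map_f; rewrite mem_filter dT sd ld -lt0n ltnW.
    rewrite (perm_mem pb) ld => /mapP[d']; rewrite mem_filter => /andP[/andP[sd' _] d'T].
    rewrite /lab2; case: ifP => [v e|_].
      by exists d'; split=> //; [apply/esym/rank5_inj|rewrite v].
    case: ifP => [c|_]; last by move=> e; rewrite e in r1.
    case: ifP => [lg e|_ e]; last by rewrite e in r1.
    by exists d'; split=> //; [apply/esym/rank5_inj|rewrite c lg orbT].
  split=> [k a b vk ka kb|t t' i j ht ht' hi hj ne].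
    have dT := @choice_tup (k, a, b) (alpha (k, a, b)) 2 (ltk k vk) ka kb (ha _).
    have [||||d' [d'T e sd' cs]] := key _ (dT _); rewrite /supp1 /lab1 /isvis /= ?vk ?eqxx //; first lia.
    have E k' : k' < 5 -> dig d' k' = dig [:: 2, k, a, b, alpha (k, a, b) & nseq 10 0] k'.
      by move=> h; apply: dig_take.
    by move: sd'; rewrite /supp2 /cellpair !E //= andbT => /eqP.
  have cT l := @con_tup t t' i j l ht ht' hi hj.
  have [|||||d' [d'T e sd' cs]] := key _ (cT (nseq 10 0) _ _) => //.
  - by rewrite all_nseq; apply/orP; right; lia.
  - by rewrite /lab1 /isvis /iscon /dig /= ne.
  have E k' : k' < 5 -> dig d' k' = dig [:: 3, t, t', i, j & nseq 10 0] k'.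
    by move=> h; apply: dig_take.
  move: cs; rewrite {1}/isvis E //= => /andP[c lg].
  by move: sd'; rewrite agrees_con // !E // => /eqP <-.
have [beta hb [bv bc]] := csp _ ha.
apply/lang2.2; exists beta => //; apply: (perm_trans pw).
have con_legal d : d \in T -> iscon d -> all (fun p => beta p.1 == p.2) (supp2 d) -> legal d.
  move=> dT c; rewrite agrees_con // => /eqP ->.
  case/tupP: dT c => [a [b [c [e [f [l [-> sl al /and5P[? ? ? ? ?]]]]]]]] /andP[_ ne].
  exact: bc.
have vis_agree d : d \in T -> isvis d -> all (fun p => alpha p.1 == p.2) (supp1 d)
    = all (fun p => beta p.1 == p.2) (supp2 d).
  case/tupP => [a [b [c [e [f [l [-> sl al /and5P[? ? ? ? ?]]]]]]]] /and3P[/eqP h0 h1 _].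
  by rewrite /supp1 /supp2 h0 /= bv.
(* On both sides no label occurs twice, so it suffices to compare the sets of labels. *)
apply: uniq_perm.
- rewrite map_inj_in_uniq ?filter_uniq ?tups_uniq // => d d'.
  rewrite !mem_filter /lab1 => /andP[/andP[_ +] dT] /andP[/andP[_ +] d'T].
  case: ifP => // h _; case: ifP => // h' _ /(rank5_inj dT d'T) e.
  have r x : isvis x || iscon x && rest0 x -> rest0 x.
    by case/orP => [/and3P[]|/andP[]].
  by apply: rest0_eq e _ _ => //; apply: r.
- rewrite map_inj_in_uniq ?filter_uniq ?tups_uniq // => d d'.
  rewrite !mem_filter => /andP[/andP[ad nd] dT] /andP[/andP[ad' nd'] d'T].
  have labE x : x \in T -> all (fun p => beta p.1 == p.2) (supp2 x) -> lab2 legal B x != 0 ->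
      lab2 legal B x = rank B (take 5 x) /\ (isvis x \/ iscon x).
    move=> xT ax; rewrite /lab2; case: ifP => [v|_]; first by split=> //; left.
    by case: ifP => // c _; rewrite (con_legal x) //; split=> //; right.
  have [-> k] := labE _ dT ad nd; have [-> k'] := labE _ d'T ad' nd'.
  move=> /(rank5_inj dT d'T) e.
  have e0 := dig_take _ _ 0 isT e.
  case: k k' => [v|c] [v'|c'].
  + by apply: rest0_eq => //; [case/and3P: v|case/and3P: v'].
  + by case/and3P: v => /eqP h; case/andP: c' => /eqP h'; rewrite e0 h' in h.
  + by case/and3P: v' => /eqP h; case/andP: c => /eqP h'; rewrite e0 h in h'.
  move: ad ad'; rewrite !agrees_con // => /eqP -> /eqP ->.
  by rewrite !(dig_take _ _ _ _ e).
move=> x; apply/mapP/mapP => -[d]; rewrite mem_filter => /andP[/andP[ad ld] dT] ->.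
  move: ld; rewrite {1 2}/lab1; case: ifP => // /orP[v|/andP[c r]] ne.
    by exists d; rewrite ?mem_filter -?vis_agree // ?ad ?dT /lab2 v ?ne.
  case/tupP: (dT) c ne => [a [b [c [e [f [l [-> sl al /and5P[? ? ? ? ?]]]]]]]] cn ne.
  have [/eqP a3 bc'] := andP cn; rewrite /dig /= in a3 bc'.
  (* The partner of a constraint event ending in ten zeros carries the values of [beta]; conversely,
     below, those values are replaced by zeros. *)
  have d'T : conof beta b c e f \in T.
    by apply: con_tup => //=; rewrite !hb.
  have cn' : iscon (conof beta b c e f) by rewrite /iscon /dig.
  have e5 : take 5 (conof beta b c e f) = take 5 [:: a, b, c, e, f & l] by rewrite a3 /= !take0.
  have l2 : lab2 legal B (conof beta b c e f) = rank B (take 5 [:: a, b, c, e, f & l]).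
    rewrite /lab2 (_ : isvis _ = false) // cn' e5 bc //.
  exists (conof beta b c e f); last by rewrite l2.
  by rewrite mem_filter d'T agrees_con // {1}/dig eqxx l2 ne.
move: ld; rewrite {1 2}/lab2; case: ifP => [v ne|_].
  by exists d; rewrite ?mem_filter ?vis_agree // ?ad ?dT /lab1 v ?ne.
case: ifP => // cn; rewrite con_legal // => ne.
case/tupP: (dT) cn ne => [a [b [c [e [f [l [-> sl al /and5P[? ? ? ? ?]]]]]]]] cn ne.
have [/eqP a3 bc'] := andP cn; rewrite /dig /= in a3 bc'.
have d'T : [:: 3, b, c, e, f & nseq 10 0] \in T.
  by apply: con_tup => //; rewrite all_nseq; apply/orP; right; lia.
have e5 : take 5 [:: a, b, c, e, f & l] = take 5 [:: 3, b, c, e, f & nseq 10 0] by rewrite a3 /= !take0.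
have l1 : lab1 B [:: 3, b, c, e, f & nseq 10 0] = rank B (take 5 [:: a, b, c, e, f & l]).
  by rewrite /lab1 (_ : isvis _ || _ = true) ?e5 // /isvis /iscon /dig /= bc'.
exists [:: 3, b, c, e, f & nseq 10 0]; last by rewrite l1.
by rewrite mem_filter d'T l1 ne.
Qed.

End Inclusion.


(** * The tableau constraint *)

Definition EqSum l1 l2 := Conj (LeSum l1 l2) (LeSum l2 l1).
Definition Disj f g := Neg (Conj (Neg f) (Neg g)).
Definition Imp f g := Disj (Neg f) g.
Definition Any (fs : seq fm) := foldr Disj (Neg Truth) fs.
Definition All (fs : seq fm) := foldr Conj Truth fs.

Arguments EqSum : simpl never.
Arguments Disj : simpl never.
Arguments Imp : simpl never.

Section FormulaSemantics.
Variables (A : nat -> option bool) (rho : env).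

Lemma feval_eq l1 l2 : feval A rho (EqSum l1 l2) = (sumr rho l1 == sumr rho l2).
Proof. by rewrite /= eqn_leq. Qed.

Lemma feval_disj f g : feval A rho (Disj f g) = feval A rho f || feval A rho g.
Proof. by rewrite /= negb_and !negbK. Qed.

Lemma feval_imp f g : feval A rho (Imp f g) = (feval A rho f ==> feval A rho g).
Proof. by rewrite feval_disj implybE. Qed.

Lemma feval_any fs : feval A rho (Any fs) = has (feval A rho) fs.
Proof. by elim: fs => // f fs IH; rewrite [Any _]/= feval_disj IH. Qed.

Lemma feval_all fs : feval A rho (All fs) = all (feval A rho) fs.
Proof. by elim: fs => //= f fs ->. Qed.

Lemma sumr_nseq k r : sumr rho (nseq k r) = k * rho r.
Proof. by rewrite /sumr map_nseq sumn_nseq mulnC. Qed.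

End FormulaSemantics.

(* Registers 0-14 and 15-29 hold the digits of two event tuples, 36-38 are scratch for [cond].
   [rN], [rP], [rT], [rB] hold |x|, the bound on |y| and |z|, the number of simulated steps and
   the base of the tuples; [r1] holds 1 and [rM] holds |x| + 2. *)
Definition rN := 30.
Definition rP := 31.
Definition rT := 32.
Definition rB := 33.
Definition r1 := 34.
Definition rM := 35.

Definition codeC (a : option bool) : nat :=
  if a is Some b then b.+1 else 0.

Section Legal.
Variable M : TM.

Definition codeS (q : tst M) : nat := enum_rank q.

Lemma codeS_inj : injective codeS.
Proof. by move=> q q' /ord_inj/enum_rank_inj. Qed.

Lemma codeC_inj : injective codeC.
Proof. by do 2 case => [[]|]. Qed.

Definition lit k := nseq k r1.

(* Digits 1-4 of a constraint tuple are t, t', i, j; digits 5-14 are the values of its scope: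
   state, head position and content of cell i at time t, the same three at time t', and then
   |y|, |z|, y_j, z_j. The tape position of cell i is i - T, and the bits of x are read from the
   end because the program stores x reversed. *)
Definition bitF (r : nat) := Conj (Imp (EqSum [:: r] [::]) (EqSum [:: 7] [:: r1]))
  (Disj (EqSum [:: r] [::]) (EqSum [:: 7] [:: r1; r1])).

(** The input word doubles each bit and closes each of x, y, z with the bits 0 1, codes 1 and 2.
    With o = T + 2|x|, bit j of x from the end fills cells o - 2j - 2 and o - 2j - 1, the first
    separator o and o + 1, bit j of y cells o + 2 + 2j and o + 3 + 2j, and so on; cells outside the
    word are blank. *)
Definition initF : fm := All [::
  EqSum [:: 5] (lit (codeS (tstart M)));
  EqSum [:: 6] [:: rT];
  Imp (Conj (LeSum [:: 4; r1] [:: rN]) (Disj (EqSum [:: 3; 4; 4; r1; r1] [:: rT; rN; rN])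
                                        (EqSum [:: 3; 4; 4; r1] [:: rT; rN; rN])))
    (Conj (Imp (BitAt 4) (EqSum [:: 7] [:: r1; r1])) (Disj (BitAt 4) (EqSum [:: 7] [:: r1])));
  Imp (EqSum [:: 3] [:: rT; rN; rN]) (EqSum [:: 7] [:: r1]);
  Imp (EqSum [:: 3] [:: rT; rN; rN; r1]) (EqSum [:: 7] [:: r1; r1]);
  Imp (Conj (LeSum [:: 4; r1] [:: 11])
         (Disj (EqSum [:: 3] [:: rT; rN; rN; r1; r1; 4; 4])
               (EqSum [:: 3] [:: rT; rN; rN; r1; r1; r1; 4; 4]))) (bitF 13);
  Imp (EqSum [:: 3] [:: rT; rN; rN; r1; r1; 11; 11]) (EqSum [:: 7] [:: r1]);
  Imp (EqSum [:: 3] [:: rT; rN; rN; r1; r1; r1; 11; 11]) (EqSum [:: 7] [:: r1; r1]);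
  Imp (Conj (LeSum [:: 4; r1] [:: 12])
         (Disj (EqSum [:: 3] [:: rT; rN; rN; r1; r1; r1; r1; 11; 11; 4; 4])
               (EqSum [:: 3] [:: rT; rN; rN; r1; r1; r1; r1; r1; 11; 11; 4; 4]))) (bitF 14);
  Imp (EqSum [:: 3] [:: rT; rN; rN; r1; r1; r1; r1; 11; 11; 12; 12]) (EqSum [:: 7] [:: r1]);
  Imp (EqSum [:: 3] [:: rT; rN; rN; r1; r1; r1; r1; r1; 11; 11; 12; 12])
    (EqSum [:: 7] [:: r1; r1]);
  Imp (Disj (LeSum [:: 3; r1] [:: rT])
            (LeSum [:: rT; rN; rN; r1; r1; r1; r1; r1; r1; 11; 11; 12; 12] [:: 3]))
    (EqSum [:: 7] [::])].

Definition moveF (d : dir) : fm :=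
  match d with
  | DL => EqSum [:: 9; r1] [:: 6]
  | DR => EqSum [:: 9] [:: 6; r1]
  | DS => EqSum [:: 9] [:: 6]
  end.

Definition ruleF (q : tst M) (a : option bool) : fm :=
  let: (q', w, d) := adelta q a in
  All [:: EqSum [:: 5] (lit (codeS q)); EqSum [:: 7] (lit (codeC a));
          EqSum [:: 8] (lit (codeS q')); EqSum [:: 10] (lit (codeC w)); moveF d].

(** The constraint whose cell [i] is under the head fixes the next state and head position; the
    other cells only keep their contents. *)
Definition stepF : fm :=
  Conj (Disj (EqSum [:: 6] [:: 3]) (EqSum [:: 10] [:: 7]))
       (Imp (EqSum [:: 6] [:: 3])
         (Any [seq ruleF qa.1 qa.2 | qa : tst M * option bool <- enum {: tst M * option bool}])).

(** The first disjunct excuses the choices with |y| above the bound, which demand nothing of z. A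
    length of z above the bound is illegal, as z must be a valid witness. *)
Definition legalF : fm :=
  Disj (LeSum [:: rP; r1] [:: 11]) (All [::
    LeSum [:: 12] [:: rP];
    Imp (EqSum [:: 1] [::]) initF;
    Imp (Conj (EqSum [:: 2] [:: 1; r1]) (LeSum [:: 2] [:: rT])) stepF;
    Imp (EqSum [:: 2] [:: rT]) (EqSum [:: 8] (lit (codeS (tacc M))))]).

Definition initB (n T : nat) (xr : nat -> bool) (i j vS vH vC yl zl vY vZ : nat) : bool :=
  let o := T + n.*2 in
  [&& vS == codeS (tstart M), vH == T,
      ((j < n) && ((i + j.*2 + 2 == o) || (i + j.*2 + 1 == o))) ==> (vC == (xr j).+1),
      (i == o) ==> (vC == 1), (i == o + 1) ==> (vC == 2),
      ((j < yl) && ((i == o + 2 + j.*2) || (i == o + 3 + j.*2))) ==> (vC == (vY != 0).+1),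
      (i == o + 2 + yl.*2) ==> (vC == 1), (i == o + 3 + yl.*2) ==> (vC == 2),
      ((j < zl) && ((i == o + 4 + yl.*2 + j.*2) || (i == o + 5 + yl.*2 + j.*2))) ==>
         (vC == (vZ != 0).+1),
      (i == o + 4 + yl.*2 + zl.*2) ==> (vC == 1),
      (i == o + 5 + yl.*2 + zl.*2) ==> (vC == 2) &
      ((i < T) || (o + 6 + yl.*2 + zl.*2 <= i)) ==> (vC == 0)].

Definition moveB (d : dir) (h h' : nat) : bool :=
  match d with DL => h'.+1 == h | DR => h' == h.+1 | DS => h' == h end.

Definition stepB (i vS vH vC vS' vH' vC' : nat) : bool :=
  ((vH != i) ==> (vC' == vC)) &&
  ((vH == i) ==> [exists qa : tst M * option bool,
     let: (q', w, d) := adelta qa.1 qa.2 in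
     [&& vS == codeS qa.1, vC == codeC qa.2, vS' == codeS q', vC' == codeC w & moveB d vH vH']]).

Definition legalB n p T xr (t t' i j vS vH vC vS' vH' vC' yl zl vY vZ : nat) : bool :=
  (p < yl) || [&& zl <= p,
    (t == 0) ==> initB n T xr i j vS vH vC yl zl vY vZ,
    ((t' == t.+1) && (t' <= T)) ==> stepB i vS vH vC vS' vH' vC' &
    (t' == T) ==> (vS' == codeS (tacc M))].

Lemma feval_legal A rho : rho r1 = 1 ->
  feval A rho legalF = legalB (rho rN) (rho rP) (rho rT) (fun j => A j == Some true)
    (rho 1) (rho 2) (rho 3) (rho 4) (rho 5) (rho 6) (rho 7) (rho 8) (rho 9) (rho 10)
    (rho 11) (rho 12) (rho 13) (rho 14).
Proof.
move=> h.
have conjE f g : feval A rho (Conj f g) = feval A rho f && feval A rho g by [].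
have leE l l' : feval A rho (LeSum l l') = (sumr rho l <= sumr rho l') by [].
have litE k : sumr rho (lit k) = k by rewrite sumr_nseq h muln1.
have sE x l : sumr rho (x :: l) = rho x + sumr rho l by [].
have s0 : sumr rho [::] = 0 by [].
have bE : feval A rho (BitAt 4) = (A (rho 4) == Some true) by [].
have aE f fs : feval A rho (All (f :: fs)) = feval A rho f && feval A rho (All fs) by [].
have a0 : feval A rho (All [::]) = true by [].
pose fE := (aE, a0, conjE, feval_disj, feval_imp, bE, leE, feval_eq, litE, sE, s0, h).
have bitE r : feval A rho (bitF r) = (rho 7 == (rho r != 0).+1).
  by rewrite /bitF !fE !addn0; case: (rho r) => [|k] //=; rewrite andbT.
have initE : feval A rho initF = initB (rho rN) (rho rT) (fun j => A j == Some true)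
    (rho 3) (rho 4) (rho 5) (rho 6) (rho 7) (rho 11) (rho 12) (rho 13) (rho 14).
  rewrite /initF !(bitE, fE) !addn0 /initB !addn1 andbT.
  case: (A _ == _) => /=; rewrite ?andbT;
    repeat first [reflexivity | apply: (f_equal2 andb) | apply: (f_equal2 implb)
                 | apply: (f_equal2 orb)]; lia.
have moveE d : feval A rho (moveF d) = moveB d (rho 6) (rho 9).
  by case: d; rewrite /moveF !fE !addn0 ?addn1.
have stepE : feval A rho stepF = stepB (rho 3) (rho 5) (rho 6) (rho 7) (rho 8) (rho 9) (rho 10).
  rewrite /stepF !fE !addn0 feval_any /stepB implyNb; congr (_ && (_ ==> _)).
  rewrite has_map; apply/hasP/existsP => -[[q a]]; rewrite /= /ruleF.
    case E : (adelta q a) => [[q' w] d] _; rewrite !fE !addn0 moveE andbT => e.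
    by exists (q, a); rewrite /= E.
  case E : (adelta q a) => [[q' w] d] e; exists (q, a); rewrite ?mem_enum //=.
  by rewrite /ruleF E !fE !addn0 moveE andbT.
rewrite /legalF !(initE, stepE, fE) !addn0 !addn1 /legalB.
by rewrite andbT.
Qed.
End Legal.


(** * Correctness of the tableau *)

Definition code_at (s : seq bool) (r : nat) : nat := codeC (nth None (map Some s) r).

Lemma code_block (w s : seq bool) r :
  code_at ((flatten [seq [:: b; b] | b <- w] ++ [:: false; true]) ++ s) r =
  if r < (size w).*2 then (nth false w r./2).+1
  else if r == (size w).*2 then 1 else if r == (size w).*2.+1 then 2
  else code_at s (r - (size w).*2.+2).
Proof.
elim: w r => [|b w IH] [|[|r]] //=; first by rewrite subn2.
have -> : code_at (b :: b :: (flatten [seq [:: b; b] | b <- w] ++ [:: false; true]) ++ s) r.+2 =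
  code_at ((flatten [seq [:: b; b] | b <- w] ++ [:: false; true]) ++ s) r by [].
by rewrite IH doubleS !ltnS !eqSS !subSS.
Qed.

Lemma enc_code x y z r :
  let n := (size x).*2 in let yl := (size y).*2 in let zl := (size z).*2 in
  code_at (enc_tuple [:: x; y; z]) r =
  if r < n then (nth false x r./2).+1
  else if r == n then 1 else if r == n.+1 then 2
  else if r < n + 2 + yl then (nth false y (r - n.+2)./2).+1
  else if r == n + 2 + yl then 1 else if r == n + 3 + yl then 2
  else if r < n + 4 + yl + zl then (nth false z (r - (n + 4 + yl))./2).+1
  else if r == n + 4 + yl + zl then 1 else if r == n + 5 + yl + zl then 2 else 0.
Proof.
move=> n yl zl; rewrite /enc_tuple /= !code_block -/n -/yl -/zl.
rewrite /code_at /= nth_nil.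
case: ltnP => // h1; case: eqP => // h2; case: eqP => // h3.
rewrite (_ : (r - n.+2 < yl) = (r < n + 2 + yl)); last lia.
case: ltnP => // h4.
rewrite (_ : (r - n.+2 == yl) = (r == n + 2 + yl)); last lia.
rewrite (_ : (r - n.+2 == yl.+1) = (r == n + 3 + yl)); last lia.
case: eqP => // h5; case: eqP => // h6.
rewrite (_ : (r - n.+2 - yl.+2) = (r - (n + 4 + yl))); last lia.
rewrite (_ : (r - (n + 4 + yl) < zl) = (r < n + 4 + yl + zl)); last lia.
rewrite (_ : (r - (n + 4 + yl) == zl) = (r == n + 4 + yl + zl)); last lia.
by rewrite (_ : (r - (n + 4 + yl) == zl.+1) = (r == n + 5 + yl + zl)); last lia.
Qed.

Section CookLevin.
Variables (M : TM) (x : seq bool) (p T B : nat) (xr : nat -> bool).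
Hypothesis T_gt0 : 0 < T.
(** In T steps the head stays among the cells 0 to 2T; the other summands cover state codes, bit
    indices and lengths. *)
Hypothesis B_gt : (T.*2 + #|tst M| + size x + p + 7 < B).
Hypothesis xrE : forall j, j < size x -> xr j = nth false x (size x - j.+1).

Local Notation n := (size x).

Definition cell (tp : tape) (i : nat) : nat := codeC (tp (Z.of_nat i - Z.of_nat T)%Z).

Definition vec (Y : nat -> nat) (l : nat) : seq bool := mkseq (fun j => Y j != 0) l.

Lemma cell_word s i : cell (word_tape s) i = if i < T then 0 else code_at s (i - T).
Proof.
rewrite /cell /word_tape; case: Z.leb_spec => h; last by rewrite ifT //; lia.
by rewrite ifF; [congr codeC; congr nth; lia|lia].
Qed.

Lemma init_row vS vH C yl zl Y Z : yl <= p -> zl <= p ->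
  (forall i j, i < B -> j < B ->
     initB M n T xr i j vS vH (C i) yl zl (Y j) (Z j)) <->
  [/\ vS = codeS (tstart M), vH = T &
     forall i, i < B -> C i = cell (word_tape (enc_tuple [:: x; vec Y yl; vec Z zl])) i].
Proof.
move=> hy hz; split=> [h|[-> -> h] i j hi hj].
  split; [by have /andP[/eqP] := h 0 0 ltac:(lia) ltac:(lia)|
          by have /and3P[_ /eqP] := h 0 0 ltac:(lia) ltac:(lia)|move=> i hi].
  have {}h j : j < B -> _ := h i j hi.
  have j0 : 0 < B by lia.
  rewrite cell_word enc_code !size_mkseq; case: ltnP => hT.
    have /and5P[_ _ _ _ /and5P[_ _ _ _ /and4P[_ _ _ H]]] := h 0 j0.
    by apply/eqP/(implyP H); rewrite hT.
  move: hT; set r := i - T => hT; have ri : i = T + r by rewrite /r; lia.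
  clearbody r; subst i.
  case: ifP => c1.
    (* The constraint counts the bits of x from the end, so offset [r] belongs to this index. *)
    have /and5P[_ _ H _ _] := h (n - (r./2).+1) ltac:(lia).
    rewrite xrE in H; last lia.
    rewrite (_ : n - (n - (r./2).+1).+1 = r./2) in H; last lia.
    by apply/eqP/(implyP H); lia.
  case: ifP => c2.
    have /and5P[_ _ _ H _] := h 0 j0.
    by apply/eqP/(implyP H); lia.
  case: ifP => c3.
    have /and5P[_ _ _ _ /and5P[H _ _ _ _]] := h 0 j0.
    by apply/eqP/(implyP H); lia.
  case: ifP => c4.
    have /and5P[_ _ _ _ /and5P[_ H _ _ _]] := h (r - n.*2.+2)./2 ltac:(lia).
    rewrite nth_mkseq; last lia.
    by apply/eqP/(implyP H); lia.
  case: ifP => c5.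
    have /and5P[_ _ _ _ /and5P[_ _ H _ _]] := h 0 j0.
    by apply/eqP/(implyP H); lia.
  case: ifP => c6.
    have /and5P[_ _ _ _ /and5P[_ _ _ H _]] := h 0 j0.
    by apply/eqP/(implyP H); lia.
  case: ifP => c7.
    have /and5P[_ _ _ _ /and5P[_ _ _ _ /and4P[H _ _ _]]] := h (r - (n.*2 + 4 + yl.*2))./2 ltac:(lia).
    rewrite nth_mkseq; last lia.
    by apply/eqP/(implyP H); lia.
  case: ifP => c8.
    have /and5P[_ _ _ _ /and5P[_ _ _ _ /and4P[_ H _ _]]] := h 0 j0.
    by apply/eqP/(implyP H); lia.
  case: ifP => c9.
    have /and5P[_ _ _ _ /and5P[_ _ _ _ /and4P[_ _ H _]]] := h 0 j0.
    by apply/eqP/(implyP H); lia.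
  have /and5P[_ _ _ _ /and5P[_ _ _ _ /and4P[_ _ _ H]]] := h 0 j0.
  by apply/eqP/(implyP H); lia.
have {}h := h i hi; rewrite cell_word enc_code !size_mkseq in h.
rewrite /initB !eqxx /=; rewrite h; case: (ltnP i T) => hT.
  by clear h; do ?(apply/andP; split); apply/implyP => H; try done; exfalso; move: H; lia.
move: h hT; set r := i - T => h hT; have ri : i = T + r by rewrite /r; lia.
clear h; clearbody r; subst i.
do ?(apply/andP; split); apply/implyP.
- case/andP=> jn jr; rewrite xrE // ifT; last lia.
  by rewrite (_ : n - j.+1 = r./2) //; lia.
- by move/eqP=> e; do 1 (rewrite ifF; last lia); rewrite ifT //; lia.
- by move/eqP=> e; do 2 (rewrite ifF; last lia); rewrite ifT //; lia.
- case/andP=> jn jr; do 3 (rewrite ifF; last lia); rewrite ifT; last lia.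
  by rewrite nth_mkseq (_ : (r - n.*2.+2)./2 = j) //; lia.
- by move/eqP=> e; do 4 (rewrite ifF; last lia); rewrite ifT //; lia.
- by move/eqP=> e; do 5 (rewrite ifF; last lia); rewrite ifT //; lia.
- case/andP=> jn jr; do 6 (rewrite ifF; last lia); rewrite ifT; last lia.
  by rewrite nth_mkseq (_ : (r - (n.*2 + 4 + yl.*2))./2 = j) //; lia.
- by move/eqP=> e; do 7 (rewrite ifF; last lia); rewrite ifT //; lia.
- by move/eqP=> e; do 8 (rewrite ifF; last lia); rewrite ifT //; lia.
by case/orP=> e; do 9 (rewrite ifF; last lia).
Qed.

Lemma cell_upd tp pos w i : (0 <= Z.of_nat T + pos)%Z ->
  cell (upd tp pos w) i = if i == Z.to_nat (Z.of_nat T + pos) then codeC w else cell tp i.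
Proof.
move=> h; rewrite /cell /upd; case: Z.eqb_spec => e; first by rewrite ifT //; lia.
by rewrite ifF //; lia.
Qed.

(** At the head cell, injectivity of the codes leaves only the rule for the actual state and symbol.
    The lower bound 1 lets a left move stay among the naturals. *)
Lemma step_row (q : tst M) tp pos C' vS' vH' : (1 <= Z.of_nat T + pos < Z.of_nat B)%Z ->
  (forall i, i < B ->
     stepB M i (codeS q) (Z.to_nat (Z.of_nat T + pos)) (cell tp i) vS' vH' (C' i)) <->
  (let: (q', tp', pos') := astep (q, tp, pos) in
   [/\ vS' = codeS q', vH' = Z.to_nat (Z.of_nat T + pos') &
       forall i, i < B -> C' i = cell tp' i]).
Proof.
set h := Z.to_nat _ => hp; rewrite /astep; case E : (adelta q (tp pos)) => [[q' w] d].
have ch : cell tp h = codeC (tp pos) by rewrite /cell /h; congr (codeC (tp _)); lia.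
have mv v : moveB d h v <-> v = Z.to_nat (Z.of_nat T + (pos + dz d)).
  by rewrite /moveB /h /dz; case: (d); split=> [/eqP|] e; try apply/eqP; lia.
have cu i : cell (upd tp pos w) i = if i == h then codeC w else cell tp i.
  by apply: cell_upd; lia.
split=> [st|[-> -> hC] i hi].
  have hB : h < B by rewrite /h; lia.
  have /andP[_] := st h hB; rewrite eqxx /= => /existsP[[q1 a1] /=].
  case E1 : (adelta q1 a1) => [[q1' w1] d1] /and5P[/eqP/codeS_inj e1 /eqP].
  rewrite ch => /codeC_inj e2; move: E; rewrite e1 e2 E1 => -[-> -> ed] /eqP -> /eqP Cw.
  rewrite ed => /mv ->; split=> // i hi; rewrite cu.
  case: eqP => [->|ne]; first by [].
  by have /andP[] := st i hi; rewrite (_ : (h != i) = true) ?implyTb => [/eqP|]; last by apply/eqP => e; apply: ne.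
rewrite /stepB hC // cu; apply/andP; split; apply/implyP => e.
  by rewrite [i == h]eq_sym (negbTE e).
rewrite [i == h]eq_sym e; apply/existsP; exists (q, tp pos); rewrite /= E !eqxx -(eqP e) ch eqxx /=.
by apply/mv.
Qed.

Definition acfg_at s t : acfg M := iter t (@astep M) (ainit M s).

Lemma acfg_pos s t : (Z.abs (acfg_at s t).2 <= Z.of_nat t)%Z.
Proof.
elim: t => [|t]; first by rewrite /=; lia.
rewrite [acfg_at s t.+1]/= -/(acfg_at s t); case: (acfg_at s t) => [[q tp] pos] /=.
by case: adelta => [[q' w] []] /=; lia.
Qed.

Definition legalC (d : seq nat) : bool :=
  legalB M n p T xr (dig d 1) (dig d 2) (dig d 3) (dig d 4) (dig d 5) (dig d 6) (dig d 7)
    (dig d 8) (dig d 9) (dig d 10) (dig d 11) (dig d 12) (dig d 13) (dig d 14).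

Definition rows (beta : var -> nat) s t :=
  [/\ beta (0, t, 0) = codeS (acfg_at s t).1.1,
      beta (1, t, 0) = Z.to_nat (Z.of_nat T + (acfg_at s t).2) &
      forall i, i < B -> beta (2, t, i) = cell (acfg_at s t).1.2 i].

Lemma codeS_lt (q : tst M) : codeS q < B.
Proof. by apply: (@leq_trans #|tst M|); [exact: ltn_ord|lia]. Qed.

Lemma codeC_lt a : codeC a < 3.
Proof. by case: a => [[]|]. Qed.

(** By induction on time the constraints leave a single tableau up to T, that of the run on [s]. *)
Lemma legal_rows (beta : var -> nat) :
  let yl := beta (3, 0, 0) in let zl := beta (4, 0, 0) in
  let s := enc_tuple [:: x; vec (fun j => beta (5, j, 0)) yl; vec (fun j => beta (6, j, 0)) zl] in
  yl <= p ->
  (forall t t' i j, t < B -> t' < B -> i < B -> j < B -> t != t' -> legalC (conof beta t t' i j))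
  <-> [/\ zl <= p, forall t, t <= T -> rows beta s t & beta (0, T, 0) = codeS (tacc M)].
Proof.
move=> yl zl s hy.
have legE t t' i j : legalC (conof beta t t' i j) = [&& zl <= p,
    (t == 0) ==> initB M n T xr i j (beta (0, t, 0)) (beta (1, t, 0)) (beta (2, t, i)) yl zl
       (beta (5, j, 0)) (beta (6, j, 0)),
    ((t' == t.+1) && (t' <= T)) ==> stepB M i (beta (0, t, 0)) (beta (1, t, 0))
       (beta (2, t, i)) (beta (0, t', 0)) (beta (1, t', 0)) (beta (2, t', i)) &
    (t' == T) ==> (beta (0, t', 0) == codeS (tacc M))].
  by rewrite /legalC /legalB ltnNge hy.
have stp t C' vS' vH' : t < T -> rows beta s t -> 
  (forall i, i < B -> stepB M i (beta (0, t, 0)) (beta (1, t, 0)) (beta (2, t, i)) vS' vH' (C' i))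
  <-> [/\ vS' = codeS (acfg_at s t.+1).1.1,
          vH' = Z.to_nat (Z.of_nat T + (acfg_at s t.+1).2) &
          forall i, i < B -> C' i = cell (acfg_at s t.+1).1.2 i].
  move=> ht [-> -> hC]; rewrite [acfg_at s t.+1]/= -/(acfg_at s t).
  have := @acfg_pos s t; move: hC; case: (acfg_at s t) => [[q tp] pos] /= hC hpos.
  have := @step_row q tp pos C' vS' vH'; rewrite /=; case: adelta => [[q' w] d] /= [|h1 h2]; first lia.
  split=> [h|/h2 h i hi]; last by rewrite hC // h.
  by apply: h1 => i hi; rewrite -hC // h.
split=> [lg|[hz hr hacc] t t' i j ht ht' hi hj ne]; last first.
  rewrite legE hz /=; apply/and3P; split; apply/implyP.
  - move=> /eqP e; subst t; have [e1 e2 e3] := hr 0 isT.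
    have [_ h] := init_row (beta (0, 0, 0)) (beta (1, 0, 0)) (fun i => beta (2, 0, i))
      (fun j => beta (5, j, 0)) (fun j => beta (6, j, 0)) hy hz.
    by apply: h => //; split=> //; rewrite e2 /=; lia.
  - move=> /andP[/eqP e le]; subst t'.
    have [_ h] := stp t (fun i => beta (2, t.+1, i)) (beta (0, t.+1, 0)) (beta (1, t.+1, 0)) le (hr _ (ltnW le)).
    by apply: h => //; apply: hr.
  - by move=> /eqP ->; rewrite hacc.
have B0 : 0 < B by lia.
have B1 : 1 < B by lia.
have hz : zl <= p by have := lg 0 1 0 0 B0 B1 B0 B0 isT; rewrite legE => /andP[].
split=> //; last first.
  (* Acceptance is stated for the later time of a constraint; as T is positive, it can be paired
     with time 0. *)
  have := lg 0 T 0 0 B0 ltac:(lia) B0 B0; rewrite legE eq_sym -lt0n T_gt0 => /(_ isT) /and4P[_ _ _].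
  by rewrite eqxx => /eqP.
elim=> [|t IH] ht.
  have [h _] := init_row (beta (0, 0, 0)) (beta (1, 0, 0)) (fun i => beta (2, 0, i))
    (fun j => beta (5, j, 0)) (fun j => beta (6, j, 0)) hy hz.
  case: h => [i j hi hj|e1 e2 e3].
    by have := lg 0 1 i j B0 B1 hi hj isT; rewrite legE => /and3P[].
  by split=> //; rewrite e2 /=; lia.
have [h _] := stp t (fun i => beta (2, t.+1, i)) (beta (0, t.+1, 0)) (beta (1, t.+1, 0)) ht (IH (ltnW ht)).
apply: h => i hi; have := lg t t.+1 i 0 ltac:(lia) ltac:(lia) hi B0.
by rewrite legE eqxx ht => /(_ _) /and4P[|_ _]; first by lia.
Qed.

Lemma csp_cook_levin :
  (forall alpha : var -> nat, (forall v, alpha v < B) ->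
    exists2 beta : var -> nat, (forall v, beta v < B) &
      (forall k a b, visible k -> a < B -> b < B -> beta (k, a, b) = alpha (k, a, b)) /\
      (forall t t' i j, t < B -> t' < B -> i < B -> j < B -> t != t' ->
         legalC (conof beta t t' i j))) <->
  (forall y, size y <= p -> exists2 z, size z <= p &
     (acfg_at (enc_tuple [:: x; y; z]) T).1.1 = tacc M).
Proof.
have B0 : 0 < B by lia.
have B1 : 1 < B by lia.
have vecK w l : size w = l -> vec (fun j => nat_of_bool (nth false w j)) l = w.
  move=> <-; apply: (@eq_from_nth _ false); rewrite size_mkseq // => i hi.
  by rewrite nth_mkseq //; case: nth.
split=> [csp y hy|hL alpha ha].
  pose alpha (v : var) := let: (k, a, b) := v in
    if k == 3 then size y else if k == 5 then nat_of_bool (nth false y a) else 0.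
  have ha v : alpha v < B.
    case: v => [[k a] b] /=; case: ifP => _; first lia.
    by case: ifP => _ //; case: nth.
  have [beta hb [bv lg]] := csp _ ha.
  have yl : beta (3, 0, 0) = size y by rewrite bv.
  have hyl : beta (3, 0, 0) <= p by rewrite yl.
  have [h _] := legal_rows hyl; case: (h lg) => hz hr hacc.
  exists (vec (fun j => beta (6, j, 0)) (beta (4, 0, 0))); first by rewrite size_mkseq.
  have [e _ _] := hr T (leqnn T); apply: codeS_inj; rewrite -hacc e.
  congr (codeS (acfg_at (enc_tuple [:: x; _; _]) T).1.1).
  rewrite yl -[LHS](vecK _ (size y)) //; apply: (@eq_from_nth _ false); rewrite !size_mkseq // => i hi.
  by rewrite !nth_mkseq // bv //; lia.
(* If the announced y is too long, every tuple is legal and [alpha] extends itself. *)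
case: (ltnP p (alpha (3, 0, 0))) => hyl.
  exists alpha => //; split=> // t t' i j *.
  by rewrite /legalC /legalB hyl.
pose y := vec (fun j => alpha (5, j, 0)) (alpha (3, 0, 0)).
have [|z hz acc] := hL y; first by rewrite size_mkseq.
set s := enc_tuple _ in acc.
(* y comes from [alpha], z from the witness and the rows up to T from the run; later rows are 0 to
   stay below [B]. *)
pose beta (v : var) := let: (k, a, b) := v in
  if visible k then alpha v else if k == 4 then size z
  else if k == 6 then nat_of_bool (nth false z a)
  else if a <= T then
    if k == 0 then codeS (acfg_at s a).1.1
    else if k == 1 then Z.to_nat (Z.of_nat T + (acfg_at s a).2)
    else codeC ((acfg_at s a).1.2 (Z.of_nat b - Z.of_nat T)%Z)
  else 0.
exists beta.
  case=> [[k a] b]; rewrite /beta; case: ifP => // _; case: ifP => _; first lia.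
  case: ifP => _; first by case: nth => /=; lia.
  case: ifP => // aT; case: ifP => _; first exact: codeS_lt.
  case: ifP => _; first by have := @acfg_pos s a; lia.
  by apply: leq_trans (codeC_lt _) _; lia.
split=> [k a b vk _ _|]; first by rewrite /beta vk.
have [_ h] := @legal_rows beta hyl; apply: h; split=> //; last first.
  by rewrite /beta /= leqnn acc.
rewrite [beta (3, 0, 0)]/= [beta (4, 0, 0)]/= (vecK z) //= -/y -/s => t ht.
by split; rewrite /beta /= ?ht // => i _; rewrite ht.
Qed.

End CookLevin.


(** * Causality and conflict as formulas *)

Lemma feval_conj A rho f g : feval A rho (Conj f g) = feval A rho f && feval A rho g.
Proof. by []. Qed.

Lemma feval_neg A rho f : feval A rho (Neg f) = ~~ feval A rho f.
Proof. by []. Qed.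

Definition term := seq nat.
Definition entry := (term * term * term * term)%type.

Definition evalE (rho : env) (e : entry) : var * nat :=
  let: (k, a, b, v) := e in ((sumr rho k, sumr rho a, sumr rho b), sumr rho v).

Definition sameVar (e e' : entry) : fm :=
  let: (k, a, b, v) := e in let: (k', a', b', v') := e' in
  All [:: EqSum k k'; EqSum a a'; EqSum b b'].

Definition sameVal (e e' : entry) : fm :=
  let: (k, a, b, v) := e in let: (k', a', b', v') := e' in EqSum v v'.

(** The shape of a support depends on the type of the tuple; guards express this case distinction
    without quantifiers. *)
Definition guarded := seq (fm * seq entry).

Definition evalG A (rho : env) (gs : guarded) : seq (var * nat) :=
  flatten [seq (if feval A rho g.1 then map (evalE rho) g.2 else [::]) | g <- gs].

Lemma evalG_cons A rho f es gs : evalG A rho ((f, es) :: gs) =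
  (if feval A rho f then map (evalE rho) es else [::]) ++ evalG A rho gs.
Proof. by []. Qed.

(** Conflict and causality both ask for a related pair of entries in two supports of fixed size,
    which is a finite disjunction. *)
Definition crossF (f : entry -> entry -> fm) (gs gs' : guarded) : fm :=
  Any [seq Conj g.1 (Any [seq Conj g'.1 (Any [seq f e e' | e <- g.2, e' <- g'.2]) | g' <- gs'])
      | g <- gs].

Definition clashF := crossF (fun e e' => Conj (sameVar e e') (Neg (sameVal e e'))).
Definition meetF := crossF (fun e e' => Conj (sameVar e e') (sameVal e e')).

Lemma feval_same A rho e e' :
  feval A rho (sameVar e e') = ((evalE rho e).1 == (evalE rho e').1) /\
  feval A rho (sameVal e e') = ((evalE rho e).2 == (evalE rho e').2).
Proof.
case: e e' => [[[k a] b] v] [[[k' a'] b'] v']; rewrite /sameVar /sameVal !feval_all.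
by split; rewrite /= -!eqn_leq ?andbT // !xpair_eqE andbA.
Qed.

Lemma feval_cross A rho f (r : var * nat -> var * nat -> bool) gs gs' :
  (forall e e', feval A rho (f e e') = r (evalE rho e) (evalE rho e')) ->
  feval A rho (crossF f gs gs') =
  has (fun p => has (r p) (evalG A rho gs')) (evalG A rho gs).
Proof.
move=> fE.
have hasG (P : pred (var * nat)) hs : has P (evalG A rho hs) =
    has (fun g => feval A rho g.1 && has (fun e => P (evalE rho e)) g.2) hs.
  elim: hs => //= g hs IH; rewrite /evalG /= has_cat -/(evalG A rho hs) IH.
  by case: ifP => //= _; rewrite has_map.
rewrite feval_any has_map hasG; apply: eq_has => g /=.
rewrite feval_any has_map; case: (feval A rho g.1) => //=.
transitivity (has (fun g' => feval A rho g'.1 &&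
    has (fun e => has (fun e' => r (evalE rho e) (evalE rho e')) g'.2) g.2) gs').
  apply: eq_has => g' /=; rewrite feval_any; congr (_ && _).
  elim: g.2 => //= e es IH; rewrite has_cat IH has_map; congr (_ || _).
  by apply: eq_has => e'; rewrite /= fE.
rewrite (eq_has (fun e => hasG (r (evalE rho e)) gs')) /=.
elim: gs' => [|g' hs IH] /=; first by elim: g.2.
rewrite IH; elim: g.2 => [|e es IHe] /=; first by rewrite andbF.
by rewrite -IHe; case: (feval A rho g'.1) => //=; rewrite orbACA.
Qed.

Lemma feval_clash A rho gs gs' :
  feval A rho (clashF gs gs') = clash (evalG A rho gs) (evalG A rho gs').
Proof.
apply: (feval_cross (r := fun p q => (p.1 == q.1) && (p.2 != q.2))) => e e' /=.
by have [-> ->] := feval_same A rho e e'.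
Qed.

Lemma feval_meet A rho gs gs' :
  feval A rho (meetF gs gs') = has (mem (evalG A rho gs')) (evalG A rho gs).
Proof.
rewrite /meetF (feval_cross (r := fun p q => (p.1 == q.1) && (p.2 == q.2))) => [|e e'].
  apply: eq_has => p; rewrite -[RHS]/(p \in evalG A rho gs') -has_pred1; apply: eq_has => q /=.
  by case: p q => [a b] [c d]; rewrite xpair_eqE eq_sym [d == b]eq_sym.
by rewrite /=; have [-> ->] := feval_same A rho e e'.
Qed.

Definition cellE o : entry := ([:: o + 1], [:: o + 2], [:: o + 3], [:: o + 4]).

Definition scopeE o : seq entry :=
  [:: (lit 0, [:: o + 1], [::], [:: o + 5]); (lit 1, [:: o + 1], [::], [:: o + 6]);
      (lit 2, [:: o + 1], [:: o + 3], [:: o + 7]);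
      (lit 0, [:: o + 2], [::], [:: o + 8]); (lit 1, [:: o + 2], [::], [:: o + 9]);
      (lit 2, [:: o + 2], [:: o + 3], [:: o + 10]);
      (lit 3, [::], [::], [:: o + 11]); (lit 4, [::], [::], [:: o + 12]);
      (lit 5, [:: o + 4], [::], [:: o + 13]); (lit 6, [:: o + 4], [::], [:: o + 14])].

Definition typeF o k := EqSum [:: o] (lit k).
Definition conF o := Conj (typeF o 3) (Neg (EqSum [:: o + 1] [:: o + 2])).
Definition zeroF o := EqSum (iota o 15) [::].
Definition restF := EqSum (iota 5 10) [::].
Definition visF :=
  All [:: typeF 0 2; Disj (EqSum [:: 1] (lit 3)) (EqSum [:: 1] (lit 5)); restF].

Definition supp1G o : guarded := [:: (typeF o 2, [:: cellE o])].
Definition supp2G o : guarded :=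
  [:: (Disj (typeF o 1) (typeF o 2), [:: cellE o]); (conF o, scopeE o)].

Definition orderF (ch : nat -> fm) (G : nat -> guarded) : fm :=
  Disj (Conj (zeroF 0) (Neg (zeroF 15)))
       (Conj (ch 0) (Conj (Neg (ch 15)) (meetF (G 0) (G 15)))).

Definition choice1F o := typeF o 2.
Definition choice2F o := typeF o 1.

Lemma sumr_eq0 (rho : env) l : sumr rho l = 0 <-> all (fun r => rho r == 0) l.
Proof.
rewrite /sumr; elim: l => //= r l IH; split=> [e|/andP[/eqP -> /IH ->] //].
by apply/andP; split; [apply/eqP|apply/IH]; lia.
Qed.

Lemma all_dig (l : seq nat) : l = [seq dig l k | k <- iota 0 (size l)].
Proof. by rewrite -[LHS](mkseq_nth 0). Qed.

Section StructureFormulas.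
Variables (A : nat -> option bool) (rho : env) (o : nat) (d : seq nat).
Hypothesis one : rho r1 = 1.
Hypothesis sd : size d = 15.
Hypothesis rhoE : forall k, k < 15 -> rho (o + k) = dig d k.

Lemma feval_type k : feval A rho (typeF o k) = (dig d 0 == k).
Proof.
rewrite /typeF feval_eq sumr_nseq one muln1 -(rhoE (isT : 0 < 15)).
by rewrite /sumr /= !addn0.
Qed.

Lemma feval_con : feval A rho (conF o) = iscon d.
Proof.
rewrite /conF feval_conj feval_neg feval_type feval_eq.
by rewrite /sumr /= !addn0 !rhoE.
Qed.

Lemma feval_zero : feval A rho (zeroF o) = (d == nseq 15 0).
Proof.
rewrite /zeroF feval_eq; apply/eqP/eqP => [/sumr_eq0/allP h|e].
  rewrite (all_dig d) sd -[RHS]/[seq 0 | k <- iota 0 15]; apply/eq_in_map => k.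
  rewrite mem_iota => /andP[_ hk]; rewrite -rhoE //; apply/eqP/h.
  by rewrite mem_iota leq_addr ltn_add2l.
apply/sumr_eq0/allP => r; rewrite mem_iota => /andP[h1 h2].
rewrite -(subnKC h1) rhoE; last lia.
by rewrite e /dig nth_nseq; case: ifP.
Qed.

Lemma feval_supp1 : evalG A rho (supp1G o) = supp1 d.
Proof.
rewrite /supp1G evalG_cons cats0 feval_type /supp1; case: ifP => // _.
by rewrite /= /sumr /= !addn0 !rhoE.
Qed.

Lemma feval_supp2 : evalG A rho (supp2G o) = supp2 d.
Proof.
rewrite /supp2G !evalG_cons cats0 feval_disj !feval_type feval_con /supp2.
case: ifP => [h|_].
  rewrite /iscon (_ : dig d 0 == 3 = false); last by case/orP: h => /eqP ->.
  by rewrite /= /sumr /= !addn0 !rhoE.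
rewrite cat0s; case: ifP => // _.
rewrite /conpairs (_ : drop 5 d = [seq dig d k | k <- iota 5 10]); last first.
  by rewrite {1}(all_dig d) -map_drop drop_iota sd.
by rewrite /= /sumr /= one !addn0 !rhoE.
Qed.

End StructureFormulas.

Lemma feval_rest A rho d : size d = 15 -> (forall k, k < 15 -> rho k = dig d k) ->
  feval A rho restF = rest0 d.
Proof.
move=> sd h; rewrite /restF feval_eq /rest0.
rewrite (_ : drop 5 d = [seq dig d k | k <- iota 5 10]); last first.
  by rewrite {1}(all_dig d) -map_drop drop_iota sd.
have lt15 k : k \in iota 5 10 -> k < 15 by rewrite mem_iota => /andP[].
rewrite all_map; apply/eqP/idP => [/sumr_eq0/allP hz|/allP hz].
  by apply/allP => k hk; rewrite /= -(h _ (lt15 _ hk)) hz.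
by apply/sumr_eq0/allP => k hk; rewrite (h _ (lt15 _ hk)); exact: hz.
Qed.

Lemma feval_vis A rho d : rho r1 = 1 -> size d = 15 -> (forall k, k < 15 -> rho k = dig d k) ->
  feval A rho visF = isvis d.
Proof.
move=> one sd h; rewrite /visF -[feval _ _ _]/[&& feval A rho (typeF 0 2),
  feval A rho (Disj (EqSum [:: 1] (lit 3)) (EqSum [:: 1] (lit 5))), feval A rho restF & true].
rewrite (feval_type A (o := 0) one h) andbT (feval_rest _ sd h) feval_disj !feval_eq.
by rewrite /sumr /= one !addn0 h.
Qed.

Lemma feval_order A rho ch chF G S d d' : rho r1 = 1 -> size d = 15 -> size d' = 15 ->
  (forall k, k < 15 -> rho (0 + k) = dig d k) -> (forall k, k < 15 -> rho (15 + k) = dig d' k) ->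
  feval A rho (chF 0) = ch d -> feval A rho (chF 15) = ch d' ->
  evalG A rho (G 0) = S d -> evalG A rho (G 15) = S d' ->
  feval A rho (orderF chF G) = tuple_lt 15 ch S d d'.
Proof.
move=> one sd sd' h h' c c' e e'; rewrite /orderF feval_disj (feval_conj _ _ (zeroF 0)) (feval_conj _ _ (chF 0)).
rewrite (feval_conj _ _ (Neg (chF 15))) !feval_neg.
rewrite (feval_zero A one sd h) (feval_zero A one sd' h').
by rewrite c c' feval_meet e e'.
Qed.


(** * Emitting an event structure *)

Definition testF := cond 36 37 38.
(** No second tuple is in use while labels are printed, so its registers 15 to 29 can serve as
    counters then. *)
Definition scratch := iota 15 15 ++ tmps 36 37 38.

Definition lowvars (f : fm) := all (fun r => r < 36) (fvars f).

Arguments lowvars : simpl never.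

Lemma lowvars_fresh f : lowvars f -> fresh 36 37 38 (fvars f).
Proof. by apply: sub_all => r hr; rewrite /tmps !inE; lia. Qed.

Lemma lowvars_disj f g : lowvars (Disj f g) = lowvars f && lowvars g.
Proof. by rewrite /lowvars /Disj /= all_cat. Qed.

Lemma lowvars_conj f g : lowvars (Conj f g) = lowvars f && lowvars g.
Proof. by rewrite /lowvars /= all_cat. Qed.

Lemma lowvars_imp f g : lowvars (Imp f g) = lowvars f && lowvars g.
Proof. by rewrite /Imp lowvars_disj. Qed.

Lemma lowvars_eq l l' : lowvars (EqSum l l') = all (fun r => r < 36) (l ++ l').
Proof. by rewrite /lowvars /EqSum /= !all_cat; case: all; case: all. Qed.

Lemma lowvars_any fs : lowvars (Any fs) = all lowvars fs.
Proof. by elim: fs => // f fs IH; rewrite [Any _]/= lowvars_disj IH. Qed.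

Lemma lowvars_all fs : lowvars (All fs) = all lowvars fs.
Proof. by elim: fs => // f fs IH; rewrite [All _]/= lowvars_conj IH. Qed.

Lemma lowvars_legal M : lowvars (legalF M).
Proof.
have low k : all (fun r => r < 36) (lit k) by rewrite all_nseq orbT.
rewrite /legalF lowvars_disj; apply/andP; split => //.
rewrite lowvars_all /= !lowvars_imp lowvars_conj !lowvars_eq !all_cat low /=.
rewrite andbT; apply/andP; split.
  by rewrite /initF lowvars_all /= lowvars_eq all_cat low.
rewrite /stepF lowvars_conj lowvars_imp lowvars_any; apply/andP; split=> //=.
rewrite all_map; apply/allP => -[q a] _; rewrite /= /ruleF.
case: (adelta q a) => [[q' w] d].
by rewrite lowvars_all /= !lowvars_eq !all_cat !low; case: d.
Qed.

(** One summand of [rank] in unary, digit [k] times [B ^ m]; the loops print it without first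
    computing it. *)
Definition rankpart k m := For 15 k (loops (iota 16 m) rB (Emit true)).

Definition rankC : cmd :=
  Seq (rankpart 0 4) (Seq (rankpart 1 3) (Seq (rankpart 2 2) (Seq (rankpart 3 1) (rankpart 4 0)))).

Definition lab1C := testF (Disj visF (Conj (conF 0) restF)) rankC Skip.

Definition lab2C M := testF visF rankC (testF (conF 0) (testF (legalF M) rankC (Emit true)) Skip).

Definition order1F := orderF choice1F supp1G.
Definition order2F := orderF choice2F supp2G.
Definition conflict1F := clashF (supp1G 0) (supp1G 15).
Definition conflict2F := clashF (supp2G 0) (supp2G 15).

Definition genC (labC : cmd) (ltF cfF : fm) : cmd :=
  let D := iota 0 15 in let D' := iota 15 15 in
  Seq (Seq (loops D rB (Emit true)) (Emit false))
  (Seq (loops D rB (Seq labC (Emit false)))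
  (Seq (loops D rB (loops D' rB (testF ltF (Emit true) (Emit false))))
       (loops D rB (loops D' rB (testF cfF (Emit true) (Emit false)))))).

Lemma setrs_iota rho a m d r : size d = m ->
  setrs rho (iota a m) d r = if a <= r < a + m then nth 0 d (r - a) else rho r.
Proof.
elim: m a d rho => [|m IH] a [|x d] rho //= => [_|[sd]]; first by rewrite ifF //; lia.
rewrite IH // /setr; case: ifP => h1; case: ifP => h2; try lia.
- by rewrite (_ : r - a = (r - a.+1).+1) //; lia.
- by rewrite (eqP h2) ifT ?subnn //; lia.
- by rewrite ifF //; lia.
Qed.

Definition enc_fles (N : nat) (labs : seq nat) (lts cfs : seq bool) : seq bool :=
  nseq N true ++ false :: flatten [seq nseq l true ++ [:: false] | l <- labs] ++ lts ++ cfs.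

Lemma flatten_const (T U : Type) (w : seq T) (s : seq U) :
  flatten [seq w | _ <- s] = flatten (nseq (size s) w).
Proof. by elim: s => //= _ s ->. Qed.

Lemma flatten_nseq_true k m : flatten (nseq k (nseq m true)) = nseq (k * m) true.
Proof. by elim: k => //= k ->; rewrite -nseqD mulSn. Qed.

Section Emission.
Variable A : nat -> option bool.

Lemma emits_ext Z c w w' : (forall rho, w rho = w' rho) -> emits A Z c w -> emits A Z c w'.
Proof. by move=> e h s a z; rewrite h // e. Qed.

Lemma emits_count Z vs b n : uniq (b :: vs) -> {subset vs <= Z} ->
  emits A Z (loops vs b (Emit n)) (fun rho => nseq (rho b ^ size vs) n).
Proof.
move=> /[dup] u /= /andP[_ _] sub.
have nh : ~~ has (mem [::]) vs by apply/hasPn.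
have h := emits_loops u nh (@emits_emit A [::] n).
apply: (@emits_sub A (vs ++ [::]) Z); first by move=> x; rewrite cats0; apply: sub.
apply: emits_ext h => rho.
by rewrite flatten_const size_tups; elim: (_ ^ _) => //= k ->.
Qed.

Lemma emits_rankpart k m : k < 15 -> m < 15 ->
  emits A scratch (rankpart k m) (fun rho => nseq (rho k * rho rB ^ m) true).
Proof.
move=> hk hm.
have u : uniq (rB :: iota 16 m) by rewrite /= iota_uniq mem_iota andbT /rB; lia.
have h := @emits_count (iota 16 m) _ _ true u (fun x h => h).
apply: emits_sub (emits_ext _ (@emits_for A _ 15 k _ _ _ _ h)); first last.
- by apply/eqP => e; rewrite -e in hk.
- by rewrite mem_iota.
- move=> rho; rewrite size_iota.
  rewrite (_ : (fun i => nseq (setr rho 15 i rB ^ m) true) = (fun=> nseq (rho rB ^ m) true)) //.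
  by rewrite flatten_const size_iota flatten_nseq_true.
move=> x; rewrite /scratch mem_cat in_cons !mem_iota; lia.
Qed.

Lemma emits_rank : emits A scratch rankC
  (fun rho => nseq (rank (rho rB) [seq rho k | k <- iota 0 5]) true).
Proof.
apply: emits_ext (emits_seq (emits_rankpart _ _) (emits_seq (emits_rankpart _ _)
  (emits_seq (emits_rankpart _ _) (emits_seq (emits_rankpart _ _) (emits_rankpart _ _))))) => //.
by move=> rho; rewrite -!nseqD /= addn0.
Qed.

Lemma emits_test Z f c d w w' : {subset tmps 36 37 38 <= Z} -> lowvars f ->
  emits A Z c w -> emits A Z d w' ->
  emits A Z (testF f c d) (fun rho => if feval A rho f then w rho else w' rho).
Proof. by move=> hZ hf; apply: emits_cond => //; apply: lowvars_fresh. Qed.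

Lemma tmps_scratch : {subset tmps 36 37 38 <= scratch}.
Proof. by move=> x hx; rewrite /scratch mem_cat hx orbT. Qed.

Definition lab1E (rho : env) : nat :=
  if feval A rho (Disj visF (Conj (conF 0) restF))
  then rank (rho rB) [seq rho k | k <- iota 0 5] else 0.

Definition lab2E M (rho : env) : nat :=
  if feval A rho visF then rank (rho rB) [seq rho k | k <- iota 0 5]
  else if feval A rho (conF 0) then
    (if feval A rho (legalF M) then rank (rho rB) [seq rho k | k <- iota 0 5] else 1)
  else 0.

Lemma emits_lab1 : emits A scratch lab1C (fun rho => nseq (lab1E rho) true).
Proof.
apply: emits_ext (emits_test tmps_scratch _ emits_rank (@emits_skip A _)) => // rho.
by rewrite /lab1E; case: ifP.
Qed.

Lemma emits_lab2 M : emits A scratch (lab2C M) (fun rho => nseq (lab2E M rho) true).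
Proof.
apply: emits_ext (emits_test tmps_scratch _ emits_rank
  (emits_test tmps_scratch _ (emits_test tmps_scratch (lowvars_legal M) emits_rank
     (@emits_emit A _ true)) (@emits_skip A _))) => // rho.
by rewrite /lab2E; do 3 case: ifP => //.
Qed.

Definition low (rho : env) d := setrs rho (iota 0 15) d.
Definition both (rho : env) d d' := setrs (low rho d) (iota 15 15) d'.

Lemma emits_gen labC labE ltF cfF : lowvars ltF -> lowvars cfF ->
  emits A scratch labC (fun rho => nseq (labE rho) true) ->
  emits A (iota 0 15 ++ scratch) (genC labC ltF cfF) (fun rho =>
    let T := tups (rho rB) 15 in
    enc_fles (rho rB ^ 15) [seq labE (low rho d) | d <- T]
      [seq feval A (both rho d d') ltF | d <- T, d' <- T]
      [seq feval A (both rho d d') cfF | d <- T, d' <- T]).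
Proof.
move=> hlt hcf hlab.
have u0 : uniq (rB :: iota 0 15) by [].
have u15 : uniq (rB :: iota 15 15) by [].
have mat f : lowvars f -> emits A (iota 0 15 ++ scratch)
    (loops (iota 0 15) rB (loops (iota 15 15) rB (testF f (Emit true) (Emit false))))
    (fun rho => let T := tups (rho rB) 15 in [seq feval A (both rho d d') f | d <- T, d' <- T]).
  move=> hf; have h := emits_test (fun x h => h) hf (@emits_emit A _ true) (@emits_emit A _ false).
  apply: emits_ext (emits_loops u0 _ (emits_loops u15 _ h)) => // rho.
  rewrite !size_iota; congr flatten; apply/eq_in_map => d; rewrite mem_tups => /andP[/eqP sd _].
  rewrite (setrs_iota _ _ _ sd) (_ : 0 <= rB < 0 + 15 = false) //.
  elim: (tups _ _) => //= d' s ->; case: feval => //.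
have head : emits A (iota 0 15 ++ scratch) (loops (iota 0 15) rB (Emit true))
    (fun rho => nseq (rho rB ^ 15) true).
  by apply: emits_count => // x hx; rewrite mem_cat hx.
have labs : emits A (iota 0 15 ++ scratch) (loops (iota 0 15) rB (Seq labC (Emit false)))
    (fun rho => flatten [seq nseq (labE (low rho d)) true ++ [:: false] | d <- tups (rho rB) 15]).
  exact: emits_loops u0 _ (emits_seq hlab (@emits_emit A _ false)).
apply: emits_ext (emits_seq (emits_seq head (@emits_emit A _ false))
  (emits_seq labs (emits_seq (mat _ hlt) (mat _ hcf)))).
by move=> rho; rewrite /enc_fles -map_comp -catA.
Qed.

End Emission.

Lemma mods_rank x : mods rankC x -> x \in scratch.
Proof. by rewrite /scratch /= !inE; lia. Qed.

Lemma mods_test f c d (P : pred nat) : {subset tmps 36 37 38 <= P} ->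
  (forall x, mods c x -> x \in P) -> (forall x, mods d x -> x \in P) ->
  forall x, mods (testF f c d) x -> x \in P.
Proof. by move=> ht hc hd x /mods_cond/or3P[/ht|/hc|/hd]. Qed.

Lemma wf_test f c d : lowvars f -> wf c -> wf d -> wf (testF f c d).
Proof. by move=> hf; apply: wf_cond => //; apply: lowvars_fresh. Qed.

Definition low_reg : pred nat := fun r => r < 36.

Lemma boundable_test f c d : lowvars f ->
  boundable low_reg c -> boundable low_reg d -> boundable low_reg (testF f c d).
Proof. by move=> hf; apply: boundable_cond. Qed.

Definition good_body c := [/\ wf c, boundable low_reg c & forall x, mods c x -> x \in scratch].

Lemma good_test f c d : lowvars f -> good_body c -> good_body d -> good_body (testF f c d).
Proof.
move=> hf [w1 b1 m1] [w2 b2 m2]; split; [exact: wf_test|exact: boundable_test|].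
by apply: mods_test => // x; apply: tmps_scratch.
Qed.

Lemma good_rank : good_body rankC.
Proof. by split=> //; exact: mods_rank. Qed.

Lemma good_lab1 : good_body lab1C.
Proof. by apply: good_test => //; exact: good_rank. Qed.

Lemma good_lab2 M : good_body (lab2C M).
Proof.
apply: good_test => //; first exact: good_rank.
apply: good_test => //; apply: good_test => //; [exact: lowvars_legal|exact: good_rank].
Qed.

Lemma good_gen labC ltF cfF : lowvars ltF -> lowvars cfF -> good_body labC ->
  wf (genC labC ltF cfF) && boundable low_reg (genC labC ltF cfF).
Proof.
move=> hlt hcf [wl bl ml].
have nsc x : x \in rB :: iota 0 15 -> x \in scratch -> false.
  by rewrite /scratch mem_cat !inE /rB; lia.
pose mc f := loops (iota 0 15) rB (loops (iota 15 15) rB (testF f (Emit true) (Emit false))).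
have mat f : lowvars f -> wf (mc f) && boundable low_reg (mc f).
  move=> hf; have [w b m] : good_body (testF f (Emit true) (Emit false)) by apply: good_test.
  rewrite /mc !boundable_loops // andbT; apply: wf_loops => //.
    apply: wf_loops => // x hx; apply/negP => /mods_cond/or3P[] //.
    by move: hx; rewrite !inE /rB; lia.
  move=> x hx; apply/negP => /mods_loops/orP[h|/m/(nsc _ hx)//].
  by have := nsc x hx; rewrite /scratch mem_cat h => /(_ isT).
have sq c d : wf c && boundable low_reg c -> wf d && boundable low_reg d ->
    wf (Seq c d) && boundable low_reg (Seq c d).
  by move=> /andP[wc bc] /andP[wd bd]; rewrite /= wc wd bc bd.
apply: (sq); first by apply: (sq).
apply: (sq); last by apply: (sq); apply: (mat).
apply/andP; split; last by apply: boundable_loops; rewrite //= bl.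
apply: wf_loops => //=; first by rewrite wl.
by move=> x hx; rewrite orbF; apply/negP => /ml/(nsc _ hx).
Qed.


(** * Register programs run in polynomial time *)

Definition machine (F : frag unit) : TM :=
  {| tst := (fstate F + bool)%type; tstart := inl (fstart F);
     tacc := inr true; trej := inr false;
     tdelta := fun q a => match q with
       | inl s => let: (r, w, d) := fdelta s a in
           (match r with inl s' => inl s' | inr _ => inr true end, w, d)
       | inr b => (inr b, a, DS)
       end |}.

Lemma machine_run (F : frag unit) s tp p t y tp' p' :
  frun (F := F) s tp p t y tp' p' ->
  iter t (@astep (machine F)) (inl s, tp, p) = (inr true, tp', p').
Proof.
elim=> {s tp p t y tp' p'} [s tp p y w d e|s tp p s' w d t y tp' p' e _ IH].
  by rewrite /= /adelta /ahalted /= e.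
by rewrite iterSr {2}/astep /adelta /ahalted /= e.
Qed.

Lemma machine_computes (F : frag unit) (f : seq bool -> seq bool) (g : nat -> nat) :
  polybounded g ->
  (forall x, exists tp, texec F (word_tape x) 0%Z (g (size x)) tt tp 0%Z /\
     forall i, tp (Z.of_nat i) = nth None (map Some (f x)) i) ->
  poly_computable f.
Proof.
move=> /polyb_pb[c [k gE]] h; exists (machine F), c, k => x.
have [tp [[t le r] tpE]] := h x; exists t; split; first exact: leq_trans le (gE _).
have := rep_run (machine F) t x; rewrite (machine_run r) => /rep_output; apply => i.
by rewrite tpE.
Qed.

Definition setarr (s : st) j v :=
  St (reg s) (fun j' => if j' == j then v else arr s j') (out s).

Lemma texec_setarr W s r b N : r.+2 < W -> 1 < W -> bounded N s ->
  texec (access W r.+2 1 (fun=> (tt, Some b))) (stape W s) home (unitcost W N) tt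
    (stape W (setarr s (reg s r) (Some b))) home.
Proof.
move=> hr hW [h _].
have -> : stape W (setarr s (reg s r) (Some b)) =
    ltape W (updc (cellsof s) 1 (reg s r) (Some b)) (out s).
  congr ltape; apply: functional_extensionality => w; apply: functional_extensionality => j.
  by rewrite /updc; case: w => [|[|w]] //=; case: eqP.
apply: (@texec_le _ _ _ _ ((reg s r).+1 * (6 * (W + 5)))); first by rewrite leq_mul2r ltnS h orbT.
apply: texec_access => //=; first exact: marked_cellsof.
- by move=> i ->.
- by rewrite ltnn.
Qed.

(** [i] bits have been popped from the end of the input and stored in that order, hence reversed;
    [rN] counts them and ends as |x|. *)
Definition partly_loaded (x : seq bool) (i : nat) : st :=
  St (fun r => if r == rN then i else 0)
     (fun j => if j < i then Some (nth false x (size x - j.+1)) else None)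
     (take (size x - i) x).

Definition loaded (x : seq bool) : st :=
  St (fun r => if r == rN then size x else 0)
     (fun j => if j < size x then Some (nth false x (size x - j.+1)) else None) [::].

Definition load (W : nat) : frag unit :=
  loop (bind pop (fun o => if o is Some b then
    access W rN.+2 1 (fun=> (tt, Some b)) ;;
    access W rN.+2 rN.+2 (fun=> (tt, Some true)) ;; ret None
  else ret (Some tt))).

Lemma texec_load W x : rN.+2 < W ->
  texec (load W) (stape W (partly_loaded x 0)) home
    ((size x).+1 * (2 * size x + 11 + 2 * unitcost W (size x))) tt (stape W (loaded x)) home.
Proof.
move=> hW; set C := 2 * size x + 11 + _.
have W1 : 1 < W by apply: leq_trans hW.
suff gen k i : i + k = size x -> texec (load W) (stape W (partly_loaded x i)) home (k.+1 * C) tt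
    (stape W (loaded x)) home by exact: gen.
elim: k i => [|k IH] i e.
  have -> : partly_loaded x i = loaded x.
    by rewrite /partly_loaded -e addn0 subnn take0 /loaded -e addn0.
  apply: texec_loop_exit; apply: (@texec_le _ _ _ _ (6 + 1)); first by rewrite /C; lia.
  by apply: texec_bind; [exact: texec_pop_nil|exact: texec_ret].
rewrite mulSn; apply: texec_loop_next (IH i.+1 _); last by rewrite addSnnS.
set s := partly_loaded x i.
set o := take (size x - i.+1) x; set b := nth false x (size x - i.+1).
have outE : out s = rcons o b.
  by rewrite /= (_ : size x - i = (size x - i.+1).+1) ?(take_nth false) //; lia.
have so : size o <= size x by rewrite size_take; case: ifP => //; lia.
pose s1 := St (reg s) (arr s) o.
have b1 : bounded (size x) s1.
  by split=> //= r; case: eqP => //; lia.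
apply: (@texec_le _ _ _ _ (2 * size o + 10 + (unitcost W (size x) + (unitcost W (size x) + 1)))).
  by rewrite /C; lia.
apply: texec_bind.
  by rewrite /stape outE; exact: texec_pop_rcons.
have ri : reg s1 rN = i by [].
apply: (@texec_bind _ _ _ _ _ _ _ tt (stape W (setarr s1 i (Some b))) home).
  by rewrite -[X in setarr s1 X]ri; exact: texec_setarr b1.
apply: texec_bind; last exact: texec_ret.
have -> : partly_loaded x i.+1 = increg rN (setarr s1 i (Some b)).
  apply: st_ext => //= [r|]; first by case: eqP.
  apply: functional_extensionality => j; rewrite ltnS leq_eqVlt.
  by case: eqP => // ->.
by apply: texec_inc => //; case: b1.
Qed.

Theorem cmd_poly (prog : cmd) (g : nat -> nat) : wf prog -> polybounded g ->
  (forall x, cost prog (loaded x) <= g (size x)) ->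
  poly_computable (fun x => out (sem prog (loaded x))).
Proof.
(* The extra 40 tracks include that of [rN], which loading needs whatever the width of [prog]. *)
move=> hwf pg hg; pose W := width prog + 40.
pose T n := 3 + (1 + (n.+1 * (2 * n + 11 + 2 * unitcost W n) +
   (g n * unitcost W (n + g n) + 3))).
apply: (@machine_computes (mv DL 2 ;; wr (Some true) ;; load W ;; compile W prog ;; mv DR 2) _ T).
  have pu h : polybounded h -> polybounded (fun n => unitcost W (h n)).
    move=> ph; apply: pb_mul (pb_const _).
    by apply: pb_le (pb_add ph (pb_const 1)) => n; rewrite addn1.
  apply: pb_add (pb_const _) _; apply: pb_add (pb_const _) _.
  apply: pb_add; last apply: pb_add (pb_const _).
    apply: pb_mul; first by apply: pb_le (pb_add pb_id (pb_const 1)) => n; rewrite addn1.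
    apply: pb_add; last by apply: pb_mul (pb_const _) (pu _ pb_id).
    by apply: pb_add (pb_const _); apply: pb_mul (pb_const _) pb_id.
  by apply: (pb_mul pg (pu _ _)); apply: (pb_add pb_id pg).
move=> x; set s' := sem prog (loaded x).
exists (stape W s'); split; last by move=> i; rewrite /stape ltape_pos.
(* Once the marker is written, the initial tape is the layout with zero registers, an empty array
   and all of x still to be read. *)
have t0 : upd (word_tape x) home (Some true) = stape W (partly_loaded x 0).
  apply: functional_extensionality => z; rewrite /upd /stape /ltape /word_tape /= subn0 take_size.
  case: Z.eqb_spec => [->|ne] /=; first by rewrite mod0n div0n.
  case: Z.leb_spec => // h0; case: Z.eqb_spec => // h1.
  have : 0 < Z.to_nat (-2 - z) by move: ne; rewrite /home; lia.
  set q := Z.to_nat _ => q0.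
  case em : (q %% W) => [|[|w]] //=; last by rewrite if_same.
  case: eqP => // ed; move: q0; rewrite (divn_eq q W) em ed; lia.
apply: texec_bind; first exact: (@texec_mvL _ _ _ home).
apply: texec_bind; first exact: texec_wr.
rewrite t0; apply: texec_bind; first by apply: texec_load; rewrite /rN /W; lia.
apply: texec_bind; last exact: (@texec_mvR 2 _ home 0%Z erefl).
have bl : bounded (size x) (loaded x) by split=> //= r; case: eqP.
apply: texec_le (texec_compile _ hwf bl); last by rewrite /W; lia.
by apply: leq_mul; rewrite ?hg // /unitcost leq_mul2r ltnS leq_add2l hg orbT.
Qed.


(** * The reduction *)

Lemma dec_unary_enc n s : dec_unary (nseq n true ++ false :: s) = Some (n, s).
Proof. by elim: n => //= n ->. Qed.

Lemma dec_nats_enc labs s :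
  dec_nats (size labs) (flatten [seq nseq l true ++ [:: false] | l <- labs] ++ s) = Some (labs, s).
Proof. by elim: labs => //= l labs IH; rewrite -!catA dec_unary_enc IH. Qed.

Lemma dec_bits_enc k u s : size u = k -> dec_bits k (u ++ s) = Some (u, s).
Proof.
by move=> su; rewrite /dec_bits size_cat su leq_addr -su take_size_cat // drop_size_cat.
Qed.

Lemma dec_fles_enc N labs lts cfs s :
  size labs = N -> size lts = N * N -> size cfs = N * N ->
  dec_fles (enc_fles N labs lts cfs ++ s) =
  Some (Fles N (mx_of N lts) (mx_of N cfs) (fun i => nth 0 labs i), s).
Proof.
move=> sl st sc; rewrite /dec_fles /enc_fles -catA /= dec_unary_enc -!catA -{1}sl.
by rewrite dec_nats_enc !dec_bits_enc.
Qed.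

Lemma nth_allpairs (T : Type) (x0 : T) (f : T -> T -> bool) (s t : seq T) i j :
  i < size s -> j < size t ->
  nth false [seq f x y | x <- s, y <- t] (i * size t + j) = f (nth x0 s i) (nth x0 t j).
Proof.
elim: s i => // x s IH [|i] /= hi hj.
  by rewrite nth_cat size_map hj (nth_map x0).
by rewrite nth_cat size_map mulSn -addnA ltnNge leq_addr /= addKn IH.
Qed.

Lemma tuple_fles_mx B D (lab lab' : seq nat -> nat) (lt lt' cf cf' : seq nat -> seq nat -> bool) :
  let T := tups B D in
  {in T, lab =1 lab'} -> {in T &, lt =2 lt'} -> {in T &, cf =2 cf'} ->
  tuple_fles B D lab lt cf
    (Fles (B ^ D) (mx_of (B ^ D) [seq lt' d d' | d <- T, d' <- T])
       (mx_of (B ^ D) [seq cf' d d' | d <- T, d' <- T])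
       (fun i => nth 0 [seq lab' d | d <- T] i)).
Proof.
move=> T hlab hlt hcf; have sT : size T = B ^ D by apply: size_tups.
have mT i : i < B ^ D -> nth [::] T i \in T by rewrite -sT => h; apply: mem_nth.
split=> //= [i hi|i j hi hj|i j hi hj].
- by rewrite (nth_map [::]) ?sT // hlab ?mT.
- by rewrite /mx_of hi hj -sT (nth_allpairs [::]) ?sT //= hlt ?mT.
- by rewrite /mx_of hi hj -sT (nth_allpairs [::]) ?sT //= hcf ?mT.
Qed.

Section Instance.
Variables (M : TM) (A : nat -> option bool) (rho : env).
Hypothesis one : rho r1 = 1.
Hypothesis B7 : 6 < rho rB.

Local Notation B := (rho rB).
Local Notation T := (tups B 15).

Definition gadget labE ltF cfF : fles :=
  Fles (B ^ 15) (mx_of (B ^ 15) [seq feval A (both rho d d') ltF | d <- T, d' <- T])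
    (mx_of (B ^ 15) [seq feval A (both rho d d') cfF | d <- T, d' <- T])
    (fun i => nth 0 [seq labE (low rho d) | d <- T] i).

Definition gadget1 := gadget (lab1E A) order1F conflict1F.
Definition gadget2 := gadget (lab2E A M) order2F conflict2F.

Definition legalT (d : seq nat) : bool :=
  legalB M (rho rN) (rho rP) (rho rT) (fun j => A j == Some true)
    (dig d 1) (dig d 2) (dig d 3) (dig d 4) (dig d 5) (dig d 6) (dig d 7)
    (dig d 8) (dig d 9) (dig d 10) (dig d 11) (dig d 12) (dig d 13) (dig d 14).

Lemma size_tup d : d \in T -> size d = 15.
Proof. by rewrite mem_tups => /andP[/eqP]. Qed.

Lemma lowE d r : size d = 15 -> low rho d r = if r < 15 then dig d r else rho r.
Proof. by move=> sd; rewrite /low setrs_iota //= subn0. Qed.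

Lemma bothE d d' r : size d = 15 -> size d' = 15 ->
  both rho d d' r = if 15 <= r < 30 then dig d' (r - 15) else low rho d r.
Proof. by move=> sd sd'; rewrite /both setrs_iota. Qed.

Lemma low_take d : size d = 15 -> [seq low rho d k | k <- iota 0 5] = take 5 d.
Proof.
move=> sd; rewrite {2}(all_dig d) -map_take sd take_iota; apply/eq_in_map => k.
by rewrite mem_iota => /andP[_ hk]; rewrite lowE // ifT //; lia.
Qed.

Lemma low_digits d k : size d = 15 -> k < 15 -> low rho d (0 + k) = dig d k.
Proof. by move=> sd hk; rewrite lowE ?hk. Qed.

Lemma low_one d : size d = 15 -> low rho d r1 = 1.
Proof. by move=> sd; rewrite lowE. Qed.

Lemma gadget1_tuple : tuple_fles B 15 (lab1 B) (tuple_lt 15 ch1 supp1)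
  (fun d d' => clash (supp1 d) (supp1 d')) gadget1.
Proof.
apply: tuple_fles_mx => [d /size_tup sd|d d' /size_tup sd /size_tup sd'|
                         d d' /size_tup sd /size_tup sd'].
- have h k hk := @low_digits d k sd hk.
  rewrite /lab1E /lab1 feval_disj feval_conj low_take // (feval_vis A (low_one sd) sd h).
  by rewrite (feval_con A (low_one sd) h) (feval_rest A sd h) lowE.
- have h k : k < 15 -> both rho d d' (0 + k) = dig d k.
    by move=> hk; rewrite bothE // ifF ?lowE ?hk //; lia.
  have h' k : k < 15 -> both rho d d' (15 + k) = dig d' k.
    by move=> hk; rewrite bothE // ifT ?addKn //; lia.
  have o : both rho d d' r1 = 1 by rewrite bothE // low_one.
  apply/esym/(feval_order o sd sd' h h').
  + exact: (feval_type A (o := 0) o h).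
  + exact: (feval_type A (o := 15) o h').
  + exact: (feval_supp1 A (o := 0) o h).
  + exact: (feval_supp1 A (o := 15) o h').
- have h k : k < 15 -> both rho d d' (0 + k) = dig d k.
    by move=> hk; rewrite bothE // ifF ?lowE ?hk //; lia.
  have h' k : k < 15 -> both rho d d' (15 + k) = dig d' k.
    by move=> hk; rewrite bothE // ifT ?addKn //; lia.
  have o : both rho d d' r1 = 1 by rewrite bothE // low_one.
  by rewrite /conflict1F feval_clash (feval_supp1 A o h) (feval_supp1 A o h').
Qed.

Lemma gadget2_tuple : tuple_fles B 15 (lab2 legalT B) (tuple_lt 15 ch2 supp2)
  (fun d d' => clash (supp2 d) (supp2 d')) gadget2.
Proof.
apply: tuple_fles_mx => [d /size_tup sd|d d' /size_tup sd /size_tup sd'|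
                         d d' /size_tup sd /size_tup sd'].
- have h k hk := @low_digits d k sd hk.
  rewrite /lab2E /lab2 low_take // (feval_vis A (low_one sd) sd h).
  rewrite (feval_con A (low_one sd) h) feval_legal ?low_one //.
  by rewrite /legalT !lowE.
- have h k : k < 15 -> both rho d d' (0 + k) = dig d k.
    by move=> hk; rewrite bothE // ifF ?lowE ?hk //; lia.
  have h' k : k < 15 -> both rho d d' (15 + k) = dig d' k.
    by move=> hk; rewrite bothE // ifT ?addKn //; lia.
  have o : both rho d d' r1 = 1 by rewrite bothE // low_one.
  apply/esym/(feval_order o sd sd' h h').
  + exact: (feval_type A (o := 0) o h).
  + exact: (feval_type A (o := 15) o h').
  + exact: (feval_supp2 A (o := 0) o sd h).
  + exact: (feval_supp2 A (o := 15) o sd' h').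
- have h k : k < 15 -> both rho d d' (0 + k) = dig d k.
    by move=> hk; rewrite bothE // ifF ?lowE ?hk //; lia.
  have h' k : k < 15 -> both rho d d' (15 + k) = dig d' k.
    by move=> hk; rewrite bothE // ifT ?addKn //; lia.
  have o : both rho d d' r1 = 1 by rewrite bothE // low_one.
  by rewrite /conflict2F feval_clash (feval_supp2 A o sd h) (feval_supp2 A o sd' h').
Qed.

Definition enc_gadget labE ltF cfF :=
  enc_fles (B ^ 15) [seq labE (low rho d) | d <- T]
    [seq feval A (both rho d d') ltF | d <- T, d' <- T]
    [seq feval A (both rho d d') cfF | d <- T, d' <- T].

Lemma dec_gadgets l1 lt1 cf1 l2 lt2 cf2 :
  dec_instance (enc_gadget l1 lt1 cf1 ++ enc_gadget l2 lt2 cf2) =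
  Some (gadget l1 lt1 cf1, gadget l2 lt2 cf2).
Proof.
have sz : size T = B ^ 15 by apply: size_tups.
have dec l lt cf s : dec_fles (enc_gadget l lt cf ++ s) = Some (gadget l lt cf, s).
  by apply: dec_fles_enc; [rewrite size_map|rewrite size_allpairs|rewrite size_allpairs]; rewrite !sz.
by rewrite /dec_instance dec -[X in dec_fles X]cats0 dec.
Qed.

Lemma INCL_gadgets :
  INCL (enc_gadget (lab1E A) order1F conflict1F ++ enc_gadget (lab2E A M) order2F conflict2F) <->
  lang_incl gadget1 gadget2.
Proof.
split=> [[E1 [E2 [d [_ [_ h]]]]]|h].
  by move: d h; rewrite dec_gadgets => -[<- <-].
exists gadget1, gadget2; rewrite dec_gadgets; split=> //; split.
  by have [] := lang1 B7 gadget1_tuple.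
by split=> //; have [] := lang2 B7 gadget2_tuple.
Qed.

End Instance.

(** * Computing the parameters of an instance *)

Fixpoint incs r k : cmd := if k is k'.+1 then Seq (Inc r) (incs r k') else Skip.

Lemma adds_incs r b k : r != b -> adds r [::] b (incs r k) (fun=> k).
Proof.
move=> rb; elim: k => [|k IH] s z /=.
  by rewrite addn0; apply: st_ext => // x /=; case: eqP => // ->.
exact: (adds_seq (Z := [::]) _ rb (adds_inc r b) IH z).
Qed.

Lemma adds_loops r b c g vs : uniq vs -> r != b -> r \notin vs -> b \notin vs ->
  adds r [::] b c g -> adds r vs b (loops vs b c) (fun v => v ^ size vs * g v).
Proof.
move=> + rb; elim: vs => [|v vs IH] /=.
  by move=> _ _ _ h s z; rewrite mul1n; apply: h.
rewrite !inE !negb_or => /andP[vn u] /andP[rv rn] /andP[bv bn] h s z.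
rewrite (adds_for _ rv rb rn vn (IH u rn bn h)) // 1?eq_sym //.
by rewrite expnS mulnA.
Qed.

(** [boundable] forbids incrementing a register that bounds a loop, so the work is done in stages,
    each computing loop bounds for a later one: here [rM], then [rB]. *)
Definition setup1 : cmd := Seq (Inc r1) (Seq (For 40 rN (Inc rM)) (incs rM 2)).

Definition power r K := loops (iota 40 K) rM (Inc r).

Definition setup2 c k K : cmd :=
  Seq (loops (iota 40 k) rN (incs rP c)) (Seq (incs rP c) (Seq (power rT K) (power rB K.+2))).

Definition consts n p t b o m : env := fun r =>
  if r == rN then n else if r == rP then p else if r == rT then t
  else if r == rB then b else if r == r1 then o else if r == rM then m else 0.

Definition params c k K (n : nat) : env :=
  consts n (polyb c k n) (n.+2 ^ K) (n.+2 ^ K.+2) 1 n.+2.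

Lemma sem_setup c k K x :
  sem (Seq setup1 (setup2 c k K)) (loaded x) =
  St (params c k K (size x)) (arr (loaded x)) [::].
Proof.
set n := size x; set a := arr (loaded x).
pose S p t b o m := St (consts n p t b o m) a [::].
have addsE r vs b0 d g p t b o m : adds r vs b0 d g -> all (fun r => 36 <= r) vs ->
    sem d (S p t b o m) = setreg (S p t b o m) r (consts n p t b o m r + g (consts n p t b o m b0)).
  move=> h hv; apply: h => r' hr' /=; have {hr'} hr : 36 <= r' by apply: (allP hv).
  by rewrite /consts /rN /rP /rT /rB /r1 /rM; do 6 (rewrite ifF; last lia).
have l40 l : all (fun r => 36 <= r) (iota 40 l).
  by apply/allP => r; rewrite mem_iota; lia.
have n40 r l : r < 36 -> r \notin iota 40 l by rewrite mem_iota; lia.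
have sP p t b o m v : setreg (S p t b o m) rP v = S v t b o m.
  by apply: st_ext => // r; rewrite /= /consts; do !case: eqP => // ->.
have sT p t b o m v : setreg (S p t b o m) rT v = S p v b o m.
  by apply: st_ext => // r; rewrite /= /consts; do !case: eqP => // ->.
have sB p t b o m v : setreg (S p t b o m) rB v = S p t v o m.
  by apply: st_ext => // r; rewrite /= /consts; do !case: eqP => // ->.
have s1 p t b o m v : setreg (S p t b o m) r1 v = S p t b v m.
  by apply: st_ext => // r; rewrite /= /consts; do !case: eqP => // ->.
have sM p t b o m v : setreg (S p t b o m) rM v = S p t b o v.
  by apply: st_ext => // r; rewrite /= /consts; do !case: eqP => // ->.
have seqE c1 c2 s : sem (Seq c1 c2) s = sem c2 (sem c1 s) by [].
have -> : loaded x = S 0 0 0 0 0.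
  by apply: st_ext => // r; rewrite /= /consts; do !case: eqP => //.
rewrite /setup1 /setup2 /power !seqE.
rewrite (addsE _ _ _ _ _ _ _ _ _ _ (adds_inc r1 rN)) // s1.
have hM : adds rM [:: 40] rN (For 40 rN (Inc rM)) (fun v => v * 1).
  exact: adds_for (adds_inc rM rN).
rewrite (addsE _ _ _ _ _ _ _ _ _ _ hM) // sM.
rewrite !(addsE _ _ _ _ _ _ _ _ _ _ (adds_inc rM rN)) // sM.
rewrite (addsE _ _ _ _ _ _ _ _ _ _ (adds_inc rM rN)) // sM [sem Skip _]/=.
set m := (X in S _ _ _ _ X); have -> : m = n.+2 by rewrite /m /consts /=; lia.
have hP := @adds_incs rP rN c isT.
have hP' := adds_loops (iota_uniq 40 k) (isT : rP != rN) (n40 rP k isT) (n40 rN k isT) hP.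
rewrite (addsE _ _ _ _ _ _ _ _ _ _ hP') // sP.
rewrite (addsE _ _ _ _ _ _ _ _ _ _ hP) // sP.
have hT := adds_loops (iota_uniq 40 K) (isT : rT != rM) (n40 rT K isT) (n40 rM K isT) (adds_inc rT rM).
rewrite (addsE _ _ _ _ _ _ _ _ _ _ hT) // sT.
have hB := adds_loops (iota_uniq 40 K.+2) (isT : rB != rM) (n40 rB K.+2 isT) (n40 rM K.+2 isT) (adds_inc rB rM).
rewrite (addsE _ _ _ _ _ _ _ _ _ _ hB) // sB.
by rewrite !size_iota /consts /= !muln1 !add0n /params /polyb [n ^ k * c]mulnC.
Qed.

Lemma wf_seq c d : wf (Seq c d) = wf c && wf d.
Proof. by []. Qed.

Lemma boundable_seq Bd c d : boundable Bd (Seq c d) = boundable Bd c && boundable Bd d.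
Proof. by []. Qed.

Lemma wf_incs r k : wf (incs r k).
Proof. by elim: k. Qed.

Lemma mods_incs r k v : mods (incs r k) v -> v == r.
Proof. by elim: k => //= k IH /orP[|/IH]. Qed.

Lemma boundable_incs (Bd : pred nat) r k : ~~ Bd r -> boundable Bd (incs r k).
Proof. by move=> h; elim: k => //= k ->; rewrite h. Qed.

Lemma wf_setup2 c k K : wf (setup2 c k K).
Proof.
have w r b l d : r < 36 -> b < 36 -> r != b -> wf d -> (forall v, mods d v -> v == r) ->
    wf (loops (iota 40 l) b d).
  move=> hr hb rb wd hd; apply: wf_loops => // [|v].
    by rewrite /= iota_uniq mem_iota andbT; lia.
  rewrite inE mem_iota => hv; apply/negP => /hd /eqP e; move: hv; rewrite e (negbTE rb) /=; lia.
rewrite /setup2 /power !wf_seq; apply/and4P; split.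
- by apply: (w rP) => //; [exact: wf_incs|exact: mods_incs].
- exact: wf_incs.
- by apply: (w rT) => // v /= /eqP ->.
by apply: (w rB _ K.+2) => // v /= /eqP ->.
Qed.

Section Generator.
Variables (M : TM) (c k K : nat).

Definition generator : cmd :=
  Seq (Seq setup1 (setup2 c k K))
      (Seq (genC lab1C order1F conflict1F) (genC (lab2C M) order2F conflict2F)).

Lemma lowvars_structure :
  [&& lowvars order1F, lowvars conflict1F, lowvars order2F & lowvars conflict2F].
Proof. by vm_compute. Qed.

Lemma good_generator :
  [/\ wf generator, wf setup1, boundable (pred1 rN) setup1, boundable (pred2 rN rM) (setup2 c k K) &
     boundable low_reg (Seq (genC lab1C order1F conflict1F) (genC (lab2C M) order2F conflict2F))].
Proof.
have s1 : wf setup1 by [].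
have s2 : boundable (pred1 rN) setup1 by [].
have s3 : boundable (pred2 rN rM) (setup2 c k K).
  by rewrite /setup2 /power !boundable_seq !boundable_loops ?boundable_incs.
have /and4P[l1 l2 l3 l4] := lowvars_structure.
have /andP[w1 b1] := good_gen l1 l2 good_lab1.
have /andP[w2 b2] := good_gen l3 l4 (good_lab2 M).
have seqP (P Q : bool) : P -> Q -> P && Q by move=> -> ->.
exact: And5 (seqP _ _ (seqP _ _ s1 (wf_setup2 c k K)) (seqP _ _ w1 w2)) s1 s2 s3 (seqP _ _ b1 b2).
Qed.

(** The cost of one stage bounds the registers with which the next begins, by [bounded_sem], and
    [maxcost] is polynomial in that bound; so three polynomials are composed. *)
Lemma cost_generator : exists2 g, polybounded g & forall x, cost generator (loaded x) <= g (size x).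
Proof.
have [wg w1 b1 b2 b3] := good_generator.
have w2 := wf_setup2 c k K.
have w3 : wf (Seq (genC lab1C order1F conflict1F) (genC (lab2C M) order2F conflict2F)).
  by move: wg => /andP[].
move: b3 w3; rewrite /generator; set gen := Seq (genC _ _ _) _ => b3 w3; clearbody gen.
pose g1 := maxcost setup1.
pose g2 n := maxcost (setup2 c k K) (n + g1 n).
pose g3 n := maxcost gen (n + g1 n + g2 n).
have p1 : polybounded g1 := pb_maxcost setup1.
have pn1 : polybounded (fun n => n + g1 n) := pb_add pb_id p1.
have p2 : polybounded g2 := pb_comp (pb_maxcost _) pn1.
have p3 : polybounded g3 := pb_comp (pb_maxcost _) (pb_add pn1 p2).
exists (fun n => g1 n + g2 n + g3 n); first exact: pb_add (pb_add p1 p2) p3.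
move=> x; set n := size x.
have bl : bounded n (loaded x) by split=> //= r; case: eqP.
have c1 : cost setup1 (loaded x) <= g1 n.
  by have [] := cost_max (R := n) w1 b1 (fun r _ => bl.1 r).
have bs1 : bounded (n + g1 n) (sem setup1 (loaded x)).
  by apply: bounded_le (bounded_sem setup1 bl); rewrite leq_add2l.
have c2 : cost (setup2 c k K) (sem setup1 (loaded x)) <= g2 n.
  by have [] := cost_max w2 b2 (fun r _ => bs1.1 r).
have bs2 : bounded (n + g1 n + g2 n) (sem (setup2 c k K) (sem setup1 (loaded x))).
  by apply: bounded_le (bounded_sem _ bs1); rewrite leq_add2l.
have c3 := (cost_max w3 b3 (fun r _ => bs2.1 r)).1.
by apply: leq_add c3; apply: leq_add c1 c2.
Qed.

Lemma out_generator x (A := arr (loaded x)) (rho := params c k K (size x)) :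
  out (sem generator (loaded x)) =
  enc_gadget A rho (lab1E A) order1F conflict1F ++ enc_gadget A rho (lab2E A M) order2F conflict2F.
Proof.
have /and4P[l1 l2 l3 l4] := lowvars_structure.
have e := emits_seq (emits_gen l1 l2 (@emits_lab1 A)) (emits_gen l3 l4 (@emits_lab2 A M)).
rewrite -[sem generator _]/(sem (Seq (genC lab1C order1F conflict1F)
  (genC (lab2C M) order2F conflict2F)) (sem (Seq setup1 (setup2 c k K)) (loaded x))).
rewrite sem_setup e; [exact: erefl|by []|move=> r; rewrite mem_cat mem_iota => hr].
have {}hr : r < 30 \/ 36 <= r.
  by case/orP: hr => [|]; [|rewrite /scratch mem_cat mem_iota /tmps !inE]; lia.
rewrite [LHS]/= /params /consts /rN /rP /rT /rB /r1 /rM.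
by do 6 (rewrite ifF; last lia).
Qed.

End Generator.

(** * Choice of the exponent and conclusion *)

Lemma expn_mono k m n : m <= n -> m ^ k <= n ^ k.
Proof. by move=> h; case: k => // k; rewrite leq_exp2r. Qed.

Lemma polyb_mono c k m n : m <= n -> polyb c k m <= polyb c k n.
Proof. by move=> h; rewrite leq_add2r leq_mul2l expn_mono ?orbT. Qed.

Lemma size_enc_tuple3 x y z :
  size (enc_tuple [:: x; y; z]) = (size x + size y + size z + 3).*2.
Proof.
have dbl (w : seq bool) : size (flatten [seq [:: b; b] | b <- w]) = (size w).*2.
  by elim: w => //= b w ->.
by rewrite /enc_tuple /= !size_cat /= !dbl; lia.
Qed.

Lemma trun_halted M s t T : t <= T -> halted (trun M t s) -> trun M T s = trun M t s.
Proof.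
move=> le h; rewrite -(subnK le) /trun iterD -/(trun M t s).
by elim: (T - t) => //= m ->; rewrite /tstep h.
Qed.

Theorem theorem4 : PiP2_hard INCL.
Proof.
move=> L [V [c [k [[M [cV [kV dec]]] hL]]]].
pose p n := polyb c k n.
(* [X] collects all that T must dominate: the running time on an encoded triple of maximal length,
   the number of states, |x| and the bound on y and z. *)
pose X n := polyb cV kV (n + p n + p n + 3).*2 + #|tst M| + n + p n + 8.
have pX : polybounded X.
  have pp := pb_polyb c k.
  have pd : polybounded (fun n => (n + p n + p n + 3).*2).
    apply: pb_le (pb_mul (pb_const 2) (pb_add (pb_add (pb_add pb_id pp) pp) (pb_const 3))) => n.
    by rewrite mul2n.
  exact: pb_add (pb_add (pb_add (pb_add (pb_comp (pb_polyb cV kV) pd) (pb_const _)) pb_id) pp) (pb_const _).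
have [K XK] : exists K, forall n, X n <= n.+2 ^ K.
  have [C [e h]] := pX; exists (C + e) => n; apply: leq_trans (h n) _.
  (* With a base of at least 2, the constant factor [C] is absorbed by the exponent, since [C] is
     below [2 ^ C]. *)
  rewrite expnD; apply: leq_mul; last by apply: expn_mono.
  by apply: leq_trans (expn_mono C (isT : 2 <= n.+2)); apply/ltnW/ltn_expl.
have [wg _ _ _ _] := good_generator M c k K.
have [g pg hg] := cost_generator M c k K.
exists (fun x => out (sem (generator M c k K) (loaded x))); split.
  exact: cmd_poly wg pg hg.
move=> x; rewrite out_generator.
set A := arr (loaded x); set rho := params c k K (size x).
set n := size x in rho *; set T := n.+2 ^ K.
have X0 : X n <= T := XK n.
have BE : rho rB = n.+2 ^ K.+2 by [].
(* The two extra powers of |x| + 2 give a factor of at least 4: two for the cells, one for the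
   remaining summands of [X], one to spare. *)
have B4 : 4 * T <= rho rB.
  by rewrite BE !expnS mulnA leq_mul2r; apply/orP; right; nia.
have B7 : 6 < rho rB by rewrite /X in X0; lia.
rewrite (INCL_gadgets M A (rho := rho) erefl B7).
rewrite (incl_csp B7 (gadget1_tuple A erefl B7) (gadget2_tuple M A erefl B7)).
have T0 : 0 < T by rewrite /X in X0; lia.
have Bgt : T.*2 + #|tst M| + size x + p n + 7 < rho rB by rewrite /X in X0; lia.
have xrE j : j < size x -> (A j == Some true) = nth false x (size x - j.+1).
  by move=> hj; rewrite /A /= hj; case: nth.
have -> : legalT M A rho = legalC M x (p n) T (fun j => A j == Some true) by [].
rewrite (@csp_cook_levin M x (p n) T (rho rB) _ T0 Bgt xrE) hL.
have acc y z : size y <= p n -> size z <= p n ->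
    (acfg_at M (enc_tuple [:: x; y; z]) T).1.1 = tacc M <-> V (enc_tuple [:: x; y; z]).
  (* The decider halts by time T and then keeps its state, so its answer can be read at T. *)
  move=> hy hz; set s := enc_tuple _; have [t [ht [hh <-]]] := dec s.
  have tT : t <= T.
    apply: leq_trans ht _; apply: (@leq_trans (polyb cV kV (n + p n + p n + 3).*2)).
      by apply: polyb_mono; rewrite size_enc_tuple3 leq_double -/n; lia.
    by apply: leq_trans X0; rewrite /X; lia.
  rewrite -(trun_halted tT hh); have := rep_run M T s; rewrite -/(acfg_at M s T).
  by case: (trun _ _ _) => [[[q l] h] r]; case: (acfg_at M s T) => [[q' tp] pos] [->].
split=> h y hy; have [z hz hv] : exists2 z, size z <= p n & V (enc_tuple [:: x; y; z]).
- by have [z [hz hv]] := h y hy; exists z.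
- by exists z => //; apply/acc.
- by have [z hz /acc hv] := h y hy; exists z => //; apply: hv.
by exists z.
Qed.
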